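(* Let $({\mathcal U}_q^{\widehat w_n})'$ be the cocycle twist of ${\mathcal U}_q^{\widehat w_n}$ by the bicharacter $\beta$, with generators $X_i',Y_i',\overline X_i',\overline Y_i'$ ($1\le i\le n$). Then the assignment $X_i'\mapsto(-1)^{n+1-i}X_{1,n+1-i}$, $\overline X_i'\mapsto(-1)^{n+1-i}X_{2,n+1-i}$, $Y_i'\mapsto X_{1,n+i}$, $\overline Y_i'\mapsto X_{2,n+i}$ extends to an algebra isomorphism $({\mathcal U}_q^{\widehat w_n})'\cong\mathbb X_{n,q}$.
   Context: $k$ algebraically closed of characteristic $0$, $q\in k^\times$ transcendental over $\mathbb Q$, $\hat q=q-q^{-1}$, $n\ge3$, $[u,v]=uv-q^{-1}vu$. $Q(D_{n+1})$: lattice of $(a_1,\dots,a_{n+1})\in\mathbb Z^{n+1}$ with even coordinate sum, standard inner product; $Q(\widehat D_{n+1})=Q(D_{n+1})\oplus\mathbb Z\delta$ with $\delta$ orthogonal to everything; simple roots $\alpha_0=-e_{n+1}-e_n+\delta$, $\alpha_1=e_1+e_2$, $\alpha_i=e_i-e_{i-1}$ ($2\le i\le n+1$); reflections $s_i(\mu)=\mu-\langle\mu,\alpha_i\rangle\alpha_i$. ${\mathcal U}_q(\widehat{\mathfrak{so}}_{2n+2})$ is generated by $E_i,F_i$ ($0\le i\le n+1$), $K_\mu$ ($\mu\in Q(\widehat D_{n+1})$) with relations $K_0=1$, $K_\mu K_\lambda=K_{\mu+\lambda}$, $K_\mu E_i=q^{\langle\mu,\alpha_i\rangle}E_iK_\mu$,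 $K_\mu F_i=q^{-\langle\mu,\alpha_i\rangle}F_iK_\mu$, $E_iE_j=E_jE_i$, $F_iF_j=F_jF_i$ if $\langle\alpha_i,\alpha_j\rangle\in\{0,2\}$, $E_i[E_i,E_j]=q[E_i,E_j]E_i$, $F_i[F_i,F_j]=q[F_i,F_j]F_i$ if $\langle\alpha_i,\alpha_j\rangle=-1$, $E_iF_j-F_jE_i=\delta_{ij}(K_{\alpha_i}-K_{-\alpha_i})/\hat q$. Lusztig automorphisms: $T_iK_\mu=K_{s_i\mu}$, $T_iE_i=-F_iK_{\alpha_i}$, $T_iF_i=-K_{-\alpha_i}E_i$, and for $j\ne i$, $T_iE_j=E_j$ if $\langle\alpha_i,\alpha_j\rangle=0$, $T_iE_j=E_iE_j-q^{-1}E_jE_i$ if $\langle\alpha_i,\alpha_j\rangle=-1$. $\widehat w_n=(s_{n+1}\cdots s_1)(s_3\cdots s_{n+1})s_0(s_n\cdots s_3)(s_1\cdots s_n)s_0=s_{i_1}\cdots s_{i_{4n}}$ (reduced); root vectors $T_{i_1}\cdots T_{i_{\ell-1}}E_{i_\ell}$ of degree $s_{i_1}\cdots s_{i_{\ell-1}}\alpha_{i_\ell}$, named in order $X_n,\dots,X_1,Y_1,\dots,Y_n,\overline X_n,\dots,\overline X_1,\overline Y_1,\dots,\overline Y_n$; ${\mathcal U}_q^{\widehat w_n}$ is the subalgebra they generate, graded by $Q(\widehat D_{n+1})$ via these degrees. Cocycle twist: for an algebra $\Lambda$ graded by an abelian group $M$ and a 2-cocycle $c:M\times M\to k^\times$,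 $\Lambda'$ is $\Lambda$ as a graded vector space ($x\leftrightarrow x'$) with product $x'y'=c(\deg x,\deg y)(xy)'$ on homogeneous elements. $\beta:Q(\widehat D_{n+1})\times Q(\widehat D_{n+1})\to k^\times$ is the bicharacter with $\beta(\alpha_0,\alpha_{n+1})=q$ and $\beta(\alpha_i,\alpha_j)=1$ for all other pairs $(i,j)$. With $s'=2n+1-s$, $\mathbb X_{n,q}$ is the $k$-algebra generated by $X_{ij}$ ($i\in\{1,2\}$, $1\le j\le 2n$) with defining relations: $X_{rt}X_{rs}=q^{-1}X_{rs}X_{rt}$ ($r\in\{1,2\}$, $s<t$, $t\ne s'$); $X_{rs'}X_{rs}=X_{rs}X_{rs'}+\hat q\sum_{l=s+1}^nq^{l-s-1}X_{rl}X_{rl'}$ ($r\in\{1,2\}$, $s<s'$); $X_{2s}X_{1s}=q^{-1}X_{1s}X_{2s}$; $X_{2s}X_{1t}=X_{1t}X_{2s}$ ($s<t$, $t\ne s'$); $X_{2t}X_{1s}=X_{1s}X_{2t}-\hat qX_{1t}X_{2s}$ ($s<t$, $t\ne s'$); $X_{2s}X_{1s'}=qX_{1s'}X_{2s}+\hat q\sum_{l=1}^{s-1}q^{s-l}X_{1l'}X_{2l}$ ($s<s'$); $X_{2s'}X_{1s}=qX_{1s}X_{2s'}+\hat q\sum_{l=s+1}^nq^{l-s}X_{1l}X_{2l'}+\hat qq^{-1}\sum_{l=1}^nq^{l'-s}X_{1l'}X_{2l}-\hat qX_{1s'}X_{2s}$ ($s<s'$). *)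

(* Defs.v *)
From HB Require Import structures.
From mathcomp Require Import all_boot all_order all_algebra.
Set Implicit Arguments. Unset Strict Implicit. Unset Printing Implicit Defensive.
Import Order.TTheory GRing.Theory Num.Theory.
Local Open Scope ring_scope.

Definition transcendental (k : fieldType) (q : k) : Prop :=
  forall p : {poly rat}, p != 0 -> ~~ root (map_poly (@ratr k) p) q.

Definition alg_hom (k : fieldType) (A B : algType k) (f : A -> B) : Prop :=
  (((forall x y, f (x + y) = f x + f y)) /\ ((forall (a : k) x, f (a *: x) = a *: f x)) /\ ((forall x y, f (x * y) = f x * f y)) /\ (f 1 = 1)).

Definition presented (k : fieldType) (I : Type) (valid : I -> Prop)
  (rels : forall B : algType k, (I -> B) -> Prop) (A : algType k) (g : I -> A) : Prop :=
  rels A g /\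
  forall (B : algType k) (h : I -> B), rels B h ->
    exists f : A -> B,
      ((alg_hom f) /\ ((forall i, valid i -> f (g i) = h i)) /\ (forall f' : A -> B, alg_hom f' -> (forall i, valid i -> f' (g i) = h i) ->
            forall x, f' x = f x)).

(* An element of Z^{n+1} (+) Z delta is a row vector of length n+2:
   column j-1 is the e_j coordinate (1 <= j <= n+1), column n+1 the delta
   coordinate. *)
Definition lat (n : nat) := 'rV[int]_(n.+2).

Definition ecoord n (j : nat) : lat n := delta_mx 0 (inord j.-1).
Definition deltaL n : lat n := delta_mx 0 ord_max.

Definition ip n (mu la : lat n) : int :=
  \sum_(j < n.+2 | j != ord_max) mu 0 j * la 0 j.

(* membership in Q(\hat D_{n+1}) = Q(D_{n+1}) (+) Z delta : even coordinate sum *)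
Definition inQ n (mu : lat n) : bool :=
  ~~ odd (absz (\sum_(j < n.+2 | j != ord_max) mu 0 j)).

Definition alpha n (i : nat) : lat n :=
  if i == 0%N then - ecoord n n.+1 - ecoord n n + deltaL n
  else if i == 1%N then ecoord n 1 + ecoord n 2
  else ecoord n i - ecoord n i.-1.

Definition refl n (i : nat) (mu : lat n) : lat n :=
  mu - alpha n i *~ ip mu (alpha n i).

Definition qhat (k : fieldType) (q : k) : k := q - q^-1.

(* the bicharacter beta: beta(alpha_0, alpha_{n+1}) = q, all other pairs 1.
   The alpha_0-coefficient of mu is its delta coordinate, and the
   alpha_{n+1}-coefficient is (e_{n+1}-coordinate + delta-coordinate). *)
Definition coef_alpha0 n (mu : lat n) : int := mu 0 ord_max.
Definition coef_alphaLast n (mu : lat n) : int := mu 0 (inord n) + mu 0 ord_max.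
Definition beta (k : fieldType) (q : k) n (mu nu : lat n) : k :=
  q ^ (coef_alpha0 mu * coef_alphaLast nu).

Inductive Ugen (n : nat) : Type :=
| UE of nat | UF of nat | UK of lat n.

Definition validU n (g : Ugen n) : Prop :=
  match g with UE i => (i <= n.+1)%N | UF i => (i <= n.+1)%N | UK mu => inQ mu end.

Definition qcomm (k : fieldType) (q : k) (B : algType k) (u v : B) : B :=
  u * v - q^-1 *: (v * u).

Definition relsU (k : fieldType) (q : k) (n : nat) (B : algType k) (g : Ugen n -> B) : Prop :=
  let E i := g (UE n i) in let F i := g (UF n i) in let K mu := g (UK mu) in
  ((K 0 = 1) /\ ((forall mu la, inQ mu -> inQ la -> K mu * K la = K (mu + la))) /\ ((forall mu i, inQ mu -> (i <= n.+1)%N ->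
         K mu * E i = q ^ (ip mu (alpha n i)) *: (E i * K mu))) /\ ((forall mu i, inQ mu -> (i <= n.+1)%N ->
         K mu * F i = q ^ (- ip mu (alpha n i)) *: (F i * K mu))) /\ ((forall i j, (i <= n.+1)%N -> (j <= n.+1)%N ->
         (ip (alpha n i) (alpha n j) == 0) || (ip (alpha n i) (alpha n j) == 2) ->
         E i * E j = E j * E i /\ F i * F j = F j * F i)) /\ ((forall i j, (i <= n.+1)%N -> (j <= n.+1)%N -> ip (alpha n i) (alpha n j) = -1 ->
         E i * qcomm q (E i) (E j) = q *: (qcomm q (E i) (E j) * E i) /\
         F i * qcomm q (F i) (F j) = q *: (qcomm q (F i) (F j) * F i))) /\ ((forall i j, (i <= n.+1)%N -> (j <= n.+1)%N ->
         E i * F j - F j * E i =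
         (if i == j then (qhat q)^-1 *: (K (alpha n i) - K (- alpha n i)) else 0)))).

Definition lusztig (k : fieldType) (q : k) (n : nat) (U : algType k) (g : Ugen n -> U)
  (T : nat -> U -> U) : Prop :=
  let E i := g (UE n i) in let F i := g (UF n i) in let K mu := g (UK mu) in
  forall i, (i <= n.+1)%N ->
  ((alg_hom (T i)) /\ (bijective (T i)) /\ ((forall mu, inQ mu -> T i (K mu) = K (refl i mu))) /\ (T i (E i) = - (F i * K (alpha n i))) /\ (T i (F i) = - (K (- alpha n i) * E i)) /\ (forall j, (j <= n.+1)%N -> j != i ->
        (ip (alpha n i) (alpha n j) = 0 -> T i (E j) = E j /\ T i (F j) = F j) /\
        (ip (alpha n i) (alpha n j) = -1 ->
           T i (E j) = E i * E j - q^-1 *: (E j * E i) /\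
           T i (F j) = F j * F i - q *: (F i * F j)))).

(* the reduced word of \hat w_n:
   (s_{n+1}..s_1)(s_3..s_{n+1}) s_0 (s_n..s_3)(s_1..s_n) s_0 *)
Definition hatw (n : nat) : seq nat :=
  rev (iota 1 n.+1) ++ iota 3 (n - 1) ++ [:: 0%N] ++ rev (iota 3 (n - 2)) ++
  iota 1 n ++ [:: 0%N].

Definition rootvec (k : fieldType) n (U : algType k) (g : Ugen n -> U) (T : nat -> U -> U)
  (l : nat) : U :=
  foldr (fun i x => T i x) (g (UE n (nth 0%N (hatw n) l.-1))) (take l.-1 (hatw n)).

Definition rootdeg n (l : nat) : lat n :=
  foldr (fun i mu => refl i mu) (alpha n (nth 0%N (hatw n) l.-1)) (take l.-1 (hatw n)).

(* Let Lam be the subalgebra of A generated by the elements r l (valid l),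
   graded by deg (r l) = d l; it is spanned by the monomials. *)
Section Twist.
Variables (k : fieldType) (A : algType k) (M : zmodType).
Variables (valid : nat -> bool) (r : nat -> A) (d : nat -> M).

Definition monom (s : seq nat) : A := \prod_(l <- s) r l.
Definition mdeg (s : seq nat) : M := \sum_(l <- s) d l.

Definition in_subalg (x : A) : Prop :=
  exists c : seq (k * seq nat),
    all (fun p => all valid p.2) c /\ x = \sum_(p <- c) p.1 *: monom p.2.

(* phi, defined on Lam, is (the map x |-> psi x' for) an algebra isomorphism
   psi : Lam' -> B, where Lam' is the cocycle twist of Lam by c
   (product x'y' = c(deg x, deg y) (xy)' on homogeneous elements; by
   bilinearity it suffices to impose multiplicativity on monomials). *)
Definition twisted_alg_iso (B : algType k) (c : M -> M -> k) (phi : A -> B) : Prop :=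
  (((forall x y, in_subalg x -> in_subalg y -> phi (x + y) = phi x + phi y)) /\ ((forall (a : k) x, in_subalg x -> phi (a *: x) = a *: phi x)) /\ (phi 1 = 1) /\ ((forall s t, all valid s -> all valid t ->
         c (mdeg s) (mdeg t) *: phi (monom s * monom t) = phi (monom s) * phi (monom t))) /\ ((forall x y, in_subalg x -> in_subalg y -> phi x = phi y -> x = y)) /\ ((forall z : B, exists2 x, in_subalg x & phi x = z))).
End Twist.

Definition validX (n : nat) (p : nat * nat) : Prop :=
  (1 <= p.1 <= 2)%N /\ (1 <= p.2 <= n.*2)%N.

Definition relsX (k : fieldType) (q : k) (n : nat) (B : algType k) (x : nat * nat -> B) : Prop :=
  let X r j := x (r, j) in
  let pr s := (n.*2.+1 - s)%N in
  let qh := qhat q in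
  let idx s := (1 <= s <= n.*2)%N in
  (((forall r s t, (1 <= r <= 2)%N -> idx s -> idx t -> (s < t)%N -> t != pr s ->
         X r t * X r s = q^-1 *: (X r s * X r t))) /\ ((forall r s, (1 <= r <= 2)%N -> idx s -> (s < pr s)%N ->
         X r (pr s) * X r s = X r s * X r (pr s) +
           qh *: \sum_(s.+1 <= l < n.+1) q ^ (l%:Z - s%:Z - 1) *: (X r l * X r (pr l)))) /\ ((forall s, idx s -> X 2 s * X 1 s = q^-1 *: (X 1 s * X 2 s))) /\ ((forall s t, idx s -> idx t -> (s < t)%N -> t != pr s ->
         X 2 s * X 1 t = X 1 t * X 2 s)) /\ ((forall s t, idx s -> idx t -> (s < t)%N -> t != pr s ->
         X 2 t * X 1 s = X 1 s * X 2 t - qh *: (X 1 t * X 2 s))) /\ ((forall s, idx s -> (s < pr s)%N ->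
         X 2 s * X 1 (pr s) = q *: (X 1 (pr s) * X 2 s) +
           qh *: \sum_(1 <= l < s) q ^ (s%:Z - l%:Z) *: (X 1 (pr l) * X 2 l))) /\ ((forall s, idx s -> (s < pr s)%N ->
         X 2 (pr s) * X 1 s = q *: (X 1 s * X 2 (pr s)) +
           qh *: \sum_(s.+1 <= l < n.+1) q ^ (l%:Z - s%:Z) *: (X 1 l * X 2 (pr l)) +
           (qh * q^-1) *: \sum_(1 <= l < n.+1) q ^ ((pr l)%:Z - s%:Z) *: (X 1 (pr l) * X 2 l) -
           qh *: (X 1 (pr s) * X 2 s)))).

(* Main.v *)
(* Along the word of w_n, each half of the root vectors is a row of iterated
   q-commutators [..[z, E_i], E_j, ..], with z = E_{n+1} for the first half and
   z = T_v E_0, where v is the first half of the word, for the second.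
   Right q-commutation with E_1, ..., E_n moves along a row as in the vector
   representation of so_{2n}; applying it repeatedly to one relation between the
   rows, itself obtained by lowering with the F_i, yields all commutation
   relations of root vectors. After a change of signs these are the relations of
   X_{n,q} with every product X_{2s} X_{1t} multiplied by q, and this factor is
   exactly the effect of the cocycle twist.

   As the two sets of relations straighten words in the same way, it remains to
   see that the sorted monomials are independent on both sides. The algebra U
   acts on tensor powers of the representation with basis the lattice vectors of
   norm 1, and X acts on them through root vectors and K_{e_{n+1}}. Apply the
   monomials to tensor powers of the coordinate function at -e_{n+1}: at q = 1
   root vectors act by derivations, so the coefficients matching monomials with
   words of labels form a diagonal matrix with non-zero diagonal. Since q is
   transcendental, its determinant is non-zero before specialisation too. *)
Require Import Defs.
From HB Require Import structures.
From mathcomp Require Import all_boot all_order all_algebra.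
From mathcomp Require Import boolp ring zify.
Import Order.TTheory GRing.Theory Num.Theory.
Set Implicit Arguments. Unset Strict Implicit. Unset Printing Implicit Defensive.

(** * The root-vector words *)

(** The subalgebra of U comes without a presentation, so no universal property yields the
    isomorphism. It is built instead as a linear relation: the span, inside U × X, of the pairs
    formed by a monomial in U and the correspondingly rescaled monomial in X. Straightening such
    pairs with common coefficients writes every element of the span over sorted words; if one
    component vanishes, independence on that side kills all coefficients and hence the other
    component. The span is therefore the graph of a bijection, and no basis theorem is presupposed
    for either algebra.

    Both halves of the word give rows of the same shape because the second half is the first one
    with the diagram automorphism tau applied, and T_v, for v the first half, sends E_i to E_{tau i}
    for 1 <= i <= n.

    X acts through a second-row generator as a root vector times an operator that q-commutes with
    all root vectors; moving this operator to the right absorbs the factor q. As e_{n+1} has odd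
    coordinate sum, the operator is not one of the K_mu of U and is defined on the representation
    directly. *)

Definition adj (n i j : nat) : bool :=
  [|| [&& 2 <= i, 2 <= j & (i == j.+1) || (j == i.+1)],
      (i == 1) && (j == 3), (i == 3) && (j == 1),
      (i == 0) && (j == n) | (i == n) && (j == 0)]%N.

(* The diagram automorphism by which the first half of [hatw n] permutes the E_i. *)
Definition tau (n i : nat) : nat :=
  if i == 0%N then n.+1 else if i == n.+1 then 0%N
  else if i == 1%N then 2%N else if i == 2%N then 1%N else i.

Section Row.
Variables (S : Type) (br : S -> S -> S) (n : nat) (e : nat -> S) (x : S).

(* [rowX j] is X_{n-j} and [rowY j] is Y_{j+1}. *)
Fixpoint rowX j := if j is j'.+1 then br (rowX j') (e (n - j')) else x.
Fixpoint rowY j :=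
  if j is j'.+1 then br (rowY j') (e j'.+2) else br (rowX (n - 2)) (e 1).
(** The index t = 1, ..., 2n is that of the vector representation: X_{n+1-t} for t <= n and Y_{t-n}
    for t > n. The bracket is a parameter because rows are formed with q-commutators, with addition
    of roots, and with commutators at q = 1. *)
Definition row t := if (t <= n)%N then rowX t.-1 else rowY (t - n.+1).
End Row.

(** This is [Y_{n-1}, [X_{n-1}, E_0]], the closed form of T_v E_0 found in [Tv_E0]. *)
Definition xbar S (br : S -> S -> S) n (e : nat -> S) : S :=
  br (rowY br n e (e n.+1) (n - 2)) (br (rowX br n e (e n.+1) 1) (e 0%N)).

Lemma row_first S (br : S -> S -> S) n e x : (1 <= n)%N -> row br n e x 1 = x.
Proof. by rewrite /row => ->. Qed.

Lemma row_stepX S (br : S -> S -> S) n e x i : (1 <= i < n)%N ->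
  row br n e x (n.+1 - i) = br (row br n e x (n - i)) (e i.+1).
Proof.
move=> hi; rewrite /row; have -> : (n.+1 - i <= n)%N by lia.
have -> : (n - i <= n)%N by lia.
have -> : (n.+1 - i).-1 = (n - i).-1.+1 by lia.
by rewrite /=; congr (br _ (e _)); lia.
Qed.

Lemma row_Y1 S (br : S -> S -> S) n e x : (3 <= n)%N ->
  row br n e x (n + 1) = br (row br n e x (n - 1)) (e 1).
Proof.
move=> hn; rewrite /row; have -> : (n + 1 <= n)%N = false by lia.
have -> : (n - 1 <= n)%N by lia.
have -> : (n + 1 - n.+1 = 0)%N by lia.
by rewrite /=; congr (br (rowX _ _ _ _ _) _); lia.
Qed.

Lemma row_stepY S (br : S -> S -> S) n e x i : (1 <= i)%N ->
  row br n e x (n + i.+1) = br (row br n e x (n + i)) (e i.+1).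
Proof.
move=> hi; rewrite /row; have -> : (n + i.+1 <= n)%N = false by lia.
have -> : (n + i <= n)%N = false by lia.
have -> : (n + i.+1 - n.+1 = (n + i - n.+1).+1)%N by lia.
by rewrite /=; congr (br _ (e _)); lia.
Qed.

(** Parametricity of [row]; its instances give the behaviour under homomorphisms, the weights, and
    the specialisation at q = 1. *)
Lemma row_rel S S' (R : S -> S' -> Prop) br br' n (e : nat -> S) (e' : nat -> S') x x' t :
  (3 <= n)%N -> (1 <= t <= n.*2)%N ->
  (forall a b a' b', R a a' -> R b b' -> R (br a b) (br' a' b')) ->
  (forall i, (1 <= i <= n)%N -> R (e i) (e' i)) -> R x x' ->
  R (row br n e x t) (row br' n e' x' t).
Proof.
move=> hn ht Rbr Re Rx.
have HX j : (j < n)%N -> R (rowX br n e x j) (rowX br' n e' x' j).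
  by elim: j => [|j IHj] //= hj; apply: Rbr; [apply: IHj|apply: Re]; lia.
have HY j : (j < n)%N -> R (rowY br n e x j) (rowY br' n e' x' j).
  elim: j => [|j IHj] /= hj; apply: Rbr; by [apply: HX; lia|apply: IHj; lia|apply: Re; lia].
by rewrite /row; case: ifP => h; [apply: HX|apply: HY]; lia.
Qed.

Lemma row_map S (f : S -> S) (br : S -> S -> S) n (e e' : nat -> S) x t :
  (3 <= n)%N -> (1 <= t <= n.*2)%N ->
  (forall a b, f (br a b) = br (f a) (f b)) ->
  (forall i, (1 <= i <= n)%N -> f (e i) = e' i) ->
  f (row br n e x t) = row br n e' (f x) t.
Proof.
move=> hn ht fbr fe; apply: (row_rel (R := fun a b => f a = b)) => // a b _ _ <- <-.
exact: fbr.
Qed.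

Definition word1 n := rev (iota 1 n.+1) ++ iota 3 (n - 1).

(** Thanks to this factorisation every statement about the second half of the word is one about the
    first half, relabelled by tau and transported by T_v. *)
Lemma hatwE n : (3 <= n)%N -> hatw n = word1 n ++ map (tau n) (word1 n).
Proof.
move=> hn; rewrite /hatw /word1 -!catA; congr (_ ++ (_ ++ _)).
have [m ->] : exists m, n = m.+3 by exists (n - 3)%N; lia.
rewrite (_ : m.+3 - 1 = m.+2)%N; last by lia.
rewrite (_ : m.+3 - 2 = m.+1)%N; last by lia.
rewrite map_cat map_rev.
have tE : map (tau m.+3) (iota 3 m.+1) = iota 3 m.+1.
  rewrite -[RHS]map_id; apply/eq_in_map => i; rewrite mem_iota /tau => hi.
  by do !case: eqP => //; lia.
have -> : iota 1 m.+4 = [:: 1; 2]%N ++ iota 3 m.+1 ++ [:: m.+4].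
  rewrite [X in iota 1 X](_ : m.+4 = 2 + m.+1 + 1)%N; last by lia.
  by rewrite !iotaD -catA.
have -> : iota 3 m.+2 = iota 3 m.+1 ++ [:: m.+4].
  by rewrite [X in iota 3 X](_ : m.+2 = m.+1 + 1)%N ?iotaD //; lia.
rewrite !map_cat tE !rev_cat -!catA.
have -> : map (tau m.+3) [:: m.+4] = [:: 0]%N by rewrite /= /tau eqxx.
by have -> : iota 1 m.+3 = [:: 1; 2]%N ++ iota 3 m.+1.
Qed.

(** * Braid operators along the word *)

Section Systems.
Variables (n : nat) (hn : (3 <= n)%N).

(** Only these four properties enter the computation along the word. They hold for U with the E_i,
    for U with the F_i, and for the lattice with simple roots and reflections, so root vectors and
    their degrees come from the same proof. *)
Record braid_sys (S : Type) (br : S -> S -> S) (E : nat -> S) (T : nat -> S -> S) :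
  Prop := BraidSys {
  sys_br : forall i a b, (i <= n.+1)%N -> T i (br a b) = br (T i a) (T i b);
  sys_far : forall i j, (i <= n.+1)%N -> (j <= n.+1)%N -> i != j -> ~~ adj n i j ->
    T i (E j) = E j;
  sys_adj : forall i j, (i <= n.+1)%N -> (j <= n.+1)%N -> adj n i j ->
    T i (E j) = br (E i) (E j);
  sys_braid : forall i j, (i <= n.+1)%N -> (j <= n.+1)%N -> adj n i j ->
    T i (T j (E i)) = E j }.

Fixpoint Tword S (T : nat -> S -> S) (w : seq nat) (a : S) : S :=
  if w is i :: w' then T i (Tword T w' a) else a.

Lemma TwordE S (T : nat -> S -> S) w a : foldr T a w = Tword T w a.
Proof. by elim: w => //= i w ->. Qed.

Lemma TwordD S (T : nat -> S -> S) v w a :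
  Tword T (v ++ w) a = Tword T v (Tword T w a).
Proof. by elim: v => //= i v ->. Qed.

Definition dn a m := rev (iota a m).

Lemma dnS a m : dn a m.+1 = (a + m)%N :: dn a m.
Proof. by rewrite /dn -addn1 iotaD rev_cat /= . Qed.

Lemma dnD a m p : dn a (m + p) = dn (a + m) p ++ dn a m.
Proof. by rewrite /dn iotaD rev_cat. Qed.

Lemma tau0 : tau n 0 = n.+1. Proof. by []. Qed.

Lemma tauS : tau n n.+1 = 0%N. Proof. by rewrite /tau /= eqxx. Qed.

Lemma tau1 : tau n 1 = 2%N.
Proof. by rewrite /tau eqSS; have -> : (0 == n)%N = false by lia. Qed.

Lemma tau2 : tau n 2 = 1%N.
Proof. by rewrite /tau eqSS; have -> : (1 == n)%N = false by lia. Qed.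

Lemma tau3 i : (3 <= i <= n)%N -> tau n i = i.
Proof. by rewrite /tau => hi; case: eqP => ?; first (by lia); case: eqP => ?; first (by lia); case: eqP => ?; first (by lia); case: eqP => ?; first (by lia). Qed.

Section One.
Variables (S : Type) (br : S -> S -> S) (E : nat -> S) (T : nat -> S -> S).
Hypothesis HS : braid_sys br E T.
Local Notation TW := (Tword T).

Lemma Tword_br w a b : all (fun i => i <= n.+1)%N w ->
  TW w (br a b) = br (TW w a) (TW w b).
Proof. by elim: w => [|i w IHw] //= /andP[hi /IHw ->]; rewrite (sys_br HS). Qed.

Lemma Tword_far w j : (j <= n.+1)%N ->
  all (fun i => [&& i <= n.+1, i != j & ~~ adj n i j])%N w -> TW w (E j) = E j.
Proof.
move=> hj; elim: w => [|i w IHw] //= /andP[/and3P[h1 h2 h3] /IHw ->].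
by rewrite (sys_far HS).
Qed.

Lemma all_dn (P : pred nat) a m :
  (forall i, (a <= i < a + m)%N -> P i) -> all P (dn a m).
Proof. by move=> h; rewrite all_rev; apply/allP => i; rewrite mem_iota; apply: h. Qed.

Lemma all_iota (P : pred nat) a m :
  (forall i, (a <= i < a + m)%N -> P i) -> all P (iota a m).
Proof. by move=> h; apply/allP => i; rewrite mem_iota; apply: h. Qed.

Ltac sys_side := try by [rewrite // /adj; lia
  | apply: all_dn => ?; rewrite /adj; lia | apply: all_iota => ?; rewrite /adj; lia].

(** Each new letter turns the next generator into a bracket with the preceding one; the remaining
    letters are not adjacent to the new factor and fix it. *)
Lemma Tword_X j : (j < n)%N ->
  TW (dn (n.+2 - j) j) (E (n.+1 - j)) = rowX br n E (E n.+1) j.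
Proof.
elim: j => [|j IHj] hj; first by rewrite subn0.
have -> : dn (n.+2 - j.+1) j.+1 = dn (n.+2 - j) j ++ [:: n.+1 - j]%N.
  rewrite -[X in dn _ X]add1n dnD (_ : n.+2 - j.+1 + 1 = n.+2 - j)%N; last by lia.
  by congr (_ ++ [:: _]); lia.
rewrite TwordD /= (sys_adj HS); sys_side.
rewrite Tword_br; sys_side.
rewrite IHj; last by lia.
by rewrite Tword_far; sys_side.
Qed.

Let P := dn 1 n.+1.

Lemma PE1 m : (m <= n.+1)%N -> P = dn m.+1 (n.+1 - m) ++ dn 1 m.
Proof. by move=> hm; rewrite -(dnD 1 m) subnKC //; lia. Qed.

Lemma Tword_XE m : (2 <= m <= n.+1)%N ->
  TW (dn m.+1 (n.+1 - m)) (E m) = rowX br n E (E n.+1) (n.+1 - m).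
Proof.
move=> hm; rewrite -Tword_X; last by lia.
by congr (TW (dn _ _) (E _)); lia.
Qed.

Lemma Tword_Y0 : TW (dn 2 n) (E 1) = rowY br n E (E n.+1) 0.
Proof.
have -> : dn 2 n = dn 4 (n - 2) ++ [:: 3; 2]%N.
  by rewrite [X in dn _ X = _](_ : n = 2 + (n - 2))%N ?dnD //; lia.
rewrite TwordD /= (sys_far HS (i := 2)); sys_side.
rewrite (sys_adj HS); sys_side.
rewrite Tword_br; sys_side.
have := Tword_XE (m := 3); rewrite (_ : n.+1 - 3 = n - 2)%N; last by lia.
move=> ->; last by lia.
rewrite Tword_far //; sys_side.
Qed.

(** The letters m, m-1 turn E_m into E_{m-1} by the braid relation and all others act trivially. The
    ascending part of the word undoes this shift. *)
Lemma Tword_PE m : (4 <= m <= n.+1)%N -> TW P (E m) = E m.-1.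
Proof.
move=> hm; have -> : P = dn m.+1 (n.+1 - m) ++ [:: m; m.-1]%N ++ dn 1 m.-2.
  rewrite (PE1 (m := m)); sys_side.
  by case: m hm => [|[|m]] hm; rewrite ?dnS //; lia.
rewrite !TwordD Tword_far; sys_side.
rewrite /= (sys_braid HS); sys_side.
rewrite Tword_far; sys_side.
Qed.

Lemma PE4 : P = dn 4 (n - 2) ++ [:: 3; 2; 1]%N.
Proof. by rewrite -(dnD 1 3) /P; congr dn; lia. Qed.

Lemma Tword_Y1 : TW P (E 3) = rowY br n E (E n.+1) 1.
Proof.
rewrite [rowY _ _ _ _ _]/= -/(rowY br n E (E n.+1) 0).
rewrite PE4 TwordD /=.
rewrite (sys_adj HS (i := 1) (j := 3)); sys_side.
rewrite (sys_br HS); sys_side.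
rewrite (sys_far HS (i := 2)); sys_side.
rewrite (sys_br HS); sys_side.
rewrite (sys_braid HS); sys_side.
rewrite (sys_adj HS (i := 3)); sys_side.
rewrite !Tword_br; sys_side.
rewrite Tword_XE; last by lia.
by rewrite !Tword_far; sys_side.
Qed.

Lemma Tword_Y j : (j.+2 <= n)%N ->
  TW P (TW (iota 3 j) (E j.+3)) = rowY br n E (E n.+1) j.+1.
Proof.
elim: j => [|j IHj] hj; first exact: Tword_Y1.
rewrite -[X in iota 3 X]addn1 iotaD TwordD /= -[(3 + j)%N]/(j.+3) (sys_adj HS); sys_side.
rewrite Tword_br; sys_side.
rewrite Tword_br; sys_side.
rewrite (Tword_far (w := iota 3 j) (j := j.+4)); sys_side.
by rewrite IHj ?Tword_PE //; lia.
Qed.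

Lemma Tword_row1 t : (1 <= t <= n.*2)%N ->
  TW (take t.-1 (word1 n)) (E (nth 0%N (word1 n) t.-1)) = row br n E (E n.+1) t.
Proof.
move=> ht; rewrite /row /word1; case: (ltnP t n.+1) => h.
  have -> : (t <= n)%N by lia.
  have hX := Tword_X (j := t.-1).
  have hsz : size (rev (iota 1 n.+1)) = n.+1 by rewrite size_rev size_iota.
  rewrite nth_cat takel_cat hsz; last by lia.
  have -> : (t.-1 < n.+1)%N by lia.
  rewrite nth_rev size_iota; last by lia.
  rewrite nth_iota; last by lia.
  have -> : (1 + (n.+1 - t.-1.+1) = n.+1 - t.-1)%N by lia.
  rewrite -hX; last by lia.
  congr (TW _ _).
  rewrite -[X in iota 1 X](subnK (_ : t.-1 <= n.+1)%N); last by lia.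
  rewrite -/(dn 1 _) dnD take_size_cat; last by rewrite size_rev size_iota.
  by congr dn; lia.
have -> : (t <= n)%N = false by lia.
have hsz : size (rev (iota 1 n.+1)) = n.+1 by rewrite size_rev size_iota.
rewrite nth_cat take_cat hsz.
have [->|[->|h1]] : t = n.+1 \/ t = n.+2 \/ (n.+3 <= t)%N by lia.
- have -> : (n.+1.-1 < n.+1)%N by lia.
  rewrite nth_rev size_iota; last by lia.
  rewrite nth_iota; last by lia.
  rewrite (_ : 1 + (n.+1 - n.+1.-1.+1) = 1)%N; last by lia.
  rewrite subnn -Tword_Y0; congr (TW _ _).
  by rewrite -/(dn 1 _) -[X in dn 1 X]add1n (dnD 1 1 n) take_size_cat // size_rev size_iota.
- rewrite ltnn subnn take0 cats0 nth_iota; last by lia.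
  by rewrite subSn // subnn addn0 Tword_Y1.
have -> : (t.-1 < n.+1)%N = false by lia.
rewrite nth_iota; last by lia.
rewrite TwordD -/P.
rewrite -[X in iota 3 X](subnKC (_ : t.-1 - n.+1 <= n - 1)%N); last by lia.
rewrite iotaD take_size_cat; last by rewrite size_iota.
have -> : (3 + (t.-1 - n.+1) = (t.-1 - n.+1).+3)%N by lia.
rewrite Tword_Y; last by lia.
by congr (rowY _ _ _ _ _); lia.
Qed.

Definition Tv a := TW (word1 n) a.

Lemma Tv_br a b : Tv (br a b) = br (Tv a) (Tv b).
Proof.
apply: Tword_br; rewrite all_cat; apply/andP; split.
  by apply: all_dn => i; lia.
by apply: all_iota => i; lia.
Qed.

Lemma word1E : word1 n = P ++ iota 3 (n - 2) ++ [:: n.+1].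
Proof.
rewrite /word1; congr (_ ++ _).
rewrite (_ : n - 1 = n - 2 + 1)%N; last by lia.
by rewrite iotaD /=; congr (_ ++ [:: _]); lia.
Qed.

Lemma Tv_E0 : Tv (E 0%N) = xbar br n E.
Proof.
rewrite /Tv word1E !TwordD /= (sys_far HS); sys_side.
have -> : iota 3 (n - 2) = iota 3 (n - 3) ++ [:: n].
  rewrite (_ : n - 2 = n - 3 + 1)%N; last by lia.
  by rewrite iotaD /=; congr (_ ++ [:: _]); lia.
rewrite TwordD /= (sys_adj HS); sys_side.
rewrite !Tword_br; sys_side.
rewrite /xbar; congr br.
  have := Tword_Y (j := (n - 3)%N).
  rewrite (_ : (n - 3).+3 = n)%N; last by lia.
  rewrite (_ : (n - 3).+1 = n - 2)%N; last by lia.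
  by apply; lia.
rewrite Tword_far; sys_side.
have -> : P = [:: n.+1; n]%N ++ dn 1 n.-1.
  rewrite /P [X in dn 1 X](_ : n.+1 = n.-1 + 2)%N ?dnD; last by lia.
  by congr (_ ++ _); rewrite /dn /=; congr [:: _; _]; lia.
rewrite TwordD (Tword_far (w := dn 1 _)); sys_side.
rewrite /= (sys_adj HS (i := n)); sys_side.
rewrite (sys_br HS) // (sys_far HS (j := 0)); sys_side.
by rewrite (sys_adj HS); try by rewrite ?subn0 // /adj; lia.
Qed.

Hypothesis HS5 : T 2 (T 1 (T 3 (E 2))) = T 1 (E 3).

(** On E_1 and E_2 the letters 3, 2, 1 interchange the two legs of the fork. For i >= 3 the
    ascending part raises the index by one and the descending part lowers it again. *)
Lemma Tv_E i : (1 <= i <= n)%N -> Tv (E i) = E (tau n i).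
Proof.
move=> hi; rewrite /Tv /word1 TwordD -[rev _]/P.
have [->|[->|h]] : i = 1%N \/ i = 2%N \/ (3 <= i)%N by lia.
- have -> : iota 3 (n - 1) = 3%N :: iota 4 (n - 2).
    by rewrite (_ : n - 1 = (n - 2).+1)%N //; lia.
  rewrite /= Tword_far; sys_side.
  rewrite PE4 TwordD /= (sys_braid HS); sys_side.
  rewrite (sys_braid HS); sys_side.
  rewrite Tword_far //; sys_side.
  by rewrite tau1.
- have -> : iota 3 (n - 1) = 3%N :: iota 4 (n - 2).
    by rewrite (_ : n - 1 = (n - 2).+1)%N //; lia.
  rewrite /= Tword_far; sys_side.
  rewrite PE4 TwordD /= HS5 (sys_braid HS); sys_side.
  rewrite Tword_far //; sys_side.
  by rewrite tau2.
have -> : iota 3 (n - 1) = iota 3 (i - 3) ++ [:: i; i.+1] ++ iota i.+2 (n - i).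
  rewrite [X in iota 3 X](_ : n - 1 = (i - 3) + (2 + (n - i)))%N; last by lia.
  by rewrite !iotaD /=; congr (_ ++ [:: _, _ & iota _ _]); lia.
rewrite !TwordD (Tword_far (w := iota i.+2 _)); sys_side.
rewrite /= (sys_braid HS); sys_side.
rewrite (Tword_far (w := iota 3 _)); sys_side.
by rewrite Tword_PE ?tau3 //; lia.
Qed.
End One.

Lemma adj_sym i j : adj n i j = adj n j i.
Proof. by apply/idP/idP; rewrite /adj; lia. Qed.

(** Commutation of T_1 and T_2 is needed only on T_3 E_2, and [braid_sys] contains no relation
    between operators alone. Writing E_3 = T_2 T_3 E_2 reduces it to T_1 fixing T_2 E_2 and to
    interchanging E_1 and E_2 in a double bracket. *)
Lemma sys_far5 S br E T : @braid_sys S br E T -> T 1 (T 2 (E 2)) = T 2 (E 2) ->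
  br (E 1) (br (E 2) (E 3)) = br (E 2) (br (E 1) (E 3)) ->
  T 2 (T 1 (T 3 (E 2))) = T 1 (E 3).
Proof.
move=> HS h1 h2.
have e1 : T 3 (E 2) = br (E 3) (E 2) by apply: (sys_adj HS); rewrite /adj; lia.
have e2 : T 1 (E 2) = E 2 by apply: (sys_far HS); rewrite // /adj; lia.
have e3 : T 2 (E 1) = E 1 by apply: (sys_far HS); rewrite // /adj; lia.
have e4 : T 1 (E 3) = br (E 1) (E 3) by apply: (sys_adj HS); rewrite // /adj; lia.
have e5 : T 2 (E 3) = br (E 2) (E 3) by apply: (sys_adj HS); rewrite // /adj; lia.
have e6 : T 2 (T 3 (E 2)) = E 3 by apply: (sys_braid HS); rewrite /adj; lia.
have B1 := sys_br HS (i := 1); have B2 := sys_br HS (i := 2).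
rewrite -[in RHS]e6 e1 !B2 ?B1 ?e2 ?e4 ?e5; try by lia.
by rewrite !B1 ?B2 ?e2 ?e3 ?e4 ?e5 ?h1 ?h2 //; lia.
Qed.

Lemma tau_adj_imp i j : (i <= n.+1)%N -> (j <= n.+1)%N ->
  adj n i j -> adj n (tau n i) (tau n j).
Proof.
move=> hi hj /or4P[/and3P[h1 h2 /orP[]/eqP h]|/andP[/eqP-> /eqP->]|/andP[/eqP-> /eqP->]|
  /orP[]/andP[/eqP-> /eqP->]].
- case: (ltnP i n.+1) => hn1.
    case: (ltnP 2 j) => h3; first by rewrite !tau3 /adj; lia.
    by rewrite (_ : j = 2)%N ?tau2 ?tau3 /adj; lia.
  rewrite (_ : i = n.+1)%N ?(tau3 (i := j)); try by lia.
  by rewrite tauS /adj; lia.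
- case: (ltnP j n.+1) => hn1.
    case: (ltnP 2 i) => h3; first by rewrite !tau3 /adj; lia.
    by rewrite (_ : i = 2)%N ?tau2 ?tau3 /adj; lia.
  rewrite (_ : j = n.+1)%N ?(tau3 (i := i)); try by lia.
  by rewrite tauS /adj; lia.
- by rewrite tau1 tau3 /adj; lia.
- by rewrite tau1 tau3 /adj; lia.
- by rewrite (tau3 (i := n)) ?tau0 /adj; lia.
- by rewrite (tau3 (i := n)) ?tau0 /adj; lia.
Qed.

Lemma tauK i : (i <= n.+1)%N -> tau n (tau n i) = i.
Proof.
move=> hi; have [->|[->|[->|[->|h]]]] :
  i = 0%N \/ i = 1%N \/ i = 2%N \/ i = n.+1 \/ (3 <= i <= n)%N by lia.
- by rewrite tau0 tauS.
- by rewrite tau1 tau2.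
- by rewrite tau2 tau1.
- by rewrite tauS tau0.
by rewrite !tau3 // tau3.
Qed.

Lemma tau_le i : (i <= n.+1)%N -> (tau n i <= n.+1)%N.
Proof. by move=> hi; rewrite /tau; do !case: eqP => //; lia. Qed.

Lemma tau_adj i j : (i <= n.+1)%N -> (j <= n.+1)%N ->
  adj n (tau n i) (tau n j) = adj n i j.
Proof.
move=> hi hj; apply/idP/idP; last exact: tau_adj_imp.
by move/(tau_adj_imp (tau_le hi) (tau_le hj)); rewrite !tauK.
Qed.

Lemma braid_sys_tau S br E T : @braid_sys S br E T ->
  braid_sys br (E \o tau n) (T \o tau n).
Proof.
move=> HS; split=> i.
- by move=> a b /tau_le hi; exact: (sys_br HS).
- move=> j hi hj hij; rewrite -tau_adj // => h; apply: (sys_far HS) => //; try exact: tau_le.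
  by apply: contra hij => /eqP/(congr1 (tau n)); rewrite !tauK // => ->.
- by move=> j hi hj; rewrite -tau_adj // => h; apply: (sys_adj HS) => //; exact: tau_le.
- by move=> j hi hj; rewrite -tau_adj // => h; apply: (sys_braid HS) => //; exact: tau_le.
Qed.

Definition rootv S (E : nat -> S) (T : nat -> S -> S) l : S :=
  Tword T (take l.-1 (hatw n)) (E (nth 0%N (hatw n) l.-1)).

Lemma size_word1 : size (word1 n) = n.*2.
Proof. by rewrite size_cat size_rev !size_iota; lia. Qed.

Lemma rootv1 S br E T t : @braid_sys S br E T -> (1 <= t <= n.*2)%N ->
  rootv E T t = row br n E (E n.+1) t.
Proof.
move=> HS ht; rewrite -(Tword_row1 HS) // /rootv hatwE // nth_cat size_word1.
have -> : (t.-1 < n.*2)%N by lia.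
by rewrite takel_cat // size_word1; lia.
Qed.

(** The second half is a row of the system relabelled by tau, starting at E_0. T_v sends its start
    to [xbar] and its brackets with E_{tau i} to brackets with E_i. *)
Lemma rootv2 S br E T t : @braid_sys S br E T -> T 2 (T 1 (T 3 (E 2))) = T 1 (E 3) ->
  (1 <= t <= n.*2)%N ->
  rootv E T (n.*2 + t) = row br n E (xbar br n E) t.
Proof.
move=> HS HS5 ht; rewrite /rootv hatwE // nth_cat take_cat size_word1.
have -> : ((n.*2 + t).-1 < n.*2)%N = false by lia.
have -> : ((n.*2 + t).-1 - n.*2 = t.-1)%N by lia.
rewrite TwordD -/(Tv T _).
have -> : Tword T (take t.-1 (map (tau n) (word1 n)))
    (E (nth 0%N (map (tau n) (word1 n)) t.-1)) =
  Tword (T \o tau n) (take t.-1 (word1 n)) ((E \o tau n) (nth 0%N (word1 n) t.-1)).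
  rewrite (nth_map 0%N) ?size_word1; last by lia.
  by rewrite -map_take /=; elim: (take _ _) => //= i w ->.
rewrite (Tword_row1 (braid_sys_tau HS)) //.
rewrite (row_map (e' := E) (f := Tv T)) //.
- by rewrite /= tauS (Tv_E0 HS).
- exact: (Tv_br HS).
move=> i hi; rewrite /= (Tv_E HS) // ?tauK //; first by lia.
have [->|[->|h]] : i = 1%N \/ i = 2%N \/ (3 <= i <= n)%N by lia.
- by rewrite tau1; lia.
- by rewrite tau2; lia.
by rewrite tau3; lia.
Qed.

End Systems.

Local Open Scope ring_scope.

(** * Identities in noncommutative algebras *)

(** A reflexive normaliser. Words are lists of naturals compared by [Nat.eqb], so [cbv] collects
    equal monomials on concrete data, while the coefficients stay symbolic and are left to
    [field]. *)
Inductive ncexp (R : Type) : Type :=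
  NCvar of nat | NCzero | NCone
| NCadd of ncexp R & ncexp R | NCopp of ncexp R
| NCscale of R & ncexp R | NCmul of ncexp R & ncexp R.
Arguments NCvar {R}. Arguments NCzero {R}. Arguments NCone {R}.

Section NCNormal.
Variables (k : fieldType) (A : algType k).

Fixpoint nc_eval (env : list A) (e : ncexp k) : A :=
  match e with
  | NCvar i => List.nth i env 0
  | NCzero => 0
  | NCone => 1
  | NCadd a b => nc_eval env a + nc_eval env b
  | NCopp a => - nc_eval env a
  | NCscale c a => c *: nc_eval env a
  | NCmul a b => nc_eval env a * nc_eval env b
  end.

Fixpoint nc_eqw (v w : list nat) : bool :=
  match v, w with
  | nil, nil => true
  | cons i v', cons j w' => if Nat.eqb i j then nc_eqw v' w' else false
  | _, _ => false
  end.

Fixpoint nc_app (T : Type) (v w : list T) : list T :=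
  match v with nil => w | cons i v' => cons i (nc_app v' w) end.

Fixpoint nc_insert (c : k) (w : list nat) (p : list (k * list nat)) :=
  match p with
  | nil => cons (c, w) nil
  | cons (d, v) p' =>
      if nc_eqw w v then cons (c + d, v) p' else cons (d, v) (nc_insert c w p')
  end.

Fixpoint nc_merge (p r : list (k * list nat)) :=
  match p with nil => r | cons (c, w) p' => nc_insert c w (nc_merge p' r) end.

Fixpoint nc_map (f : k * list nat -> k * list nat) (p : list (k * list nat)) :=
  match p with nil => nil | cons a p' => cons (f a) (nc_map f p') end.

Fixpoint nc_prod (p r : list (k * list nat)) :=
  match p with
  | nil => nil
  | cons (c, w) p' =>
      nc_merge (nc_map (fun b => (c * b.1, nc_app w b.2)) r) (nc_prod p' r)
  end.

Fixpoint nc_norm (e : ncexp k) : list (k * list nat) :=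
  match e with
  | NCvar i => cons (1, cons i nil) nil
  | NCzero => nil
  | NCone => cons (1, nil) nil
  | NCadd a b => nc_merge (nc_norm a) (nc_norm b)
  | NCopp a => nc_map (fun b => (- b.1, b.2)) (nc_norm a)
  | NCscale c a => nc_map (fun b => (c * b.1, b.2)) (nc_norm a)
  | NCmul a b => nc_prod (nc_norm a) (nc_norm b)
  end.

Fixpoint nc_word (env : list A) (w : list nat) : A :=
  match w with nil => 1 | cons i w' => List.nth i env 0 * nc_word env w' end.

Fixpoint nc_poly (env : list A) (p : list (k * list nat)) : A :=
  match p with nil => 0 | cons (c, w) p' => c *: nc_word env w + nc_poly env p' end.

Fixpoint nc_null (p : list (k * list nat)) : Prop :=
  match p with nil => True | cons (c, _) p' => c = 0 /\ nc_null p' end.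

Lemma nc_eqwP v w : nc_eqw v w -> v = w.
Proof.
elim: v w => [|i v IHv] [|j w] //=.
by case: (PeanoNat.Nat.eqb_spec i j) => // -> /IHv ->.
Qed.

Lemma nc_insertE env c w p :
  nc_poly env (nc_insert c w p) = c *: nc_word env w + nc_poly env p.
Proof.
elim: p => [|[d v] p IHp] //=.
case E: (nc_eqw w v) => /=; first by rewrite (nc_eqwP E) scalerDl addrA.
by rewrite IHp addrCA.
Qed.

Lemma nc_mergeE env p r : nc_poly env (nc_merge p r) = nc_poly env p + nc_poly env r.
Proof.
elim: p => [|[c w] p IHp] /=; first by rewrite add0r.
by rewrite nc_insertE IHp addrA.
Qed.

Lemma nc_wordM env v w : nc_word env (nc_app v w) = nc_word env v * nc_word env w.
Proof. by elim: v => [|i v IHv] /=; rewrite ?mul1r // IHv mulrA. Qed.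

Lemma nc_prodE env p r : nc_poly env (nc_prod p r) = nc_poly env p * nc_poly env r.
Proof.
elim: p => [|[c w] p IHp] /=; first by rewrite mul0r.
rewrite nc_mergeE IHp mulrDl; congr (_ + _).
elim: r {IHp} => [|[d v] r IHr] /=; first by rewrite mulr0.
by rewrite IHr nc_wordM mulrDr -scalerAr -[in RHS]scalerAl scalerA (mulrC d) -scalerAl.
Qed.

Lemma nc_normE env e : nc_eval env e = nc_poly env (nc_norm e).
Proof.
elim: e => [i|||a IHa b IHb|a IHa|c a IHa|a IHa b IHb] /=.
- by rewrite scale1r mulr1 addr0.
- by [].
- by rewrite scale1r addr0.
- by rewrite nc_mergeE IHa IHb.
- rewrite IHa; elim: (nc_norm a) => [|[d v] p IHp] /=; first by rewrite oppr0.
  by rewrite opprD IHp scaleNr.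
- rewrite IHa; elim: (nc_norm a) => [|[d v] p IHp] /=; first by rewrite scaler0.
  by rewrite scalerDr IHp scalerA.
- by rewrite nc_prodE IHa IHb.
Qed.

Lemma nc_eq env a b :
  nc_null (nc_norm (NCadd a (NCopp b))) -> nc_eval env a = nc_eval env b.
Proof.
move=> H; apply/eqP; rewrite -subr_eq0; apply/eqP.
have -> : nc_eval env a - nc_eval env b = nc_eval env (NCadd a (NCopp b)) by [].
rewrite nc_normE; elim: (nc_norm _) H => [|[c w] p IHp] //= [-> /IHp ->].
by rewrite scale0r addr0.
Qed.

End NCNormal.

Ltac nc_mem x l :=
  lazymatch l with
  | nil => constr:(false)
  | cons x _ => constr:(true)
  | cons _ ?l' => nc_mem x l'
  end.

Ltac nc_pos x l :=
  lazymatch l with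
  | cons x _ => constr:(O)
  | cons _ ?l' => let m := nc_pos x l' in constr:(S m)
  end.

Ltac nc_atoms t l :=
  lazymatch t with
  | 0 => l
  | 1 => l
  | ?a + ?b => let l' := nc_atoms a l in nc_atoms b l'
  | - ?a => nc_atoms a l
  | ?c *: ?a => nc_atoms a l
  | ?a * ?b => let l' := nc_atoms a l in nc_atoms b l'
  | _ => let m := nc_mem t l in
         lazymatch m with true => l | false => constr:(cons t l) end
  end.

Ltac nc_reify k t l :=
  lazymatch t with
  | 0 => constr:(@NCzero k)
  | 1 => constr:(@NCone k)
  | ?a + ?b => let x := nc_reify k a l in let y := nc_reify k b l in
               constr:(@NCadd k x y)
  | - ?a => let x := nc_reify k a l in constr:(@NCopp k x)
  | ?c *: ?a => let x := nc_reify k a l in constr:(@NCscale k c x)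
  | ?a * ?b => let x := nc_reify k a l in let y := nc_reify k b l in
               constr:(@NCmul k x y)
  | _ => let m := nc_pos t l in constr:(@NCvar k m)
  end.

(* Reduces an identity in a [k]-algebra to the vanishing in [k] of the
   coefficient of every noncommutative monomial. *)
Ltac ncalg :=
  lazymatch goal with
  | |- @eq ?T ?a ?b =>
    lazymatch goal with
    | A : algType ?k |- _ =>
      let _ := constr:(erefl T : T = (A : Type)) in
      let l := nc_atoms a (@nil A) in
      let l' := nc_atoms b l in
      let x := nc_reify (GRing.Field.sort k) a l' in
      let y := nc_reify (GRing.Field.sort k) b l' in
      apply: (@nc_eq k A l' x y);
      cbv [nc_norm nc_merge nc_insert nc_eqw nc_app nc_map nc_prod nc_null
           Nat.eqb fst snd]
    end
  end.

Ltac ncfield := ncalg; repeat split; try by (field; repeat (apply/andP; split)).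

(** * One row of root vectors *)

Definition pr (n t : nat) : nat := (n.*2.+1 - t)%N.
(* Right q-commutation with [e i] moves [arrA i] to [arrB i] and
   [pr (arrB i)] to [pr (arrA i)]; it kills the other vectors of a row. *)
Definition arrA (n i : nat) : nat := if i == 1%N then (n - 1)%N else (n.+1 - i)%N.
Definition arrB (n i : nat) : nat := if i == 1%N then n.+1 else (n.+2 - i)%N.

Ltac arrlia := unfold arrA, arrB, pr in *;
  repeat match goal with
  | H : context [if _ == _ then _ else _] |- _ => move: H
  end;
  repeat match goal with
  | |- context [if ?a == ?b then _ else _] => case: (a =P b) => ?
  end; lia.

Lemma down_ind n (P : nat -> Prop) : P n ->
  (forall i, (1 <= i < n)%N -> P i.+1 -> P i) -> forall i, (1 <= i <= n)%N -> P i.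
Proof.
move=> Pn Ps i hi; rewrite -(subKn (_ : i <= n)%N); last by lia.
have : (n - i < n)%N by lia.
elim: (n - i)%N => [|j IHj] hj; first by rewrite subn0.
apply: Ps; first by lia.
by rewrite (_ : (n - j.+1).+1 = n - j)%N; [apply: IHj|]; lia.
Qed.

(** * Consequences of the q-Serre relations *)

Section Serre.
Variables (k : fieldType) (q : k) (A : algType k).
Hypotheses (q0 : q != 0) (qq : q + q^-1 != 0).
Local Notation qc := (@qcomm k q A).

Definition serre (b c : A) : Prop := b * qc b c = q *: (qc b c * b).

Lemma serre0 b c : serre b c ->
  b * b * c - (q + q^-1) *: (b * c * b) + c * b * b = 0.
Proof.
move/eqP; rewrite -subr_eq0 => /eqP h; rewrite -[RHS]h /qcomm.
by ncfield.
Qed.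

Lemma serre_of0 b c :
  b * b * c - (q + q^-1) *: (b * c * b) + c * b * b = 0 -> serre b c.
Proof.
move=> h; apply: subr0_eq; rewrite -[RHS]h /qcomm.
by ncfield.
Qed.

Lemma serre_sym b c : serre b c -> qc c b * b = q *: (b * qc c b).
Proof.
move/serre0 => h; apply: subr0_eq.
transitivity (b * b * c - (q + q^-1) *: (b * c * b) + c * b * b); last exact: h.
by rewrite /qcomm; ncfield.
Qed.

Lemma qcomm_tail a b c : a * c = c * a -> serre c b ->
  qc (qc a b) c * c = q *: (c * qc (qc a b) c).
Proof.
move=> /eqP; rewrite -subr_eq0 => /eqP C /serre0 S; apply: subr0_eq.
set s := _ + _ in S.
transitivity (a * s - q^-1 *: (s * a)
  - q^-1 *: (b * (a * c - c * a) * c + b * c * (a * c - c * a))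
  + (q + q^-1) *: ((a * c - c * a) * b * c)
  + ((q + q^-1) * q^-1) *: (c * b * (a * c - c * a))
  - ((a * c - c * a) * c * b + c * (a * c - c * a) * b)).
  by rewrite /qcomm /s; ncfield.
by rewrite C S !(mulr0, mul0r, scaler0, addr0, subr0, oppr0).
Qed.

(** Q equals both [P,c] and [a,R]. Moving b through the two forms expresses q(Qb - bQ) by PR - RP
    with opposite signs; adding the results leaves (q + q^{-1})(Qb - bQ) = 0. *)
Lemma qcomm_mid a b c : a * c = c * a -> serre b c ->
  qc a b * b = q *: (b * qc a b) ->
  qc (qc a b) c * b = b * qc (qc a b) c.
Proof.
move=> /eqP; rewrite -subr_eq0 => /eqP C S2 S1.
set P := qc a b in S1 *; set Q := qc P c; set R := qc b c.
have S1' : P * b - q *: (b * P) = 0 by rewrite S1 subrr.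
have S2' : b * R - q *: (R * b) = 0 by rewrite S2 subrr.
have QE : Q = a * R - q^-1 *: (R * a).
  apply: subr0_eq; transitivity (- (q^-1) *: (b * (a * c - c * a))
    + q^-1 *: ((a * c - c * a) * b)).
    by rewrite /Q /P /R /qcomm; ncfield.
  by rewrite C !(mulr0, mul0r, scaler0, addr0).
have e1 : q *: (Q * b - b * Q) = - (P * R - R * P) + qhat q *: (Q * b).
  apply: subr0_eq; transitivity ((P * b - q *: (b * P)) * c
     - (q^-1 * q^-1) *: (c * (P * b - q *: (b * P)))).
    by rewrite /Q /R /qcomm /qhat; ncfield.
  by rewrite S1' !(mulr0, mul0r, scaler0, subr0).
have e2 : q *: (Q * b - b * Q) = (P * R - R * P) - qhat q *: (b * Q).
  apply: subr0_eq; transitivity (- (a * (b * R - q *: (R * b)))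
     + (q^-1 * q^-1) *: ((b * R - q *: (R * b)) * a)).
    by rewrite QE /P /qcomm /qhat; ncfield.
  by rewrite S2' !(mulr0, mul0r, scaler0, oppr0, addr0).
apply: subr0_eq; apply: (scalerI qq); rewrite scaler0.
transitivity (q *: (Q * b - b * Q) + q *: (Q * b - b * Q) - qhat q *: (Q * b - b * Q)).
  by rewrite /qhat; ncfield.
by rewrite {1}e1 e2; ncfield.
Qed.

Lemma qcomm_comm a b c : a * c = c * a -> b * c = c * b -> qc a b * c = c * qc a b.
Proof.
by move=> h1 h2; rewrite /qcomm mulrBl mulrBr -scalerAl -scalerAr -!mulrA h2 h1 !mulrA h1 h2.
Qed.

Lemma qcomm_qcomm a b c : b * c = c * b -> qc (qc a b) c = qc (qc a c) b.
Proof.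
move=> /eqP; rewrite -subr_eq0 => /eqP C; apply: subr0_eq.
transitivity (a * (b * c - c * b) - (q^-1 * q^-1) *: ((b * c - c * b) * a)).
  by rewrite /qcomm; ncfield.
by rewrite C !(mulr0, mul0r, scaler0, subr0).
Qed.

Lemma qcomm_scale a b c (r : k) : a * c = r *: (c * a) -> b * c = c * b ->
  qc a b * c = r *: (c * qc a b).
Proof.
move=> /eqP; rewrite -subr_eq0 => /eqP h1 /eqP; rewrite -subr_eq0 => /eqP h2.
apply: subr0_eq; transitivity (a * (b * c - c * b) + (a * c - r *: (c * a)) * b
  - q^-1 *: (b * (a * c - r *: (c * a)) + r *: ((b * c - c * b) * a))).
  by rewrite /qcomm; ncfield.
by rewrite h1 h2 !(mulr0, mul0r, scaler0, addr0, subr0).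
Qed.

End Serre.

Section Weights.
Variables (k : fieldType) (q : k) (A : algType k) (n : nat).
(** The exponent of q is the pairing of alpha_i with the weight of t in the vector representation,
    which is -e_{n+1-t} for t <= n and e_{t-n} for t > n. *)
Definition cw (i t : nat) : k :=
  if (t == arrA n i) || (t == pr n (arrB n i)) then q^-1
  else if (t == arrB n i) || (t == pr n (arrA n i)) then q else 1.
Definition dplus (z : nat -> A) (i t : nat) : A :=
  if t == arrA n i then z (arrB n i)
  else if t == pr n (arrB n i) then z (pr n (arrA n i)) else 0.
(** The two arrows of e_i carry opposite signs, as when so_{2n} acts on its vector representation by
    the matrices E_{ab} - E_{b'a'}. *)
Definition dsign (z : nat -> A) (i t : nat) : A :=
  if t == arrA n i then z (arrB n i)
  else if t == pr n (arrB n i) then - z (pr n (arrA n i)) else 0.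
Definition rowrule (d : (nat -> A) -> nat -> nat -> A) (e z : nat -> A) : Prop :=
  forall i t, (1 <= i <= n)%N -> (1 <= t <= n.*2)%N ->
  z t * e i = cw i t *: (e i * z t) + d z i t.

(** These are the signs of the theorem, X_i having index t = n+1-i. The factor [esgn] on e_i
    compensates: along the first arrow of e_i the product of the two signs is the sign of the
    target, along the second arrow its negative. *)
Definition sgn (t : nat) : k := if (t <= n)%N then (-1) ^+ t else 1.
Definition esgn (i : nat) : k := if i == 1%N then (-1) ^+ n.-1 else -1.
End Weights.

(** * Right q-commutation along one row *)

Section RowRules.
Variables (k : fieldType) (q : k) (A : algType k) (n : nat).
Hypotheses (q0 : q != 0) (qq : q + q^-1 != 0) (hn : (3 <= n)%N).
Variables (e : nat -> A) (x : A).
Local Notation qc := (@qcomm k q A).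
Hypothesis eC : forall i j, (1 <= i <= n)%N -> (1 <= j <= n)%N -> ~~ adj n i j ->
  e i * e j = e j * e i.
Hypothesis eS : forall i j, (1 <= i <= n)%N -> (1 <= j <= n)%N -> adj n i j ->
  serre q (e i) (e j).
Hypothesis xC : forall i, (1 <= i < n)%N -> x * e i = e i * x.
Hypothesis xS1 : serre q x (e n).
Hypothesis xS2 : serre q (e n) x.

Let X i := rowX qc n e x (n - i).
Let Y i := rowY qc n e x i.-1.

Lemma X_top : X n = x. Proof. by rewrite /X subnn. Qed.

Lemma X_step i : (1 <= i < n)%N -> X i = qc (X i.+1) (e i.+1).
Proof.
move=> hi; rewrite /X (_ : n - i = (n - i.+1).+1)%N /=; last by lia.
by congr (qc _ (e _)); lia.
Qed.

Lemma Y_1 : Y 1 = qc (X 2) (e 1). Proof. by []. Qed.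

Lemma Y_step i : (1 <= i)%N -> Y i.+1 = qc (Y i) (e i.+1).
Proof. by case: i. Qed.

(** The pair (1,2) is excluded because the bracket of X_2 with e_1 is Y_1. *)
Lemma X_lt i m : (1 <= m < i)%N -> (i <= n)%N -> (m, i) != (1, 2)%N ->
  X i * e m = e m * X i.
Proof.
move=> hm hi; move: (hm); have: (1 <= i <= n)%N by lia.
move: i {hi hm}; apply: (down_ind (P := fun i => is_true (1 <= m < i)%N -> _ -> _)).
  by move=> hm; rewrite X_top xpair_eqE => ?; apply: xC.
move=> i hi IHi hm hmi; rewrite X_step //; apply: qcomm_comm.
  apply: IHi; first by lia.
  by rewrite xpair_eqE; lia.
by apply: eC; rewrite ?/adj; move: hmi; rewrite xpair_eqE; lia.
Qed.

Lemma X_succ i : (1 <= i < n)%N -> X i * e i.+1 = q *: (e i.+1 * X i).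
Proof.
move=> hi; rewrite X_step //.
have [hin|hin] : i.+1 = n \/ (i.+1 < n)%N by lia.
  by rewrite hin X_top; apply: serre_sym.
rewrite X_step; last by lia.
apply: qcomm_tail => //; first by apply: X_lt; rewrite ?xpair_eqE; lia.
by apply: eS; rewrite ?/adj; lia.
Qed.

Lemma X_gt i m : (1 <= i)%N -> (i.+2 <= m <= n)%N -> X i * e m = e m * X i.
Proof.
move=> h1 hm; move: (hm); have: (1 <= i <= n)%N by lia.
move: i {h1 hm}; apply: (down_ind (P := fun i => is_true (i.+2 <= m <= n)%N -> _)).
  by lia.
move=> i hi IHi hm; rewrite X_step //.
have [h|h] : m = i.+2 \/ (i.+3 <= m)%N by lia.
  rewrite {}h in hm *; rewrite X_step; last by lia.
  apply: qcomm_mid => //.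
  - by apply: X_lt; rewrite ?xpair_eqE; lia.
  - by apply: eS; rewrite ?/adj; lia.
  - by rewrite -X_step ?X_succ //; lia.
apply: qcomm_comm; first by apply: IHi; lia.
by apply: eC; rewrite ?/adj; lia.
Qed.

(** As e_1 and e_2 commute, the two paths from X_2 to Y_2 through the fork, by way of Y_1 or of X_1,
    agree. *)
Lemma Y_2 : Y 2 = qc (X 1) (e 1).
Proof.
rewrite Y_step // Y_1 qcomm_qcomm //.
  by rewrite -X_step //; lia.
by apply: eC; rewrite ?/adj; lia.
Qed.

Lemma Y1_e1 : Y 1 * e 1 = q *: (e 1 * Y 1).
Proof.
rewrite Y_1 X_step; last by lia.
apply: qcomm_tail => //; first by apply: X_lt; rewrite ?xpair_eqE; lia.
by apply: eS; rewrite ?/adj; lia.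
Qed.

Lemma Y2_e1 : Y 2 * e 1 = q *: (e 1 * Y 2).
Proof.
rewrite Y_step //; apply: qcomm_scale => //; first exact: Y1_e1.
by apply: eC; rewrite ?/adj; lia.
Qed.

Lemma Y_gt i m : (1 <= i)%N -> (i.+2 <= m <= n)%N -> Y i * e m = e m * Y i.
Proof.
elim: i => // -[|i] IHi _ hm.
  have [h|h] : (m = 3)%N \/ (4 <= m)%N by lia.
    rewrite {}h in hm *; rewrite Y_1 X_step; last by lia.
    apply: qcomm_mid => //.
    - by apply: X_lt; rewrite ?xpair_eqE; lia.
    - by apply: eS; rewrite ?/adj; lia.
    - by rewrite -X_step ?X_succ //; lia.
  rewrite Y_1; apply: qcomm_comm; first by apply: X_gt; lia.
  by apply: eC; rewrite ?/adj; lia.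
rewrite Y_step //; apply: qcomm_comm; first by apply: IHi; lia.
by apply: eC; rewrite ?/adj; lia.
Qed.

Lemma Y_same i : (1 <= i <= n)%N -> Y i * e i = q *: (e i * Y i).
Proof.
move=> hi; have [->|[->|h]] : i = 1%N \/ i = 2%N \/ (3 <= i)%N by lia.
- exact: Y1_e1.
- rewrite Y_2; apply: qcomm_scale => //; first by apply: X_succ; lia.
  by apply: eC; rewrite ?/adj; lia.
case: i hi h => // -[|i] // hi h; rewrite Y_step // Y_step; last by lia.
apply: qcomm_tail => //; first by apply: Y_gt; lia.
by apply: eS; rewrite ?/adj; lia.
Qed.

Lemma Y_pred i : (2 <= i < n)%N -> Y i.+1 * e i = e i * Y i.+1.
Proof.
case: i => // i hi; rewrite Y_step // Y_step; last by lia.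
apply: qcomm_mid => //.
- by apply: Y_gt; lia.
- by apply: eS; rewrite ?/adj; lia.
- by rewrite -Y_step ?Y_same //; lia.
Qed.

Lemma Y3_e1 : Y 3 * e 1 = e 1 * Y 3.
Proof.
rewrite Y_step // Y_2; apply: qcomm_mid => //.
- by apply: X_gt; lia.
- by apply: eS; rewrite ?/adj; lia.
- by rewrite -Y_2 Y2_e1.
Qed.

Lemma Y_lt i m : (i <= n)%N -> (1 <= m < i)%N -> (3 <= i)%N -> Y i * e m = e m * Y i.
Proof.
elim: i => // i IHi hi hm h3.
have [h|h] : m = i \/ (m < i)%N by lia.
  by rewrite h in hm *; apply: Y_pred; lia.
have [h4|h4] : i = 2%N \/ (3 <= i)%N by lia.
  by rewrite h4 in h *; rewrite (_ : m = 1%N) ?Y3_e1 //; lia.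
rewrite Y_step; last by lia.
apply: qcomm_comm; first by apply: IHi; lia.
by apply: eC; rewrite ?/adj; lia.
Qed.

Local Notation z := (row qc n e x).

Lemma row_X i : (1 <= i <= n)%N -> z (n.+1 - i) = X i.
Proof.
move=> hi; rewrite /row; have -> : (n.+1 - i <= n)%N by lia.
by rewrite /X; congr (rowX _ _ _ _ _); lia.
Qed.

Lemma row_Y i : (1 <= i)%N -> z (n + i) = Y i.
Proof.
move=> hi; rewrite /row; have -> : (n + i <= n)%N = false by lia.
by rewrite /Y; congr (rowY _ _ _ _ _); lia.
Qed.

Lemma qcommE a b : a * b = q^-1 *: (b * a) + qc a b.
Proof. by rewrite /qcomm addrC subrK. Qed.

Lemma rule_move i t t' u w : cw q n i t = q^-1 -> dplus n z i t = z t' ->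
  z t = u -> z t' = w -> qc u (e i) = w ->
  z t * e i = cw q n i t *: (e i * z t) + dplus n z i t.
Proof. by move=> -> -> -> -> <-; exact: qcommE. Qed.

Lemma rule_stay i t c u : cw q n i t = c -> dplus n z i t = 0 ->
  z t = u -> u * e i = c *: (e i * u) ->
  z t * e i = cw q n i t *: (e i * z t) + dplus n z i t.
Proof. by move=> -> -> -> ->; rewrite addr0. Qed.

Lemma cw_pred i t : (t == arrA n i) || (t == pr n (arrB n i)) -> cw q n i t = q^-1.
Proof. by rewrite /cw => ->. Qed.

Lemma cw_succ i t : (1 <= i <= n)%N -> (t == arrB n i) || (t == pr n (arrA n i)) ->
  cw q n i t = q.
Proof.
rewrite /cw => hi h; case: ifP => h'; last by rewrite h.
by exfalso; move: hi h h'; arrlia.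
Qed.

Lemma dplus_succ i t : (1 <= i <= n)%N -> (t == arrB n i) || (t == pr n (arrA n i)) ->
  dplus n z i t = 0.
Proof.
rewrite /dplus => hi h.
have h1 : (t == arrA n i) = false.
  by apply/eqP; move: hi h; arrlia.
have h2 : (t == pr n (arrB n i)) = false.
  by apply/eqP; move: hi h; arrlia.
by rewrite h1 h2.
Qed.

Lemma cwd_other i t : t != arrA n i -> t != arrB n i ->
  t != pr n (arrA n i) -> t != pr n (arrB n i) ->
  cw q n i t = 1 /\ dplus n z i t = 0.
Proof. by rewrite /cw /dplus => /negPf-> /negPf-> /negPf-> /negPf->. Qed.

(** The cases follow the weight diagram: e_i moves t, or t is the end of an arrow of e_i, or
    neither. Only e_1 leads from the X part to the Y part. *)
Lemma row_rule : rowrule q n (dplus n) e z.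
Proof.
move=> i t hi ht; have [h|h] : (t <= n)%N \/ (n < t)%N by lia.
  have [j [hj tE]] : exists j, (1 <= j <= n)%N /\ t = (n.+1 - j)%N.
    by exists (n.+1 - t)%N; lia.
  have zE : z t = X j by rewrite tE row_X.
  have [ij|[ij|[ij ij']]] : ((2 <= i)%N /\ i = j) \/ ((2 <= i)%N /\ i = j.+1) \/
    ((i <= j.+1)%N -> (2 <= i)%N -> (i < j)%N) /\ True by lia.
  - apply: (rule_move (t' := (n.+1 - j.-1)%N) (u := X j) (w := X j.-1)) => //.
    + by apply: cw_pred; arrlia.
    + rewrite /dplus (_ : t == arrA n i); last by arrlia.
      by congr (row _ _ _ _ _); arrlia.
    + by rewrite row_X //; lia.
    + have jE : j.-1.+1 = j by lia.
      have jb : (1 <= j.-1 < n)%N by lia.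
      by rewrite (X_step jb) jE; case: ij => _ ->.
  - apply: (rule_stay (c := q) (u := X j)) => //.
    + by apply: cw_succ => //; arrlia.
    + by apply: dplus_succ => //; arrlia.
    + by case: ij => h2 iE; rewrite iE; apply: X_succ; lia.
  have [i1|i2] : i = 1%N \/ (2 <= i)%N by lia.
    have [j1|[j1|j1]] : j = 1%N \/ j = 2%N \/ (3 <= j)%N by lia.
    + apply: (rule_move (t' := (n + 2)%N) (u := X j) (w := Y 2)) => //.
      * by apply: cw_pred; arrlia.
      * rewrite /dplus (_ : (t == arrA n i) = false); last by arrlia.
        rewrite (_ : t == pr n (arrB n i)); last by arrlia.
        by congr (row _ _ _ _ _); arrlia.
      * by rewrite row_Y.
      * by rewrite i1 j1 Y_2.
    + apply: (rule_move (t' := (n + 1)%N) (u := X j) (w := Y 1)) => //.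
      * by apply: cw_pred; arrlia.
      * rewrite /dplus (_ : t == arrA n i); last by arrlia.
        by congr (row _ _ _ _ _); arrlia.
      * by rewrite row_Y.
      * by rewrite i1 j1 Y_1.
    + have [c1 d1] : cw q n i t = 1 /\ dplus n z i t = 0 by apply: cwd_other; arrlia.
      apply: (rule_stay c1 d1 zE); rewrite scale1r.
      by apply: X_lt; rewrite ?xpair_eqE; lia.
  have [c1 d1] : cw q n i t = 1 /\ dplus n z i t = 0 by apply: cwd_other; arrlia.
  apply: (rule_stay c1 d1 zE); rewrite scale1r.
  have [h'|h'] : (i < j)%N \/ (j.+2 <= i)%N by lia.
    by apply: X_lt; rewrite ?xpair_eqE; lia.
  by apply: X_gt; lia.
have [j [hj tE]] : exists j, (1 <= j <= n)%N /\ t = (n + j)%N.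
  by exists (t - n)%N; lia.
have zE : z t = Y j by rewrite tE row_Y //; lia.
have [ij|[ij|ij]] : i = j.+1 \/ (i = j \/ i = 1%N /\ j = 2%N) \/
   i != j.+1 /\ i != j /\ (i, j) != (1, 2)%N by rewrite xpair_eqE; lia.
- apply: (rule_move (t' := (n + j.+1)%N) (u := Y j) (w := Y j.+1)) => //.
  + by apply: cw_pred; arrlia.
  + rewrite /dplus (_ : (t == arrA n i) = false); last by arrlia.
    rewrite (_ : t == pr n (arrB n i)); last by arrlia.
    by congr (row _ _ _ _ _); arrlia.
  + by rewrite row_Y.
  + by rewrite ij Y_step //; lia.
- apply: (rule_stay (c := q) (u := Y j)) => //.
  + by apply: cw_succ => //; arrlia.
  + by apply: dplus_succ => //; arrlia.
  + case: ij => [->|[-> ->]]; first exact: Y_same.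
    exact: Y2_e1.
move: ij; rewrite xpair_eqE => ij.
have [c1 d1] : cw q n i t = 1 /\ dplus n z i t = 0 by apply: cwd_other; arrlia.
apply: (rule_stay c1 d1 zE); rewrite scale1r.
have [h'|h'] : (j.+2 <= i)%N \/ (i < j)%N by lia.
  by apply: Y_gt; lia.
by apply: Y_lt; lia.
Qed.

End RowRules.

Section Signs.
Variables (k : fieldType) (q : k) (A : algType k) (n : nat).
Hypothesis hn : (3 <= n)%N.

Lemma row_rule_sign (e z : nat -> A) : rowrule q n (dplus n) e z ->
  rowrule q n (dsign n) (fun i => esgn k n i *: e i) (fun t => sgn k n t *: z t).
Proof.
move=> H i t hi ht; rewrite -!scalerAr -!scalerAl H // !scalerDr.
congr (_ + _); first by rewrite !scalerA; congr (_ *: _); ring.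
rewrite scalerA.
rewrite /dplus /dsign; case: ifP => h1; [|case: ifP => h2; last by rewrite scaler0].
  congr (_ *: _); rewrite /sgn /esgn.
  have [i1|i2] : i = 1%N \/ (2 <= i)%N by lia.
    rewrite i1 in h1 *; rewrite eqxx (_ : (t <= n)%N); last by arrlia.
    rewrite (_ : (arrB n 1 <= n)%N = false); last by arrlia.
    rewrite (_ : t = n.-1); last by arrlia.
    by rewrite -exprD addnn -mul2n exprM sqrrN !expr1n.
  have -> : (i == 1)%N = false by lia.
  have -> : (t <= n)%N by arrlia.
  have -> : arrB n i = t.+1 by arrlia.
  by have -> : (t < n)%N; [arrlia | rewrite exprS].
rewrite /= -scaleNr; congr (_ *: _); rewrite /sgn /esgn.
rewrite (_ : (pr n (arrA n i) <= n)%N = false); last by arrlia.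
have [i1|i2] : i = 1%N \/ (2 <= i)%N by lia.
  rewrite i1 in h1 h2 *; rewrite eqxx (_ : (t <= n)%N); last by arrlia.
  rewrite (_ : t = n.-1.+1); last by arrlia.
  by rewrite exprS mulrCA -exprD addnn -mul2n exprM sqrrN !expr1n mulr1.
have -> : (i == 1)%N = false by lia.
by have -> : (t <= n)%N = false; [arrlia | rewrite mulr1].
Qed.

End Signs.

(** * Two rows of root vectors *)

Section Derivation.
Variables (k : fieldType) (A : algType k) (e : A).

(** Right q-commutation with e acts as a skew derivation: u1 is the image of u and c records its
    weight. By [deriv_uniq] an identity u = v may be differentiated, and this is how one relation
    spreads to all pairs of row vectors. *)
Definition deriv (c : k) (u u1 : A) : Prop := u * e = c *: (e * u) + u1.

Lemma deriv_uniq c u v u1 v1 : u = v -> deriv c u u1 -> deriv c v v1 -> u1 = v1.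
Proof. by rewrite /deriv => -> -> /addrI. Qed.

Lemma derivM c d u u1 v v1 : deriv c u u1 -> deriv d v v1 ->
  deriv (c * d) (u * v) (d *: (u1 * v) + u * v1).
Proof.
rewrite /deriv => hu hv; rewrite -mulrA hv mulrDr -scalerAr [u * (e * v)]mulrA hu.
by rewrite mulrDl !scalerDr -scalerAl scalerA -mulrA mulrC addrA.
Qed.

Lemma derivD c u u1 v v1 : deriv c u u1 -> deriv c v v1 -> deriv c (u + v) (u1 + v1).
Proof. by rewrite /deriv => hu hv; rewrite mulrDl hu hv mulrDr scalerDr addrACA. Qed.

Lemma derivZ c d u u1 : deriv c u u1 -> deriv c (d *: u) (d *: u1).
Proof.
by rewrite /deriv => hu; rewrite -scalerAl hu scalerDr -scalerAr !scalerA mulrC.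
Qed.

Lemma derivN c u u1 : deriv c u u1 -> deriv c (- u) (- u1).
Proof. by move/(derivZ (-1)); rewrite !scaleN1r. Qed.

Lemma deriv0 c : deriv c 0 0.
Proof. by rewrite /deriv mul0r mulr0 scaler0 addr0. Qed.

Lemma deriv_eq c d u u1 v1 : deriv c u u1 -> c = d -> u1 = v1 -> deriv d u v1.
Proof. by move=> h <- <-. Qed.

Lemma deriv_commL c r u w v : deriv c u w -> deriv 1 v 0 ->
  v * u = r *: (u * v) -> v * w = r *: (w * v).
Proof.
move=> du dv h; have := derivZ r (derivM du dv); rewrite mulr1.
have := derivM dv du; rewrite mul1r => d1 d2.
by have := deriv_uniq h d1 d2; rewrite mul0r mulr0 scaler0 add0r addr0 scale1r.
Qed.

Lemma deriv_commR c r u w v : deriv c u w -> deriv 1 v 0 ->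
  u * v = r *: (v * u) -> w * v = r *: (v * w).
Proof.
move=> du dv h; have := derivM du dv; rewrite mulr1.
have := derivZ r (derivM dv du); rewrite mul1r => d1 d2.
by have := deriv_uniq h d2 d1; rewrite mul0r mulr0 scaler0 add0r addr0 scale1r.
Qed.

End Derivation.

(** * Relations inside one row *)

Section Rows.
Variables (k : fieldType) (q : k) (A : algType k) (n : nat).
Hypotheses (q0 : q != 0) (qq : q + q^-1 != 0) (hn : (3 <= n)%N).
Local Notation pr := (pr n).
Local Notation arrA := (arrA n).
Local Notation arrB := (arrB n).
Variable e : nat -> A.

Lemma arr_bounds i : (1 <= i <= n)%N ->
  [/\ (1 <= arrA i)%N, (arrA i < n)%N, (arrA i < arrB i)%N, (arrB i <= n.+1)%N &
      (pr (arrB i) < pr (arrA i) <= n.*2)%N].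
Proof. by move=> hi; split; arrlia. Qed.

(** The last clause isolates e_n, the only e_i that moves weight 1: it is needed for t = 2 and t =
    2n alone, so elsewhere in [commute_first] the factor x 1 stays fixed. *)
Lemma arrow_to t : (2 <= t <= n.*2)%N -> exists i, [/\ (1 <= i <= n)%N,
  t = arrB i \/ t = pr (arrA i) & (i == n) = (t == 2) || (t == n.*2)].
Proof.
move=> ht; have [h|[h|h]] : (t <= n)%N \/ t = n.+1 \/ (n.+2 <= t)%N by lia.
- by exists (n.+2 - t)%N; split; [|left|]; arrlia.
- by exists 1%N; split; [|left|]; arrlia.
- by exists (t - n)%N; split; [|right|]; arrlia.
Qed.

Section OneRow.
Variable x : nat -> A.
Hypothesis Hx : rowrule q n (dsign n) e x.

Lemma row_A i : (1 <= i <= n)%N -> deriv (e i) q^-1 (x (arrA i)) (x (arrB i)).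
Proof.
move=> hi; have [h1 h2 h3 h4 h5] := arr_bounds hi.
by rewrite /deriv Hx ?/cw ?/dsign ?eqxx //; lia.
Qed.

Lemma row_B' i : (1 <= i <= n)%N ->
  deriv (e i) q^-1 (x (pr (arrB i))) (- x (pr (arrA i))).
Proof.
move=> hi; have [h1 h2 h3 h4 h5] := arr_bounds hi.
rewrite /deriv Hx ?/cw ?/dsign ?eqxx ?orbT //; last by rewrite /pr; lia.
by rewrite (_ : (pr (arrB i) == arrA i) = false) //; arrlia.
Qed.

Lemma row_tgt i t : (1 <= i <= n)%N -> (t == arrB i) || (t == pr (arrA i)) ->
  deriv (e i) q (x t) 0.
Proof.
move=> hi ht; have [h1 h2 h3 h4 h5] := arr_bounds hi.
rewrite /deriv Hx ?(cw_succ q0 qq hn hi ht) //; last first.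
  by case/orP: ht => /eqP ->; rewrite ?/pr; lia.
have a : (t == arrA i) = false by case/orP: ht => /eqP ->; arrlia.
have b : (t == pr (arrB i)) = false by case/orP: ht => /eqP ->; arrlia.
by rewrite /dsign a b.
Qed.

Lemma row_B i : (1 <= i <= n)%N -> deriv (e i) q (x (arrB i)) 0.
Proof. by move=> hi; apply: row_tgt; rewrite // eqxx. Qed.

Lemma row_A' i : (1 <= i <= n)%N -> deriv (e i) q (x (pr (arrA i))) 0.
Proof. by move=> hi; apply: row_tgt; rewrite // eqxx orbT. Qed.

Lemma row_O i t : (1 <= i <= n)%N -> (1 <= t <= n.*2)%N ->
  [&& t != arrA i, t != arrB i, t != pr (arrA i) & t != pr (arrB i)] ->
  deriv (e i) 1 (x t) 0.
Proof.
move=> hi ht /and4P[/negPf a /negPf b /negPf c /negPf d].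
by rewrite /deriv Hx ?/cw ?/dsign ?a ?b ?c ?d.
Qed.

Hypothesis base : x 2 * x 1 = q^-1 *: (x 1 * x 2).

Let N s := forall t, (s < t <= n.*2)%N -> t != pr s ->
  x t * x s = q^-1 *: (x s * x t).

Lemma commute_first : N 1.
Proof.
move=> t; elim/ltn_ind: t => t IHt ht ht'.
have [->|h2] : t = 2%N \/ (3 <= t)%N by lia.
  exact: base.
have ht2 : (2 <= t <= n.*2)%N by lia.
have [i [hi harr hin]] := arrow_to ht2.
have hi' : (i < n)%N by move: hin ht'; rewrite /pr; lia.
have [h3 h4 h5 h6 h7] := arr_bounds hi.
have d1 : deriv (e i) 1 (x 1) 0 by apply: row_O => //; arrlia.
case: harr => tE.
  rewrite tE; apply: (deriv_commR (row_A hi) d1).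
  by apply: IHt; arrlia.
have := IHt (pr (arrB i)) _ _ _.
move=> /(_ _ _ _)/(deriv_commR (row_B' hi) d1).
rewrite tE mulNr mulrN scalerN => h; apply: oppr_inj; apply: h; arrlia.
Qed.

(** The hypothesis is differentiated by e_i, which moves both of its factors. *)
Lemma star i : (1 <= i <= n)%N ->
  x (pr (arrB i)) * x (arrA i) = q^-1 *: (x (arrA i) * x (pr (arrB i))) ->
  x (pr (arrA i)) * x (arrA i) = x (arrA i) * x (pr (arrA i)) +
    (q *: (x (pr (arrB i)) * x (arrB i)) - q^-1 *: (x (arrB i) * x (pr (arrB i)))).
Proof.
move=> hi h; have dA := row_A hi; have dB := row_B' hi.
have E := deriv_uniq h (derivM dB dA) (derivZ q^-1 (derivM dA dB)).
move/eqP: E; rewrite -subr_eq0 => /eqP E; apply: subr0_eq.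
set u := _ - _ in E; transitivity (- q *: u); last by rewrite E scaler0.
by rewrite /u; ncfield.
Qed.

(** Differentiating [star] once more by the same e_i gives q(q + q^{-1}) times the claim. *)
Lemma star' i : (1 <= i <= n)%N ->
  x (pr (arrB i)) * x (arrA i) = q^-1 *: (x (arrA i) * x (pr (arrB i))) ->
  x (pr (arrA i)) * x (arrB i) = q^-1 *: (x (arrB i) * x (pr (arrA i))).
Proof.
move=> hi h; have dA := row_A hi; have dB := row_B' hi.
have dA' := row_A' hi; have dB' := row_B hi.
have d1 := derivM dA' dA; have d2 := derivM dA dA'.
have d3 := derivZ q (derivM dB dB'); have d4 := derivZ q^-1 (derivM dB' dB).
have c1 : q * q^-1 = 1 by rewrite mulfV.
have c2 : q^-1 * q = 1 by rewrite mulVf.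
move: d1 d2 d3 d4; rewrite !c1 !c2 => d1 d2 d3 d4.
have E := deriv_uniq (star hi h) d1 (derivD d2 (derivD d3 (derivN d4))).
move/eqP: E; rewrite -subr_eq0 => /eqP E; apply: subr0_eq.
set u := _ - _ in E; apply: (scalerI q0); apply: (scalerI qq).
rewrite !scaler0; transitivity u; last exact: E.
by rewrite /u; ncfield.
Qed.

(** Induction along an arrow into s. The other factor x t is fixed by this e_i, except when s = arrB
    i and t = (arrA i)', where both ends move and [star'] takes over. *)
Lemma commute_row s : (1 <= s <= n.*2)%N -> N s.
Proof.
elim/ltn_ind: s => s IHs hs.
have [->|h2] : s = 1%N \/ (2 <= s)%N by lia.
  exact: commute_first.
have hs2 : (2 <= s <= n.*2)%N by lia.
have [i [hi harr _]] := arrow_to hs2; have [h3 h4 h5 h6 h7] := arr_bounds hi.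
move=> t ht ht'; case: harr => sE; rewrite sE in ht ht' *.
  have NA : N (arrA i) by apply: IHs; lia.
  have [->|tA] := eqVneq t (pr (arrA i)).
    by apply: star' => //; apply: NA; arrlia.
  have d1 : deriv (e i) 1 (x t) 0 by apply: row_O => //; arrlia.
  by apply: (deriv_commL (row_A hi) d1); apply: NA; arrlia.
have NA : N (pr (arrB i)) by apply: IHs; arrlia.
have d1 : deriv (e i) 1 (x t) 0 by apply: row_O => //; arrlia.
have := NA t; move=> /(_ _ _)/(deriv_commL (row_B' hi) d1).
rewrite mulrN mulNr scalerN => h; apply: oppr_inj; apply: h; arrlia.
Qed.

Lemma star_row i : (1 <= i <= n)%N ->
  x (pr (arrA i)) * x (arrA i) = x (arrA i) * x (pr (arrA i)) +
    (q *: (x (pr (arrB i)) * x (arrB i)) - q^-1 *: (x (arrB i) * x (pr (arrB i)))).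
Proof.
by move=> hi; apply: star => //; apply: commute_row; have := arr_bounds hi; arrlia.
Qed.

(** Both e_1 and e_2 have an arrow out of weight n-1, ending at n+1 and n respectively. The two
    resulting forms of [star_row] differ by interchanging x n and x n', and equating them gives (q +
    q^{-1}) times the claim. *)
Lemma commute_mid : x (pr n) * x n = x n * x (pr n).
Proof.
have h1 := star_row (i := 1); have h2 := star_row (i := 2).
have E : x (pr (arrA 1)) * x (arrA 1) = x (pr (arrA 2)) * x (arrA 2).
  by congr (x _ * x _); arrlia.
have a1 : arrB 1 = pr n by arrlia.
have a2 : pr (arrB 1) = n by arrlia.
have a3 : arrB 2 = n by arrlia.
have a4 : x (arrA 1) * x (pr (arrA 1)) = x (arrA 2) * x (pr (arrA 2)).
  by congr (x _ * x _); arrlia.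
have hi1 : (1 <= 1 <= n)%N by lia.
have hi2 : (1 <= 2 <= n)%N by lia.
have := etrans (esym (h1 hi1)) (etrans E (h2 hi2)); rewrite a4 a2 a1 a3.
move=> /addrI/eqP; rewrite -subr_eq0 => /eqP; set u := _ - _ => {}E.
apply: subr0_eq; apply: (scalerI qq); rewrite scaler0.
by transitivity (- u); [rewrite /u; ncfield | rewrite E oppr0].
Qed.

Lemma commute_prime s : (1 <= s <= n)%N ->
  x (pr s) * x s = x s * x (pr s) +
    qhat q *: \sum_(s.+1 <= l < n.+1) q ^ (l%:Z - s%:Z - 1) *: (x l * x (pr l)).
Proof.
move: s; apply: (@down_ind n).
  by rewrite big_geq // scaler0 addr0 commute_mid.
move=> s hs IHs; have hi : (1 <= n.+1 - s <= n)%N by lia.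
have := star_row hi.
have -> : arrA (n.+1 - s) = s by arrlia.
have -> : arrB (n.+1 - s) = s.+1 by arrlia.
move=> ->; congr (_ + _); rewrite IHs [in RHS]big_ltn; last by lia.
have -> : (s.+1%:Z - s%:Z - 1 = 0)%R by lia.
rewrite expr0z scale1r.
have -> : \sum_(s.+2 <= l < n.+1) q ^ (l%:Z - s%:Z - 1) *: (x l * x (pr l)) =
  q *: \sum_(s.+2 <= l < n.+1) q ^ (l%:Z - s.+1%:Z - 1) *: (x l * x (pr l)).
  rewrite scaler_sumr; apply: eq_bigr => l _; rewrite scalerA; congr (_ *: _).
  by rewrite -{2}[q]expr1z -expfzDr //; congr (_ ^ _); lia.
by rewrite /qhat; ncfield.
Qed.

End OneRow.

(** * Relations between two rows *)

Section TwoRows.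
Variables x y : nat -> A.
Hypotheses (Hx : rowrule q n (dsign n) e x) (Hy : rowrule q n (dsign n) e y).

(** The summand of height m in the pairing of the two rows. The weights n and n+1 are incomparable
    and share height n, hence two products there. *)
Definition vterm m : A :=
  if (m < n)%N then x (pr m) * y m
  else if m == n then x (pr n) * y n + x n * y (pr n)
  else x (pr m.+1) * y m.+1.

(* [tsum j] is the sum of [q^(j+1-h l) x_{l'} y_l] over the [l] of height
   [h l <= j], where [h l = l] for [l <= n] and [h l = l - 1] for [l > n]. *)
Fixpoint tsum j : A := if j is j'.+1 then q *: (tsum j' + vterm j) else 0.

(** The value to be proved for q y_s x_t. It is needed for all s, since the induction passes through
    every weight. The index [(s - (n < s)).-1] is the height of s minus 1; s = n and s = n+1 are
    treated alike because these weights are incomparable. *)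
Definition cross s t : A :=
  if t == s then q^-1 *: (x s * y s)
  else if t == pr s then
    if (s <= n.+1)%N then q *: (x (pr s) * y s) + qhat q *: tsum (s - (n < s)).-1
    else q *: (x (pr s) * y s) + qhat q *: tsum (s - (n < s)).-1
         - qhat q *: (x s * y (pr s))
  else if (s < t)%N then x t * y s
  else x t * y s - qhat q *: (x s * y t).

Let qV : q * q^-1 = 1. Proof. by rewrite mulfV. Qed.
Let Vq : q^-1 * q = 1. Proof. by rewrite mulVf. Qed.

Lemma vterm_far i m : (1 <= i <= n)%N ->
  (1 <= m < arrA i)%N || (arrB i < m < (pr (arrB i)).-1)%N ->
  deriv (e i) 1 (vterm m) 0.
Proof.
move=> hi hm; have [h3 h4 h5 h6 h7] := arr_bounds hi.
have O t : (1 <= t <= n.*2)%N ->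
    [&& t != arrA i, t != arrB i, t != pr (arrA i) & t != pr (arrB i)] ->
    deriv (e i) 1 (x t) 0 /\ deriv (e i) 1 (y t) 0.
  by move=> ht ho; split; apply: row_O.
have M s t : (1 <= s <= n.*2)%N -> (1 <= t <= n.*2)%N ->
    [&& s != arrA i, s != arrB i, s != pr (arrA i) & s != pr (arrB i)] ->
    [&& t != arrA i, t != arrB i, t != pr (arrA i) & t != pr (arrB i)] ->
    deriv (e i) 1 (x s * y t) 0.
  move=> hs ht hso hto; have [d1 _] := O s hs hso; have [_ d2] := O t ht hto.
  by apply: (deriv_eq (derivM d1 d2)); rewrite ?mulr1 // mul0r mulr0 scaler0 addr0.
rewrite /vterm; case: ifP => hmn; first by apply: M; arrlia.
case: eqP => hmn'; last by apply: M; arrlia.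
by rewrite -[0]addr0; apply: derivD; apply: M; arrlia.
Qed.

Lemma vterm_A i : (1 <= i <= n)%N ->
  deriv (e i) 1 (vterm (arrA i)) (x (pr (arrA i)) * y (arrB i)).
Proof.
move=> hi; have [h3 h4 h5 h6 h7] := arr_bounds hi; rewrite /vterm h4.
apply: (deriv_eq (derivM (row_A' Hx hi) (row_A Hy hi))) => //.
by rewrite mul0r scaler0 add0r.
Qed.

Lemma vterm_B i : (3 <= i <= n)%N ->
  deriv (e i) 1 (vterm (arrB i)) (- q *: (x (pr (arrA i)) * y (arrB i))).
Proof.
move=> hi; have hi1 : (1 <= i <= n)%N by lia.
rewrite /vterm (_ : (arrB i < n)%N); last by arrlia.
apply: (deriv_eq (derivM (row_B' Hx hi1) (row_B Hy hi1))) => //.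
by rewrite mulr0 addr0 mulNr scalerN scaleNr.
Qed.

Lemma tsum_low i j : (1 <= i <= n)%N -> (j < arrA i)%N -> deriv (e i) 1 (tsum j) 0.
Proof.
move=> hi; elim: j => [|j IHj] hj; first exact: deriv0.
have d1 := IHj (ltnW hj); have d2 : deriv (e i) 1 (vterm j.+1) 0.
  by apply: vterm_far; rewrite ?hj.
by apply: (deriv_eq (derivZ q (derivD d1 d2))); rewrite // addr0 scaler0.
Qed.

Lemma tsum_A i : (1 <= i <= n)%N ->
  deriv (e i) 1 (tsum (arrA i)) (q *: (x (pr (arrA i)) * y (arrB i))).
Proof.
move=> hi; have [h3 h4 h5 h6 h7] := arr_bounds hi.
have d1 := vterm_A hi; have aE : (arrA i).-1.+1 = arrA i by lia.
have d2 : deriv (e i) 1 (tsum (arrA i).-1) 0 by apply: tsum_low => //; lia.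
rewrite -aE /= aE.
by apply: (deriv_eq (derivZ q (derivD d2 d1))) => //; rewrite add0r.
Qed.

(** In the q-weighted sum the images of the terms at arrA i and arrB i = arrA i + 1 cancel, so a
    partial sum containing both is annihilated. *)
Lemma tsum_mid i j : (3 <= i <= n)%N -> (arrB i <= j < (pr (arrB i)).-1)%N ->
  deriv (e i) 1 (tsum j) 0.
Proof.
move=> hi; have hi1 : (1 <= i <= n)%N by lia.
elim: j => [|j IHj] hj; first exact: deriv0.
have [jB|jB] : j.+1 = arrB i \/ (arrB i <= j)%N by lia.
  rewrite /= jB (_ : j = arrA i); last by arrlia.
  apply: (deriv_eq (derivZ q (derivD (tsum_A hi1) (vterm_B hi)))) => //.
  by rewrite scaleNr addrN scaler0.
have d2 : deriv (e i) 1 (vterm j.+1) 0 by apply: vterm_far => //; lia.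
have d1 : deriv (e i) 1 (tsum j) 0 by apply: IHj; lia.
by apply: (deriv_eq (derivZ q (derivD d1 d2))); rewrite // addr0 scaler0.
Qed.

Lemma cross_eq s : cross s s = q^-1 *: (x s * y s).
Proof. by rewrite /cross eqxx. Qed.

Lemma cross_lt s t : (s < t)%N -> t != pr s -> cross s t = x t * y s.
Proof. by move=> h /negPf h'; rewrite /cross h' h; case: eqP => // ?; lia. Qed.

Lemma cross_gt s t : (t < s)%N -> t != pr s ->
  cross s t = x t * y s - qhat q *: (x s * y t).
Proof.
move=> h /negPf h'; rewrite /cross h' (_ : (s < t)%N = false); last by lia.
by case: eqP => // ?; lia.
Qed.

Lemma cross_pr_lo s : (1 <= s <= n.+1)%N ->
  cross s (pr s) = q *: (x (pr s) * y s) + qhat q *: tsum (s - (n < s)).-1.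
Proof.
move=> h; rewrite /cross eqxx; have /negPf-> : pr s != s by arrlia.
by have -> : (s <= n.+1)%N by lia.
Qed.

Lemma cross_pr_hi s : (n.+1 < s <= n.*2)%N ->
  cross s (pr s) = q *: (x (pr s) * y s) + qhat q *: tsum (s - 1).-1
     - qhat q *: (x s * y (pr s)).
Proof.
move=> h; rewrite /cross eqxx; have /negPf-> : pr s != s by arrlia.
have -> : (s <= n.+1)%N = false by lia.
by have -> : (n < s)%N by lia.
Qed.

Let P s t := q *: (y s * x t).

Section Step.
Variable i : nat.
Hypothesis hi : (1 <= i <= n)%N.

Lemma lin1 (L R u v : A) c : u = v -> L - R = c *: (u - v) -> L = R.
Proof. by move=> -> h; apply: subr0_eq; rewrite h subrr scaler0. Qed.

Lemma lin2 (L R u v u' v' : A) c c' : u = v -> u' = v' ->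
  L - R = c *: (u - v) + c' *: (u' - v') -> L = R.
Proof. by move=> -> -> h; apply: subr0_eq; rewrite h !subrr !scaler0 addr0. Qed.

Lemma pr_pr t : (1 <= t <= n.*2)%N -> pr (pr t) = t.
Proof. by rewrite /pr => ht; lia. Qed.

(** Differentiating the relation for y_A x_t replaces y_A by y_B. If e_i also moves x_t, the extra
    product is eliminated by a second instance of the hypothesis, whence [lin2]. *)
Lemma cross_step_A t : (1 <= t <= n.*2)%N ->
  (forall t', (1 <= t' <= n.*2)%N -> P (arrA i) t' = cross (arrA i) t') ->
  P (arrB i) t = cross (arrB i) t.
Proof.
move=> ht IH; have [h3 h4 h5 h6 h7] := arr_bounds hi.
have xA := row_A Hx hi; have yA := row_A Hy hi.
have xB := row_B Hx hi; have yB := row_B Hy hi.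
have xA' := row_A' Hx hi; have yA' := row_A' Hy hi.
have xB' := row_B' Hx hi; have yB' := row_B' Hy hi.
have EA := IH (arrA i) _; have EB := IH (arrB i) _.
have EA' := IH (pr (arrA i)) _; have EB' := IH (pr (arrB i)) _.
have jE : (arrA i - (n < arrA i)).-1 = (arrA i).-1 by arrlia.
rewrite cross_eq in EA; rewrite cross_lt in EB; try by arrlia.
rewrite cross_pr_lo ?jE in EA'; try by arrlia.
rewrite cross_lt in EB'; try by arrlia.
have [tA|tA] := eqVneq t (arrA i).
  rewrite tA cross_gt; try by arrlia.
  have E := deriv_uniq (EA _) (derivZ q (derivM yA xA)) (derivZ q^-1 (derivM xA yA)).
  apply: (lin2 (c := q) (c' := - q) (E _) (EB _)); try by arrlia.
  by rewrite /P /qhat; ncfield.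
have [tB|tB] := eqVneq t (arrB i).
  rewrite tB cross_eq; have := derivM xB yA; have := derivZ q (derivM yA xB).
  rewrite qV Vq => d1 d2; have E := deriv_uniq (EB _) d1 d2.
  by apply: (lin1 (c := q^-1) (E _)); [arrlia | rewrite /P /qhat; ncfield].
have [tA'|tA'] := eqVneq t (pr (arrA i)).
  rewrite tA' cross_lt; try by arrlia.
  have d0 : deriv (e i) 1 (tsum (arrA i).-1) 0 by apply: tsum_low => //; lia.
  have := derivM xA' yA; have := derivZ q (derivM yA xA').
  rewrite qV Vq => d1 d2.
  have E := deriv_uniq (EA' _) d1 (derivD (derivZ q d2) (derivZ (qhat q) d0)).
  by apply: (lin1 (c := q^-1) (E _)); [arrlia | rewrite /P /qhat; ncfield].
have [tB'|tB'] := eqVneq t (pr (arrB i)).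
  rewrite tB' cross_pr_lo; try by arrlia.
  have -> : (arrB i - (n < arrB i)).-1 = (arrA i).-1.+1 by arrlia.
  rewrite [tsum _]/= prednK // /vterm h4.
  have E := deriv_uniq (EB' _) (derivZ q (derivM yA xB')) (derivM xB' yA).
  apply: (lin2 (c := q) (c' := q) (E _) (EA' _)); try by arrlia.
  by rewrite /P /qhat; ncfield.
have Et := IH t ht.
have xt : deriv (e i) 1 (x t) 0 by apply: row_O => //; apply/and4P.
have yt : deriv (e i) 1 (y t) 0 by apply: row_O => //; apply/and4P.
have := derivM xt yA; have := derivM xA yt; have := derivZ q (derivM yA xt).
rewrite mulr1 mul1r => d1 d2 d3.
have [h|h] : (t < arrA i)%N \/ (arrB i < t)%N by arrlia.
  rewrite cross_gt in Et; try by arrlia.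
  rewrite cross_gt; try by arrlia.
  have E := deriv_uniq Et d1 (derivD d3 (derivN (derivZ (qhat q) d2))).
  by apply: (lin1 (c := 1) E); rewrite /P /qhat; ncfield.
rewrite cross_lt in Et; try by arrlia.
rewrite cross_lt; try by arrlia.
have E := deriv_uniq Et d1 d3.
by apply: (lin1 (c := 1) E); rewrite /P /qhat; ncfield.
Qed.

Lemma cross_step_B' t : (1 <= t <= n.*2)%N ->
  (forall t', (1 <= t' <= n.*2)%N -> P (pr (arrB i)) t' = cross (pr (arrB i)) t') ->
  P (pr (arrA i)) t = cross (pr (arrA i)) t.
Proof.
move=> ht IH; have [h3 h4 h5 h6 h7] := arr_bounds hi.
have xA := row_A Hx hi; have yA := row_A Hy hi.
have xB := row_B Hx hi; have yB := row_B Hy hi.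
have xA' := row_A' Hx hi; have yA' := row_A' Hy hi.
have xB' := row_B' Hx hi; have yB' := row_B' Hy hi.
have /IH EA : (1 <= arrA i <= n.*2)%N by lia.
have /IH EB : (1 <= arrB i <= n.*2)%N by lia.
have /IH EA' : (1 <= pr (arrA i) <= n.*2)%N by arrlia.
have /IH EB' : (1 <= pr (arrB i) <= n.*2)%N by arrlia.
have ppA : pr (pr (arrA i)) = arrA i by apply: pr_pr; lia.
have ppB : pr (pr (arrB i)) = arrB i by apply: pr_pr; lia.
rewrite cross_gt in EA; try by arrlia.
rewrite cross_lt in EA'; try by arrlia.
rewrite cross_eq in EB'.
have [tA|tA] := eqVneq t (arrA i).
  rewrite tA -[X in cross _ X]ppA cross_pr_hi; last by arrlia.
  rewrite ppA; have E := deriv_uniq EA (derivZ q (derivM yB' xA))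
    (derivD (derivM xA yB') (derivN (derivZ (qhat q) (derivM xB' yA)))).
  have -> : (pr (arrA i) - 1).-1 = (pr (arrA i)).-2.-1.+1 by arrlia.
  rewrite -[X in cross _ X]ppB in EB.
  (* For i <= 2 the arrow meets the middle weights, where [cross] has no correction term and
     [vterm n] consists of two products. *)
  have [i3|i3] : (3 <= i)%N \/ (i <= 2)%N by lia.
    rewrite cross_pr_hi ?ppB in EB; try by arrlia.
    have jE : (pr (arrB i) - 1).-1 = (pr (arrA i)).-2.-1 by arrlia.
    rewrite jE in EB.
    have vE : vterm (pr (arrA i)).-2.-1.+1 = x (arrB i) * y (pr (arrB i)).
      rewrite /vterm; have -> : ((pr (arrA i)).-2.-1.+1 < n)%N = false by arrlia.
      have /negPf-> : (pr (arrA i)).-2.-1.+1 != n by arrlia.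
      by congr (x _ * y _); arrlia.
    rewrite [tsum _.+1]/= vE.
    apply: (lin2 (c := - q) (c' := q) E EB).
    by rewrite /P /qhat; ncfield.
  rewrite cross_pr_lo ?ppB in EB; try by arrlia.
  have jE : (pr (arrB i) - (n < pr (arrB i))).-1 = (pr (arrA i)).-2.-1 by arrlia.
  rewrite jE in EB.
  have vE : vterm (pr (arrA i)).-2.-1.+1 =
      x (arrB i) * y (pr (arrB i)) + x (pr (arrB i)) * y (arrB i).
    have -> : (pr (arrA i)).-2.-1.+1 = n by arrlia.
    rewrite /vterm ltnn eqxx; have [i1|i2] : i = 1%N \/ i = 2%N by lia.
      by congr (x _ * y _ + x _ * y _); arrlia.
    by rewrite addrC; congr (x _ * y _ + x _ * y _); arrlia.
  rewrite [tsum _.+1]/= vE.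
  apply: (lin2 (c := - q) (c' := q) E EB).
  by rewrite /P /qhat; ncfield.
have [tB|tB] := eqVneq t (arrB i).
  rewrite tB cross_gt; try by arrlia.
  rewrite -[X in cross _ X]ppB in EB.
  have := derivM xB yB'; have := derivM xB' yB; have := derivZ q (derivM yB' xB).
  rewrite Vq qV => d1 d2 d3.
  (* For i >= 3 the sum is annihilated and the correction term contributes. For i <= 2 there is no
     correction term, and the top summand of the sum takes its place. *)
  have [i3|i3] : (3 <= i)%N \/ (i <= 2)%N by lia.
    rewrite cross_pr_hi ?ppB in EB; try by arrlia.
    have d0 : deriv (e i) 1 (tsum (pr (arrB i) - 1).-1) 0.
      by apply: tsum_mid => //; arrlia.
    have E := deriv_uniq EB d1 (derivD (derivD (derivZ q d3) (derivZ (qhat q) d0))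
       (derivN (derivZ (qhat q) d2))).
    by apply: (lin1 (c := - q^-1) E); rewrite /P /qhat; ncfield.
  rewrite cross_pr_lo ?ppB in EB; try by arrlia.
  have d0 := tsum_A hi.
  have jE : (pr (arrB i) - (n < pr (arrB i))).-1 = arrA i by arrlia.
  rewrite jE in EB.
  have E := deriv_uniq EB d1 (derivD (derivZ q d3) (derivZ (qhat q) d0)).
  by apply: (lin1 (c := - q^-1) E); rewrite /P /qhat; ncfield.
have [tA'|tA'] := eqVneq t (pr (arrA i)).
  rewrite tA' cross_eq; have := derivM xA' yB'; have := derivZ q (derivM yB' xA').
  rewrite qV Vq => d1 d2; have E := deriv_uniq EA' d1 d2.
  by apply: (lin1 (c := - q^-1) E); rewrite /P /qhat; ncfield.
have [tB'|tB'] := eqVneq t (pr (arrB i)).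
  rewrite tB' cross_gt; try by arrlia.
  have E := deriv_uniq EB' (derivZ q (derivM yB' xB')) (derivZ q^-1 (derivM xB' yB')).
  apply: (lin2 (c := - q) (c' := - q) E EA').
  by rewrite /P /qhat; ncfield.
have Et := IH t ht.
have xt : deriv (e i) 1 (x t) 0 by apply: row_O => //; apply/and4P.
have yt : deriv (e i) 1 (y t) 0 by apply: row_O => //; apply/and4P.
have := derivM xt yB'; have := derivM xB' yt; have := derivZ q (derivM yB' xt).
rewrite mulr1 mul1r => d1 d2 d3.
have [h|h] : (t < pr (arrB i))%N \/ (pr (arrA i) < t)%N by arrlia.
  rewrite cross_gt in Et; try by arrlia.
  rewrite cross_gt; try by arrlia.
  have E := deriv_uniq Et d1 (derivD d3 (derivN (derivZ (qhat q) d2))).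
  by apply: (lin1 (c := - 1) E); rewrite /P /qhat; ncfield.
rewrite cross_lt in Et; try by arrlia.
rewrite cross_lt; try by arrlia.
have E := deriv_uniq Et d1 d3.
by apply: (lin1 (c := - 1) E); rewrite /P /qhat; ncfield.
Qed.

End Step.

Hypothesis base : forall t, (1 <= t <= n.*2)%N -> P 1 t = cross 1 t.

Lemma cross_rel s t : (1 <= s <= n.*2)%N -> (1 <= t <= n.*2)%N ->
  q *: (y s * x t) = cross s t.
Proof.
move=> hs; elim/ltn_ind: s hs t => s IHs hs t ht; rewrite -/(P s t).
have [->|h2] : s = 1%N \/ (2 <= s)%N by lia.
  exact: base.
have hs2 : (2 <= s <= n.*2)%N by lia.
have [i [hi harr _]] := arrow_to hs2; have [h3 h4 h5 h6 h7] := arr_bounds hi.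
case: harr => sE; rewrite sE in IHs *.
  by apply: cross_step_A => // t' ht'; apply: IHs => //; lia.
by apply: cross_step_B' => // t' ht'; apply: IHs => //; arrlia.
Qed.

End TwoRows.
End Rows.

(* [relsT 1] is [relsX]; in general every product X_{2s} X_{1t} is rescaled by
   [th], which is the effect of the cocycle twist when [th = q]. *)
Definition relsT (k : fieldType) (th q : k) (n : nat) (B : algType k)
  (x : nat * nat -> B) : Prop :=
  let X r j := x (r, j) in
  let qh := qhat q in
  let idx s := (1 <= s <= n.*2)%N in
  (forall r s t, (1 <= r <= 2)%N -> idx s -> idx t -> (s < t)%N -> t != pr n s ->
     X r t * X r s = q^-1 *: (X r s * X r t)) /\
  (forall r s, (1 <= r <= 2)%N -> idx s -> (s < pr n s)%N ->
     X r (pr n s) * X r s = X r s * X r (pr n s) +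
       qh *: \sum_(s.+1 <= l < n.+1) q ^ (l%:Z - s%:Z - 1) *: (X r l * X r (pr n l))) /\
  (forall s, idx s -> th *: (X 2 s * X 1 s) = q^-1 *: (X 1 s * X 2 s)) /\
  (forall s t, idx s -> idx t -> (s < t)%N -> t != pr n s ->
     th *: (X 2 s * X 1 t) = X 1 t * X 2 s) /\
  (forall s t, idx s -> idx t -> (s < t)%N -> t != pr n s ->
     th *: (X 2 t * X 1 s) = X 1 s * X 2 t - qh *: (X 1 t * X 2 s)) /\
  (forall s, idx s -> (s < pr n s)%N ->
     th *: (X 2 s * X 1 (pr n s)) = q *: (X 1 (pr n s) * X 2 s) +
       qh *: \sum_(1 <= l < s) q ^ (s%:Z - l%:Z) *: (X 1 (pr n l) * X 2 l)) /\
  (forall s, idx s -> (s < pr n s)%N ->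
     th *: (X 2 (pr n s) * X 1 s) = q *: (X 1 s * X 2 (pr n s)) +
       qh *: \sum_(s.+1 <= l < n.+1) q ^ (l%:Z - s%:Z) *: (X 1 l * X 2 (pr n l)) +
       (qh * q^-1) *: \sum_(1 <= l < n.+1) q ^ ((pr n l)%:Z - s%:Z) *:
          (X 1 (pr n l) * X 2 l) -
       qh *: (X 1 (pr n s) * X 2 s)).

Lemma relsT1 (k : fieldType) (q : k) n (B : algType k) (x : nat * nat -> B) :
  relsX q n x <-> relsT 1 q n x.
Proof.
split; move=> [h1 [h2 [h3 [h4 [h5 [h6 h7]]]]]]; rewrite /relsT /relsX /=.
  split; [exact: h1|split; [exact: h2|split; [|split; [|split; [|split]]]]] => *;
  rewrite scale1r; by [apply: h3|apply: h4|apply: h5|apply: h6|apply: h7].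
split; [exact: h1|split; [exact: h2|split; [|split; [|split; [|split]]]]] => *;
by [rewrite -h3 ?scale1r|rewrite -h4 ?scale1r|rewrite -h5 ?scale1r
   |rewrite -h6 ?scale1r|rewrite -h7 ?scale1r].
Qed.

(** * From cross relations to the presentation *)

Section RowsRel.
Variables (k : fieldType) (q : k) (A : algType k) (n : nat).
Hypotheses (q0 : q != 0) (qq : q + q^-1 != 0) (hn : (3 <= n)%N).
Variables (e x y : nat -> A).
Hypotheses (Hx : rowrule q n (dsign n) e x) (Hy : rowrule q n (dsign n) e y).
Hypotheses (bx : x 2 * x 1 = q^-1 *: (x 1 * x 2)).
Hypotheses (by_ : y 2 * y 1 = q^-1 *: (y 1 * y 2)).
Hypothesis base : forall t, (1 <= t <= n.*2)%N -> q *: (y 1 * x t) = cross q n x y 1 t.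
Local Notation tsum := (tsum q n x y).
Local Notation pr := (pr n).

Lemma tsum_lo s : (1 <= s <= n)%N ->
  tsum s.-1 = \sum_(1 <= l < s) q ^ (s%:Z - l%:Z) *: (x (pr l) * y l).
Proof.
elim: s => // -[|s] IHs hs; first by rewrite big_geq.
have {}IHs : tsum s = \sum_(1 <= l < s.+1) q ^ (s.+1%:Z - l%:Z) *: (x (pr l) * y l).
  by apply: IHs; lia.
rewrite -[tsum _]/(q *: (tsum s + vterm n x y s.+1)) IHs [in RHS]big_nat_recr //= scalerDr scaler_sumr /vterm (_ : (s.+1 < n)%N); last by lia.
congr (_ + _).
  apply: eq_bigr => l _; rewrite scalerA -{1}[q]expr1z -expfzDr //.
  by congr (_ ^ _ *: _); lia.
by rewrite -[in LHS](expr1z q); congr (_ ^ _ *: _); lia.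
Qed.

(** The two sums in the last family of relations, without the common factor [qhat q]. By [G_top] and
    [G_step] they obey the recursion of [tsum] above the middle height. *)
Let G s := \sum_(s.+1 <= l < n.+1) q ^ (l%:Z - s%:Z) *: (x l * y (pr l)) +
  q^-1 *: \sum_(1 <= l < n.+1) q ^ ((pr l)%:Z - s%:Z) *: (x (pr l) * y l).

Lemma G_top : G n = tsum n.-1 + x (pr n) * y n.
Proof.
rewrite /G big_geq // add0r tsum_lo; last by lia.
rewrite scaler_sumr big_nat_recr /=; last by lia.
congr (_ + _); last first.
  rewrite scalerA -{1}[q^-1]expr1z exprz_inv -expfzDr //.
  have -> : (- 1 + ((pr n)%:Z - n%:Z) = 0)%R by rewrite /pr; lia.
  by rewrite expr0z scale1r.
apply: eq_big_nat => l hl; rewrite scalerA -{1}[q^-1]expr1z exprz_inv -expfzDr //.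
by congr (_ ^ _ *: _); rewrite /pr; lia.
Qed.

Lemma G_step s : (1 <= s < n)%N -> G s = q *: (G s.+1 + x s.+1 * y (pr s.+1)).
Proof.
move=> hs; rewrite /G big_ltn; last by lia.
have -> : (s.+1%:Z - s%:Z = 1)%R by lia.
rewrite expr1z !scalerDr [RHS]addrC addrA; congr (_ + _ + _).
  rewrite scaler_sumr; apply: eq_bigr => l _; rewrite scalerA.
  by rewrite -{2}[q]expr1z -expfzDr //; congr (_ ^ _ *: _); lia.
rewrite scalerA mulrC -scalerA; congr (_ *: _).
rewrite scaler_sumr; apply: eq_bigr => l _; rewrite scalerA.
by rewrite -{2}[q]expr1z -expfzDr //; congr (_ ^ _ *: _); lia.
Qed.

Lemma tsum_hi j s : (s + j.+1 = n)%N -> (1 <= s)%N -> tsum (pr s - 1).-1 = G s.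
Proof.
elim: j s => [|j IHj] s hs h1; rewrite G_step; try by lia.
  have -> : s.+1 = n by lia.
  have -> : (pr s - 1).-1 = n.-1.+1 by rewrite /pr; lia.
  rewrite G_top [LHS]/= /vterm prednK ?ltnn ?eqxx; last by lia.
  by rewrite addrA.
have -> : (pr s - 1).-1 = ((pr s.+1) - 1).-1.+1 by rewrite /pr; lia.
rewrite [LHS]/= IHj; try by lia.
congr (_ *: (_ + _)); rewrite /vterm.
have -> : ((pr s.+1 - 1).-1.+1 < n)%N = false by rewrite /pr; lia.
have /negPf-> : (pr s.+1 - 1).-1.+1 != n by rewrite /pr; lia.
by congr (x _ * y _); rewrite /pr; lia.
Qed.

Lemma rows_relsT : relsT q q n (fun p => if p.1 == 1%N then x p.2 else y p.2).
Proof.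
have rP r : (1 <= r <= 2)%N -> r = 1%N \/ r = 2%N by lia.
have C := cross_rel q0 qq hn Hx Hy base.
split; [|split; [|split; [|split; [|split; [|split]]]]] => /=.
- move=> r s t /rP [->|->] hs ht hst htp /=.
    by apply: (commute_row q0 qq hn Hx bx); rewrite // hst; lia.
  by apply: (commute_row q0 qq hn Hy by_); rewrite // hst; lia.
- move=> r s /rP [->|->] hs hsp /=.
    by apply: (commute_prime q0 qq hn Hx bx); move: hsp; rewrite /pr; lia.
  by apply: (commute_prime q0 qq hn Hy by_); move: hsp; rewrite /pr; lia.
- by move=> s hs; rewrite C // cross_eq.
- by move=> s t hs ht hst htp; rewrite C // cross_lt.
- move=> s t hs ht hst htp; rewrite C // cross_gt //.
  by move: htp; rewrite /pr; lia.
- move=> s hs hsp; have hsn : (1 <= s <= n)%N by move: hsp; rewrite /pr; lia.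
  rewrite C //; last by rewrite /pr; lia.
  rewrite cross_pr_lo //; last by lia.
  have -> : (n < s)%N = false by lia.
  by rewrite subn0 tsum_lo.
move=> s hs hsp; have hsn : (1 <= s <= n)%N by move: hsp; rewrite /pr; lia.
have pps : pr (pr s) = s by rewrite /pr; lia.
rewrite C //; last by rewrite /pr; lia.
rewrite -[X in cross _ _ _ _ _ X]pps -(scalerA (qhat q)) -[X in X - _]addrA -scalerDr -/(G s).
(* For s = n the second sum contains x_{n'} y_n, which cancels the subtracted term; this matches the
   absence of a correction term in [cross] at n+1. *)
have [sn|sn] : s = n \/ (s < n)%N by lia.
  rewrite cross_pr_lo //; last by rewrite /pr; lia.
  rewrite pps sn G_top.
  have -> : (n < pr n)%N by rewrite /pr; lia.
  have -> : (pr n - true).-1 = n.-1 by rewrite /pr; lia.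
  by ncfield.
rewrite cross_pr_hi //; last by rewrite /pr; lia.
by rewrite pps (tsum_hi (j := (n - s).-1)) //; lia.
Qed.

End RowsRel.

(** * The root lattice *)

Section Lattice.
Variables (n : nat) (hn : (3 <= n)%N).
Local Notation lat := (lat n).
Local Notation ip := (@ip n).
Local Notation alpha := (alpha n).
Local Notation ec := (ecoord n).
Local Notation refl := (@refl n).

Lemma ipDl a b c : ip (a + b) c = ip a c + ip b c.
Proof. by rewrite /ip -big_split; apply: eq_bigr => j _; rewrite mxE mulrDl. Qed.

Lemma ipC a b : ip a b = ip b a.
Proof. by apply: eq_bigr => j _; rewrite mulrC. Qed.

Lemma ipNl a c : ip (- a) c = - ip a c.
Proof. by rewrite /ip -sumrN; apply: eq_bigr => j _; rewrite mxE mulNr. Qed.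

Lemma ip0l c : ip 0 c = 0.
Proof. by rewrite /ip big1 // => j _; rewrite mxE mul0r. Qed.

Lemma ipMzl a m c : ip (a *~ m) c = ip a c * m.
Proof.
have H (j : nat) : ip (a *+ j) c = ip a c *+ j.
  by elim: j => [|j IHj]; rewrite ?ip0l // !mulrS ipDl IHj.
case: m => j; first by rewrite -pmulrn H pmulrn mulrzz.
by rewrite NegzE mulrNz -pmulrn ipNl H mulrN pmulrn mulrzz.
Qed.

Lemma ipDr a b c : ip a (b + c) = ip a b + ip a c.
Proof. by rewrite !(ipC a) ipDl. Qed.

Lemma ipNr a c : ip a (- c) = - ip a c.
Proof. by rewrite !(ipC a) ipNl. Qed.

Lemma ipMzr a m c : ip c (a *~ m) = ip c a * m.
Proof. by rewrite !(ipC c) ipMzl. Qed.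

Lemma ip_ec a b : (1 <= a <= n.+1)%N -> (1 <= b <= n.+1)%N ->
  ip (ec a) (ec b) = if a == b then 1 else 0.
Proof.
move=> ha hb; rewrite /ip (bigD1 (inord a.-1)) /=; last first.
  by rewrite -val_eqE /= inordK; lia.
rewrite big1 => [|j /andP[_ /negPf hj]]; last by rewrite !mxE hj andbF mul0r.
rewrite addr0 !mxE !eqxx mul1r; case: (a =P b) => [->|ab]; first by rewrite eqxx.
rewrite /=; case: eqP => // h; case: ab.
by move/(congr1 val): h; rewrite /= !inordK; lia.
Qed.

Lemma ip_delta a : ip a (deltaL n) = 0.
Proof.
by rewrite /ip big1 // => j /negPf hj; rewrite mxE hj andbF mulr0.
Qed.

Lemma ip_deltal a : ip (deltaL n) a = 0. Proof. by rewrite ipC ip_delta. Qed.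

Definition ipE := (ipDl, ipNl, ipDr, ipNr, ip_delta, ip_deltal).

Lemma alpha0 : alpha 0 = - ec n.+1 - ec n + deltaL n. Proof. by []. Qed.
Lemma alpha1 : alpha 1 = ec 1 + ec 2. Proof. by []. Qed.
Lemma alphaS i : (2 <= i)%N -> alpha i = ec i - ec i.-1.
Proof. by case: i => [|[|]]. Qed.

(** This identifies [adj] with the Dynkin diagram of type D_{n+1}^{(1)}: a chain 2, ..., n+1, with 1
    attached to 3 and 0 attached to n. *)
Lemma cartan i j : (i <= n.+1)%N -> (j <= n.+1)%N ->
  ip (alpha i) (alpha j) = if i == j then 2 else if adj n i j then -1 else 0.
Proof.
have P m : (m <= n.+1)%N -> [\/ m = 0%N, m = 1%N | (2 <= m)%N].
  case: m => [|[|m]] _; [exact: Or31|exact: Or32|exact: Or33].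
move=> hi hj; case: (P i hi) => hi'; case: (P j hj) => hj'; rewrite ?hi' ?hj' ?alpha0 ?alpha1
  ?alphaS // ?ipE ?ip_ec /adj; try by lia.
all: repeat (case: ifP => ?; try (exfalso; lia)).
all: by [lia|].
Qed.

Lemma reflD i a b : refl i (a + b) = refl i a + refl i b.
Proof. by rewrite /refl ipDl mulrzDr opprD addrACA. Qed.

Lemma refl_alpha i j : (i <= n.+1)%N -> (j <= n.+1)%N ->
  refl i (alpha j) = alpha j - alpha i *~ (if i == j then 2 else if adj n i j then -1 else 0).
Proof. by move=> hi hj; rewrite /refl (ipC (alpha j)) cartan. Qed.

Lemma adj_irr i : adj n i i = false.
Proof. by rewrite /adj; lia. Qed.

Lemma adj_neq i j : adj n i j -> (i == j) = false.
Proof. by apply: contraTF => /eqP->; rewrite adj_irr. Qed.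

Lemma lat_sys : braid_sys n (@Algebra.add lat) alpha (fun i => refl i).
Proof.
split=> i.
- by move=> a b _; exact: reflD.
- by move=> j hi hj /negPf hij /negPf hadj; rewrite refl_alpha // hij hadj mulr0z subr0.
- by move=> j hi hj hadj; rewrite refl_alpha // adj_neq // hadj mulrN1z opprK addrC.
move=> j hi hj hadj; rewrite (refl_alpha hj hi) eq_sym adj_sym // adj_neq // hadj mulrN1z opprK.
rewrite reflD !refl_alpha // eqxx adj_neq // hadj mulrN1z opprK.
by rewrite -[_ *~ 2]/(alpha i + alpha i) opprD [alpha i + (- _ - _)]addrA subrr add0r addrC addrK.
Qed.

Lemma lat_sys5 : refl 2 (refl 1 (refl 3 (alpha 2))) = refl 1 (alpha 3).
Proof.
have h1 : (1 <= n.+1)%N by []. have h2 : (2 <= n.+1)%N by lia.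
have h3 : (3 <= n.+1)%N by lia.
have a32 : adj n 3 2 by rewrite /adj; lia.
have a12 : adj n 1 2 = false by rewrite /adj; lia.
have a21 : adj n 2 1 = false by rewrite /adj; lia.
have a13 : adj n 1 3 by rewrite /adj; lia.
have a23 : adj n 2 3 by rewrite /adj; lia.
have e1 : refl 3 (alpha 2) = alpha 2 + alpha 3.
  by rewrite (refl_alpha h3 h2) a32 /= mulrN1z opprK.
have e2 : refl 1 (alpha 2) = alpha 2 by rewrite (refl_alpha h1 h2) a12 /= mulr0z subr0.
have e3 : refl 1 (alpha 3) = alpha 3 + alpha 1.
  by rewrite (refl_alpha h1 h3) a13 /= mulrN1z opprK.
have e4 : refl 2 (alpha 2) = - alpha 2.
  by rewrite (refl_alpha h2 h2) /= -[_ *~ 2]/(alpha 2 + alpha 2) opprD addrA subrr add0r.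
have e5 : refl 2 (alpha 3) = alpha 3 + alpha 2.
  by rewrite (refl_alpha h2 h3) a23 /= mulrN1z opprK.
have e6 : refl 2 (alpha 1) = alpha 1 by rewrite (refl_alpha h2 h1) a21 /= mulr0z subr0.
by rewrite e1 (reflD 1) e2 e3 (reflD 2 (alpha 2)) (reflD 2 (alpha 3)) e4 e5 e6 addrA [alpha 3 + _]addrC addrA addNr add0r.
Qed.

Lemma refl_ip i a b : (i <= n.+1)%N -> ip (refl i a) (refl i b) = ip a b.
Proof.
move=> hi; rewrite /refl !ipE !ipMzl !ipMzr cartan // eqxx (ipC (alpha i) b); ring.
Qed.

Lemma rootdegE l : rootdeg n l = rootv n alpha (fun i => refl i) l.
Proof. by rewrite /rootdeg TwordE. Qed.

Definition ev (t : nat) : lat := if (t <= n)%N then - ec (n.+1 - t) else ec (t - n).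

Lemma row_lat x t : (1 <= t <= n.*2)%N ->
  row +%R n alpha x t = x + ec n + ev t.
Proof.
move=> ht.
have HX j : (j < n)%N -> rowX +%R n alpha x j = x + ec n - ec (n - j).
  elim: j => [|j IHj] hj; first by rewrite subn0 addrK.
  rewrite [LHS]/= IHj ?alphaS; try by lia.
  by rewrite addrA subrK; congr (_ - ec _); lia.
have HY j : (j < n)%N -> rowY +%R n alpha x j = x + ec n + ec j.+1.
  elim: j => [|j IHj] hj.
    rewrite [LHS]/= HX ?alpha1; last by lia.
    have -> : (n - (n - 2) = 2)%N by lia.
    by rewrite [ec 1 + _]addrC addrA subrK.
  rewrite [LHS]/= IHj ?alphaS //; last by lia.
  by rewrite -[_ + _ + (_ - _)]addrA [ec j.+1 + _]addrC subrK.
rewrite /row /ev; case: ifP => h; first by rewrite HX; [congr (_ - ec _)|]; lia.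
by rewrite HY; [congr (_ + ec _)|]; lia.
Qed.

Lemma inQP (mu : lat) :
  inQ mu = (2 %| \sum_(j < n.+2 | j != ord_max) mu 0 j)%Z.
Proof. by rewrite /inQ dvdzE -[`|2|%N]/2%N dvdn2. Qed.

Lemma inQD (a b : lat) : inQ a -> inQ b -> inQ (a + b).
Proof.
rewrite !inQP => ha hb.
rewrite (eq_bigr (fun j => a 0 j + b 0 j)) => [|j _]; last by rewrite mxE.
by rewrite big_split; apply: rpredD.
Qed.

Lemma inQN (a : lat) : inQ a -> inQ (- a).
Proof.
rewrite !inQP => ha.
rewrite (eq_bigr (fun j => - a 0 j)) => [|j _]; last by rewrite mxE.
by rewrite sumrN rpredN.
Qed.

Lemma sum_ec a : (1 <= a <= n.+1)%N ->
  \sum_(j < n.+2 | j != ord_max) (ec a) 0 j = 1.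
Proof.
move=> ha; rewrite (bigD1 (inord a.-1)) /=; last first.
  by rewrite -val_eqE /= inordK; lia.
rewrite big1 => [|j /andP[_ /negPf hj]]; last by rewrite !mxE hj andbF.
by rewrite addr0 mxE !eqxx.
Qed.

Lemma inQ_alpha i : (i <= n.+1)%N -> inQ (alpha i).
Proof.
move=> hi.
have D a b : (1 <= a <= n.+1)%N -> (1 <= b <= n.+1)%N -> inQ (ec a + ec b).
  move=> ha hb; rewrite inQP (eq_bigr (fun j => ec a 0 j + ec b 0 j)) => [|j _].
    by rewrite big_split /= !sum_ec.
  by rewrite mxE.
have Q2 a : (1 <= a <= n.+1)%N -> inQ (ec a + ec a) by move=> ha; apply: D.
have [->|[->|h]] : i = 0%N \/ i = 1%N \/ (2 <= i)%N by lia.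
- rewrite alpha0; apply: inQD; first by rewrite -opprD; apply/inQN/D; lia.
  by rewrite inQP big1 // => j /negPf hj; rewrite mxE hj andbF.
- by apply: D; lia.
rewrite alphaS // (_ : _ - _ = ec i + ec i.-1 - (ec i.-1 + ec i.-1)).
  by apply: inQD; [|apply: inQN]; apply: D; lia.
by rewrite opprD addrA addrK.
Qed.

Lemma row_deg1 t : (1 <= t <= n.*2)%N -> rootdeg n t = ec n.+1 + ev t.
Proof.
move=> ht; rewrite rootdegE (rootv1 hn lat_sys) // row_lat // alphaS; last by lia.
by rewrite /= subrK.
Qed.

Lemma xbarE (S : Type) (br : S -> S -> S) (e : nat -> S) : xbar br n e =
  br (row br n e (e n.+1) n.*2.-1) (br (row br n e (e n.+1) 2) (e 0%N)).
Proof.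
rewrite /xbar /row.
have -> : (n.*2.-1 <= n)%N = false by lia.
have -> : (2 <= n)%N by lia.
by congr (br (rowY _ _ _ _ _) _); lia.
Qed.

Lemma ev_first : ev 1 = - ec n.
Proof. by rewrite /ev (_ : (1 <= n)%N) ?subn1 //; lia. Qed.

Lemma row_deg2 t : (1 <= t <= n.*2)%N ->
  rootdeg n (n.*2 + t) = ec n.+1 + ev t + deltaL n.
Proof.
move=> ht; rewrite rootdegE (rootv2 hn lat_sys lat_sys5) // row_lat // xbarE.
rewrite !row_lat; try by lia.
have -> : ev n.*2.-1 = ec n.-1.
  by rewrite /ev; have -> : (n.*2.-1 <= n)%N = false; [|congr ecoord]; lia.
have -> : ev 2 = - ec n.-1.
  by rewrite /ev; have -> : (2 <= n)%N; [|congr (- ecoord _ _)]; lia.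
rewrite alphaS; last by lia.
rewrite /= alpha0 subrK.
set a := ec n.+1; set b := ec n; set c := ec n.-1; set d := deltaL n; set v := ev t.
by apply/rowP => j; rewrite !mxE; ring.
Qed.

Lemma coefD (a b : lat) : coef_alpha0 (a + b) = coef_alpha0 a + coef_alpha0 b /\
  coef_alphaLast (a + b) = coef_alphaLast a + coef_alphaLast b.
Proof. by rewrite /coef_alpha0 /coef_alphaLast !mxE addrACA. Qed.

Lemma coef_ec a : (1 <= a <= n.+1)%N -> coef_alpha0 (ec a) = 0 /\
  coef_alphaLast (ec a) = if a == n.+1 then 1 else 0.
Proof.
move=> ha; rewrite /coef_alpha0 /coef_alphaLast !mxE eqxx /=.
have -> : (ord_max == inord a.-1 :> 'I_n.+2) = false.
  by apply/eqP => /(congr1 val); rewrite /= inordK; lia.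
split; rewrite // addr0.
have -> : (inord n == inord a.-1 :> 'I_n.+2) = (a == n.+1).
  by rewrite -val_eqE /= !inordK; lia.
by case: eqP.
Qed.

Lemma coef_ev t : (1 <= t <= n.*2)%N -> coef_alpha0 (ev t) = 0 /\ coef_alphaLast (ev t) = 0.
Proof.
move=> ht; rewrite /ev; case: ifP => h.
  have [] := @coef_ec (n.+1 - t); first by lia.
  rewrite /coef_alpha0 /coef_alphaLast !mxE => -> /[!addr0] ->.
  by have /negPf-> : (n.+1 - t != n.+1)%N by lia.
have [] := @coef_ec (t - n); first by lia.
by move=> -> ->; have /negPf-> : (t - n != n.+1)%N by lia.
Qed.

Lemma coef_delta : coef_alpha0 (deltaL n) = 1 /\ coef_alphaLast (deltaL n) = 1.
Proof.
rewrite /coef_alpha0 /coef_alphaLast !mxE !eqxx /=.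
have -> : (inord n == ord_max :> 'I_n.+2) = false.
  by apply/eqP => /(congr1 val); rewrite /= inordK; lia.
by [].
Qed.

(** Hence beta of two letters is 1 if the first lies in the first row, and otherwise q or q^2
    according as the second letter lies in the first or the second row. Products inside a row are
    rescaled uniformly, and only X_2 X_1 changes relative to X_1 X_2. *)
Lemma coef_rootdeg l : (1 <= l <= n * 4)%N ->
  coef_alpha0 (rootdeg n l) = (nat_of_bool (n.*2 < l)%N)%:Z /\
  coef_alphaLast (rootdeg n l) = 1 + (nat_of_bool (n.*2 < l)%N)%:Z.
Proof.
move=> hl; have hs : (1 <= n.+1 <= n.+1)%N by lia.
have [c0 cL] := coef_ec hs; have [d0 dL] := coef_delta.
have [h|h] : (l <= n.*2)%N \/ (n.*2 < l)%N by lia.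
  have hl' : (1 <= l <= n.*2)%N by lia.
  have [e0 eL] := coef_ev hl'.
  rewrite row_deg1 // (coefD _ _).1 (coefD _ _).2 c0 cL e0 eL eqxx.
  by have -> : (n.*2 < l)%N = false by lia.
have [l' lE] : exists t, l = (n.*2 + t)%N by exists (l - n.*2)%N; lia.
have hl' : (1 <= l' <= n.*2)%N by lia.
have [e0 eL] := coef_ev hl'.
rewrite h lE row_deg2 //.
rewrite (coefD _ _).1 (coefD (_ + _) _).2 (coefD _ _).1 (coefD _ _).2 c0 cL e0 eL d0 dL eqxx.
by rewrite !addr0 !add0r.
Qed.

Lemma ip_ev s t : (1 <= s <= n.*2)%N -> (1 <= t <= n.*2)%N ->
  ip (ev s) (ev t) = if s == t then 1 else if s == pr n t then -1 else 0.
Proof.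
move=> hs ht; rewrite /ev /pr.
case: ifP => h; case: ifP => h'; rewrite ?ipE ip_ec; try by lia.
all: repeat (case: ifP => ?; try (exfalso; lia)); by lia.
Qed.

Lemma ip_ev_last t : (1 <= t <= n.*2)%N -> ip (ev t) (ec n.+1) = 0.
Proof.
move=> ht; rewrite /ev; case: ifP => h; rewrite ?ipE ip_ec; try by lia.
all: by case: ifP => ?; lia.
Qed.

Lemma ev_X i : (1 <= i <= n)%N -> ev (n.+1 - i) = - ec i.
Proof.
by move=> hi; rewrite /ev (_ : (n.+1 - i <= n)%N); [congr (- ec _)|]; lia.
Qed.

Lemma ev_Y i : (1 <= i)%N -> ev (n + i) = ec i.
Proof.
move=> hi; rewrite /ev (_ : (n + i <= n)%N = false); [congr (ec _)|]; lia.
Qed.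

End Lattice.

(** * Root vectors of the quantum affine algebra *)

Section RankTwo.
Variables (k : fieldType) (q : k) (A : algType k).
Hypotheses (q0 : q != 0) (q2 : q * q - 1 != 0).
Variables (a b f K Km : A).
Hypothesis KmK : Km * K = 1.
Hypothesis Kb : K * b = q^-1 *: (b * K).
Hypothesis Kmb : Km * b = q *: (b * Km).
Hypothesis af : a * f - f * a = (qhat q)^-1 *: (K - Km).
Local Notation qc := (@qcomm k q A).

Lemma sub0 (u v : A) : u = v -> u - v = 0. Proof. by move=> ->; rewrite subrr. Qed.

(** This is T_i T_j E_i = E_j for adjacent nodes, with a = E_i, b = E_j, f = F_i: T_i turns
    [E_j, E_i] into [[E_i, E_j], -F_i K_i]. *)
Lemma rank2_E (Ka : K * a = q ^+ 2 *: (a * K)) (bf : b * f = f * b) :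
  qc (qc a b) (- (f * K)) = b.
Proof.
have D1 := sub0 Ka; have D2 := sub0 Kb; have D3 := sub0 Kmb.
have D4 := sub0 af; have D5 := sub0 bf.
have s1 : K * qc a b = q *: (qc a b * K).
  apply: subr0_eq; transitivity ((K * a - q ^+ 2 *: (a * K)) * b +
    q ^+ 2 *: (a * (K * b - q^-1 *: (b * K))) - q^-1 *: ((K * b - q^-1 *: (b * K)) * a
    + q^-1 *: (b * (K * a - q ^+ 2 *: (a * K))))); first by rewrite /qcomm; ncfield.
  by rewrite D1 D2 !(mulr0, mul0r, scaler0, addr0, subr0).
have s2 : f * qc a b - qc a b * f = b * Km.
  apply: subr0_eq; transitivity (- ((a * f - f * a - (qhat q)^-1 *: (K - Km)) * b)
    - a * (b * f - f * b) + q^-1 *: ((b * f - f * b) * a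
    + b * (a * f - f * a - (qhat q)^-1 *: (K - Km)))
    - (qhat q)^-1 *: (K * b - q^-1 *: (b * K)) + (qhat q)^-1 *: (Km * b - q *: (b * Km))).
    by rewrite /qcomm /qhat; ncfield.
  by rewrite D2 D3 D4 D5 !(mulr0, mul0r, scaler0, addr0, subr0, oppr0).
rewrite {1}/qcomm mulrN mulNr -mulrA s1 scalerN -scalerAr scalerA mulVf // scale1r opprK.
by rewrite !mulrA addrC -mulrBl s2 -mulrA KmK mulr1.
Qed.

End RankTwo.

Section RankTwoF.
Variables (k : fieldType) (q : k) (A : algType k).
Hypotheses (q0 : q != 0) (q2 : q * q - 1 != 0).
Variables (a b f K Km : A).
Definition qcommF (u v : A) : A := v * u - q *: (u * v).

Lemma rank2F (KmK : Km * K = 1) (Kmf : Km * f = q ^+ 2 *: (f * Km))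
  (Kmb : Km * b = q^-1 *: (b * Km)) (Kb : K * b = q *: (b * K))
  (af : a * f - f * a = (qhat q)^-1 *: (K - Km)) (ab : a * b = b * a) :
  qcommF (qcommF f b) (- (Km * a)) = b.
Proof.
have D1 := sub0 Kmf; have D2 := sub0 Kmb; have D3 := sub0 Kb.
have D4 := sub0 af; have D5 := sub0 ab.
set c := qcommF f b.
have s1 : Km * c = q *: (c * Km).
  apply: subr0_eq; transitivity ((Km * b - q^-1 *: (b * Km)) * f
    + q^-1 *: (b * (Km * f - q ^+ 2 *: (f * Km)))
    - q *: ((Km * f - q ^+ 2 *: (f * Km)) * b + q ^+ 2 *: (f * (Km * b - q^-1 *: (b * Km))))).
    by rewrite /c /qcommF; ncfield.
  by rewrite D1 D2 !(mulr0, mul0r, scaler0, addr0, subr0).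
have s2 : c * a - a * c = q *: (b * K).
  apply: subr0_eq; transitivity (- (b * (a * f - f * a - (qhat q)^-1 *: (K - Km)))
    - (a * b - b * a) * f
    + q *: ((a * f - f * a - (qhat q)^-1 *: (K - Km)) * b + f * (a * b - b * a))
    + (q * (qhat q)^-1) *: (K * b - q *: (b * K) - (Km * b - q^-1 *: (b * Km)))).
    by rewrite /c /qcommF /qhat; ncfield.
  by rewrite D2 D3 D4 D5 !(mulr0, mul0r, scaler0, addr0, subr0, oppr0).
rewrite {1}/qcommF mulrN mulNr scalerN opprK mulrA scalerAl -s1 addrC -!mulrA -mulrBr.
by rewrite s2 -scalerAr mulrA Kmb -scalerAl scalerA mulfV // scale1r -mulrA KmK mulr1.
Qed.

End RankTwoF.

Section Lowering.
Variables (k : fieldType) (q : k) (A : algType k).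
Hypotheses (q0 : q != 0) (q2 : q * q - 1 != 0).
Local Notation qc := (@qcomm k q A).

(** Commuting with F_i undoes the last bracket with E_i, up to a factor K_i. *)
Lemma lower_same (z a f K Km : A) : z * f = f * z ->
  a * f - f * a = (qhat q)^-1 *: (K - Km) ->
  K * z = q^-1 *: (z * K) -> Km * z = q *: (z * Km) ->
  qc z a * f = f * qc z a + q^-1 *: (z * K).
Proof.
move=> /sub0 D1 /sub0 D2 /sub0 D3 /sub0 D4; apply: subr0_eq.
transitivity (z * (a * f - f * a - (qhat q)^-1 *: (K - Km)) + (z * f - f * z) * a
  - q^-1 *: ((a * f - f * a - (qhat q)^-1 *: (K - Km)) * z + a * (z * f - f * z))
  - (q^-1 * (qhat q)^-1) *: (K * z - q^-1 *: (z * K) - (Km * z - q *: (z * Km)))).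
  by rewrite /qcomm /qhat; ncfield.
by rewrite D1 D2 D3 D4 !(mulr0, mul0r, scaler0, addr0, subr0).
Qed.

Lemma lower_next (z y a f K : A) : z * f = f * z + q^-1 *: (y * K) ->
  a * f = f * a -> K * a = q^-1 *: (a * K) -> y * a = a * y ->
  qc z a * f = f * qc z a.
Proof.
move=> /sub0 D1 /sub0 D2 /sub0 D3 /sub0 D4; apply: subr0_eq.
transitivity (z * (a * f - f * a) + (z * f - (f * z + q^-1 *: (y * K))) * a
  - q^-1 *: ((a * f - f * a) * z + a * (z * f - (f * z + q^-1 *: (y * K))))
  + q^-1 *: (y * (K * a - q^-1 *: (a * K))) + (q^-1 * q^-1) *: ((y * a - a * y) * K)).
  by rewrite /qcomm; ncfield.
by rewrite D1 D2 D3 D4 !(mulr0, mul0r, scaler0, addr0, subr0).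
Qed.

(** Commute f past both sides of wz = c zw. Since w passes f and z leaves yK, the difference is a
    relation between w and yK; moving K past w costs d, and Km cancels it. *)
Lemma lower_cross (w z y f K Km : A) c d : K * Km = 1 ->
  z * f = f * z + q^-1 *: (y * K) -> w * f = f * w -> K * w = d *: (w * K) ->
  w * z = c *: (z * w) -> w * y = (c * d) *: (y * w).
Proof.
move=> KKm /sub0 D1 /sub0 D2 /sub0 D3 /sub0 D4; apply: subr0_eq.
transitivity (q *: ((w * z - c *: (z * w)) * f * Km
  - f * (w * z - c *: (z * w)) * Km
  - w * (z * f - (f * z + q^-1 *: (y * K))) * Km - (w * f - f * w) * z * Km
  + c *: (z * (w * f - f * w) * Km)
  + c *: ((z * f - (f * z + q^-1 *: (y * K))) * w * Km))
  + c *: (y * (K * w - d *: (w * K)) * Km)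
  - w * y * (K * Km - 1) + (c * d) *: (y * w * (K * Km - 1))).
  by ncfield.
by rewrite D1 D2 D3 D4 KKm subrr !(mulr0, mul0r, scaler0, addr0, subr0).
Qed.
End Lowering.

Section AlgHom.
Variables (k : fieldType) (A B : algType k) (f : A -> B).

Lemma homD x y : alg_hom f -> f (x + y) = f x + f y.
Proof. by case=> [h _]; apply: h. Qed.

Lemma homZ a x : alg_hom f -> f (a *: x) = a *: f x.
Proof. by case=> [_ [h _]]; apply: h. Qed.

Lemma homM x y : alg_hom f -> f (x * y) = f x * f y.
Proof. by case=> [_ [_ [h _]]]; apply: h. Qed.

Lemma hom1 : alg_hom f -> f 1 = 1.
Proof. by case=> [_ [_ [_ h]]]. Qed.

Lemma homN x : alg_hom f -> f (- x) = - f x.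
Proof. by move=> h; rewrite -scaleN1r (homZ _ _ h) scaleN1r. Qed.

Lemma hom0 : alg_hom f -> f 0 = 0.
Proof. by move=> h; rewrite -(scale0r (0 : A)) (homZ _ _ h) scale0r. Qed.
End AlgHom.

(** * The two rows of root vectors in the quantum affine algebra *)

Section UQ.
Variables (k : fieldType) (q : k) (n : nat) (U : algType k) (g : Ugen n -> U)
  (T : nat -> U -> U).
Hypotheses (q0 : q != 0) (q2 : q * q - 1 != 0) (qq : q + q^-1 != 0) (hn : (3 <= n)%N).
Hypotheses (HR : relsU q g) (HT : lusztig q g T).
Let E i := g (UE n i).
Let F i := g (UF n i).
Let K mu := g (UK mu).
Local Notation ip := (@ip n).
Local Notation alpha := (alpha n).
Local Notation qc := (@qcomm k q U).

Lemma K_zero : K 0 = 1. Proof. by case: HR. Qed.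

Lemma K_add mu la : inQ mu -> inQ la -> K mu * K la = K (mu + la).
Proof. by case: HR => _ [h _]; apply: h. Qed.

Lemma K_E mu i : inQ mu -> (i <= n.+1)%N ->
  K mu * E i = q ^ (ip mu (alpha i)) *: (E i * K mu).
Proof. by case: HR => _ [_ [h _]]; apply: h. Qed.

Lemma K_F mu i : inQ mu -> (i <= n.+1)%N ->
  K mu * F i = q ^ (- ip mu (alpha i)) *: (F i * K mu).
Proof. by case: HR => _ [_ [_ [h _]]]; apply: h. Qed.

Lemma EF_far i j : (i <= n.+1)%N -> (j <= n.+1)%N -> ~~ adj n i j ->
  E i * E j = E j * E i /\ F i * F j = F j * F i.
Proof.
move=> hi hj hij; case: HR => _ [_ [_ [_ [h _]]]]; apply: h => //.
by rewrite cartan // (negPf hij); case: (i == j).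
Qed.

Lemma EF_serre i j : (i <= n.+1)%N -> (j <= n.+1)%N -> adj n i j -> serre q (E i) (E j).
Proof.
move=> hi hj hij; case: HR => _ [_ [_ [_ [_ [h _]]]]]; apply: (h i j hi hj _).1.
by rewrite cartan // (adj_neq hn hij) hij.
Qed.

Lemma EF_comm i j : (i <= n.+1)%N -> (j <= n.+1)%N ->
  E i * F j - F j * E i =
  if i == j then (qhat q)^-1 *: (K (alpha i) - K (- alpha i)) else 0.
Proof. by move=> hi hj; case: HR => _ [_ [_ [_ [_ [_ h]]]]]; apply: h. Qed.

Lemma EF_neq i j : (i <= n.+1)%N -> (j <= n.+1)%N -> i != j -> E i * F j = F j * E i.
Proof.
by move=> hi hj /negPf hij; apply: subr0_eq; rewrite EF_comm // hij.
Qed.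

Lemma T_hom i : (i <= n.+1)%N -> alg_hom (T i).
Proof. by move=> hi; case: (HT hi). Qed.

Lemma hom_qcomm (A B : algType k) (f : A -> B) x y : alg_hom f ->
  f (qcomm q x y) = qcomm q (f x) (f y).
Proof. by move=> h; rewrite /qcomm (homD _ _ h) (homN _ h) (homZ _ _ h) !(homM _ _ h). Qed.

Lemma T_K i mu : (i <= n.+1)%N -> inQ mu -> T i (K mu) = K (refl i mu).
Proof. by move=> hi hmu; case: (HT hi) => _ [_ [h _]]; apply: h. Qed.

Lemma T_EF i : (i <= n.+1)%N ->
  T i (E i) = - (F i * K (alpha i)) /\ T i (F i) = - (K (- alpha i) * E i).
Proof. by move=> hi; case: (HT hi) => _ [_ [_ [h1 [h2 _]]]]. Qed.

Lemma T_far i j : (i <= n.+1)%N -> (j <= n.+1)%N -> i != j -> ~~ adj n i j ->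
  T i (E j) = E j /\ T i (F j) = F j.
Proof.
move=> hi hj hij /negPf hadj; case: (HT hi) => _ [_ [_ [_ [_ h]]]].
have ji : j != i by rewrite eq_sym.
by apply: (h j hj ji).1; rewrite cartan // hadj (negPf hij).
Qed.

Lemma T_adj i j : (i <= n.+1)%N -> (j <= n.+1)%N -> adj n i j ->
  T i (E j) = qc (E i) (E j) /\ T i (F j) = qcommF q (F i) (F j).
Proof.
move=> hi hj hadj; case: (HT hi) => _ [_ [_ [_ [_ h]]]].
have ji : j != i by rewrite eq_sym (adj_neq hn hadj).
apply: (h j hj ji).2.
by rewrite cartan // (adj_neq hn hadj) hadj.
Qed.

Lemma Kinv i : (i <= n.+1)%N -> K (- alpha i) * K (alpha i) = 1.
Proof.
by move=> hi; rewrite K_add ?addNr ?K_zero ?inQN ?inQ_alpha.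
Qed.

Lemma Kalpha i j : (i <= n.+1)%N -> (j <= n.+1)%N -> adj n i j ->
  [/\ K (alpha i) * E j = q^-1 *: (E j * K (alpha i)),
      K (- alpha i) * E j = q *: (E j * K (- alpha i)),
      K (alpha i) * F j = q *: (F j * K (alpha i)) &
      K (- alpha i) * F j = q^-1 *: (F j * K (- alpha i))].
Proof.
move=> hi hj hadj; have c : ip (alpha i) (alpha j) = -1.
  by rewrite cartan // (adj_neq hn hadj) hadj.
by split; rewrite ?K_E ?K_F ?inQN ?inQ_alpha // ?ipNl c ?opprK ?expr1z ?exprN1.
Qed.

Lemma Kalpha2 i : (i <= n.+1)%N ->
  K (alpha i) * E i = q ^+ 2 *: (E i * K (alpha i)) /\
  K (- alpha i) * F i = q ^+ 2 *: (F i * K (- alpha i)).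
Proof.
move=> hi; have c : ip (alpha i) (alpha i) = 2 by rewrite cartan // eqxx.
by rewrite K_E ?K_F ?inQN ?inQ_alpha // ipNl c opprK.
Qed.

Lemma E_sys : braid_sys n qc E T.
Proof.
split=> i.
- by move=> a b hi; apply/hom_qcomm/T_hom.
- by move=> j hi hj hij hadj; case: (T_far hi hj hij hadj).
- by move=> j hi hj hadj; case: (T_adj hi hj hadj).
move=> j hi hj hadj; have hadj' : adj n j i by rewrite adj_sym.
rewrite (T_adj hj hi hadj').1 (hom_qcomm _ _ (T_hom hi)).
rewrite (T_adj hi hj hadj).1 (T_EF hi).1.
have [h1 h2 _ _] := Kalpha hi hj hadj.
apply: (rank2_E q0 q2 (Kinv hi) h1 h2 _ (Kalpha2 hi).1 _).
  by rewrite EF_comm // eqxx.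
by rewrite EF_neq // eq_sym (adj_neq hn hadj).
Qed.

(** This system lets F_i be written as T_v F_{tau i}, from which [W_f] follows. *)
Lemma F_sys : braid_sys n (@qcommF k q U) F T.
Proof.
have H i a b : (i <= n.+1)%N -> T i (qcommF q a b) = qcommF q (T i a) (T i b).
  move=> /T_hom h; by rewrite /qcommF (homD _ _ h) (homN _ h) (homZ _ _ h) !(homM _ _ h).
split=> i.
- by move=> a b hi; apply: H.
- by move=> j hi hj hij hadj; case: (T_far hi hj hij hadj).
- by move=> j hi hj hadj; case: (T_adj hi hj hadj).
move=> j hi hj hadj; have hadj' : adj n j i by rewrite adj_sym.
rewrite (T_adj hj hi hadj').2 H // (T_adj hi hj hadj).2 (T_EF hi).2.
have [_ _ h3 h4] := Kalpha hi hj hadj.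
apply: (rank2F q0 q2 (Kinv hi) (Kalpha2 hi).2 h4 h3 _ _).
  by rewrite EF_comm // eqxx.
by rewrite EF_neq // (adj_neq hn hadj).
Qed.

Lemma adj12 : adj n 1 2 = false. Proof. by rewrite /adj; lia. Qed.
Lemma adj21 : adj n 2 1 = false. Proof. by rewrite /adj; lia. Qed.

Lemma refl12 : refl 1 (alpha 2) = alpha 2 /\ refl 1 (- alpha 2) = - alpha 2.
Proof.
have c : ip (alpha 2) (alpha 1) = 0 by rewrite cartan ?adj21 //; lia.
by rewrite /refl ipNl c oppr0 !addr0.
Qed.

Lemma sys5_E : T 2 (T 1 (T 3 (E 2))) = T 1 (E 3).
Proof.
have h1 : (1 <= n.+1)%N by []. have h2 : (2 <= n.+1)%N by lia.
have [t1 t2] : T 1 (E 2) = E 2 /\ T 1 (F 2) = F 2 by apply: T_far; rewrite ?adj12.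
apply: (sys_far5 hn E_sys).
  have ht := T_hom h1; rewrite (T_EF h2).1 (homN _ ht) (homM _ _ ht).
  by rewrite t2 T_K ?inQ_alpha // refl12.1.
have [/eqP + _] : E 1 * E 2 = E 2 * E 1 /\ F 1 * F 2 = F 2 * F 1.
  by apply: EF_far; rewrite ?adj12.
rewrite -subr_eq0 => /eqP C; apply: subr0_eq.
transitivity ((E 1 * E 2 - E 2 * E 1) * E 3
  - (q^-1 * q^-1) *: (E 3 * (E 1 * E 2 - E 2 * E 1))).
  by rewrite /qcomm; ncfield.
by rewrite C mul0r mulr0 scaler0 subr0.
Qed.

Lemma sys5_F : T 2 (T 1 (T 3 (F 2))) = T 1 (F 3).
Proof.
have h1 : (1 <= n.+1)%N by []. have h2 : (2 <= n.+1)%N by lia.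
have [t1 t2] : T 1 (E 2) = E 2 /\ T 1 (F 2) = F 2 by apply: T_far; rewrite ?adj12.
apply: (sys_far5 hn F_sys).
  have ht := T_hom h1; rewrite (T_EF h2).2 (homN _ ht) (homM _ _ ht).
  by rewrite t1 T_K ?inQN ?inQ_alpha // refl12.2.
have [_ /eqP +] : E 1 * E 2 = E 2 * E 1 /\ F 1 * F 2 = F 2 * F 1.
  by apply: EF_far; rewrite ?adj12.
rewrite -subr_eq0 => /eqP C; apply: subr0_eq.
transitivity ((q * q) *: ((F 1 * F 2 - F 2 * F 1) * F 3)
  - (F 3 * (F 1 * F 2 - F 2 * F 1))).
  by rewrite /qcommF; ncfield.
by rewrite C mul0r mulr0 scaler0 subr0.
Qed.

Lemma Tword_hom w : all (fun i => i <= n.+1)%N w -> alg_hom (Tword T w).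
Proof.
elim: w => [|i w IHw] /=; first by move=> _; split.
case/andP => /T_hom hi /IHw hw; split; [|split; [|split]].
- by move=> x y; rewrite (homD _ _ hw) (homD _ _ hi).
- by move=> a x; rewrite (homZ _ _ hw) (homZ _ _ hi).
- by move=> x y; rewrite (homM _ _ hw) (homM _ _ hi).
by rewrite (hom1 hw) (hom1 hi).
Qed.

Lemma all_word1 : all (fun i => i <= n.+1)%N (word1 n).
Proof.
rewrite all_cat; apply/andP; split; first by apply: all_dn => i; lia.
by apply: all_iota => i; lia.
Qed.

Lemma Tv_hom : alg_hom (Tv n T).
Proof. exact: Tword_hom all_word1. Qed.

Definition qweight (x : U) (d : lat n) : Prop :=
  forall mu, inQ mu -> K mu * x = q ^ (ip mu d) *: (x * K mu).

Lemma qweight_E i : (i <= n.+1)%N -> qweight (E i) (alpha i).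
Proof. by move=> hi mu hmu; apply: K_E. Qed.

Lemma qweight_qcomm x y d d' : qweight x d -> qweight y d' ->
  qweight (qc x y) (d + d').
Proof.
move=> hx hy mu hmu; rewrite ipDr expfzDr //.
set c := q ^ _; set c' := q ^ _.
have /eqP := hx mu hmu; rewrite -subr_eq0 => /eqP D1.
have /eqP := hy mu hmu; rewrite -subr_eq0 => /eqP D2.
apply: subr0_eq; transitivity ((K mu * x - c *: (x * K mu)) * y
  + c *: (x * (K mu * y - c' *: (y * K mu)))
  - q^-1 *: ((K mu * y - c' *: (y * K mu)) * x
  + c' *: (y * (K mu * x - c *: (x * K mu))))).
  by rewrite /qcomm; ncfield.
by rewrite D1 D2 !(mulr0, mul0r, scaler0, addr0, subr0).
Qed.

Let z := row qc n E (E n.+1).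
Let W := xbar qc n E.
Let w := row qc n E W.

Lemma qweight_row x d t : (1 <= t <= n.*2)%N -> qweight x d ->
  qweight (row qc n E x t) (d + ecoord n n + ev n t).
Proof.
move=> ht hx; rewrite -row_lat //; apply: (row_rel (R := qweight)) => //.
- by move=> a b a' b' h1 h2; exact: qweight_qcomm.
- by move=> i hi; apply: qweight_E; lia.
Qed.

Lemma qweight_z t : (1 <= t <= n.*2)%N -> qweight (z t) (ecoord n n.+1 + ev n t).
Proof.
move=> ht; have := qweight_row ht (qweight_E (leqnn n.+1)).
by rewrite alphaS ?subrK //; lia.
Qed.

Lemma qweight_W : qweight W (ecoord n n.+1 - ecoord n n + deltaL n).
Proof.
rewrite /W xbarE // -/z; have e1 : ev n n.*2.-1 = ecoord n n.-1.
  by rewrite /ev; have -> : (n.*2.-1 <= n)%N = false; [|congr ecoord]; lia.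
have e2 : ev n 2 = - ecoord n n.-1.
  by rewrite /ev; have -> : (2 <= n)%N; [|congr (- ecoord _ _)]; lia.
have h1 : qweight (z n.*2.-1) (ecoord n n.+1 + ev n n.*2.-1) by apply: qweight_z; lia.
have h2 : qweight (z 2) (ecoord n n.+1 + ev n 2) by apply: qweight_z; lia.
have h0 : (0 <= n.+1)%N by [].
have := qweight_qcomm h1 (qweight_qcomm h2 (qweight_E h0)); rewrite e1 e2 alpha0.
set v := _ + _; set v' := _ - _ + _; have -> // : v = v'.
by rewrite /v /v'; apply/rowP => j; rewrite !mxE; ring.
Qed.

Lemma eC i j : (1 <= i <= n)%N -> (1 <= j <= n)%N -> ~~ adj n i j ->
  E i * E j = E j * E i.
Proof. by move=> hi hj hadj; apply: (EF_far _ _ hadj).1; lia. Qed.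

Lemma eS i j : (1 <= i <= n)%N -> (1 <= j <= n)%N -> adj n i j -> serre q (E i) (E j).
Proof. by move=> hi hj hadj; apply: EF_serre => //; lia. Qed.

Lemma z_rule : rowrule q n (dplus n) E z.
Proof.
apply: row_rule => //; [exact: eC|exact: eS| |].
  by move=> i hi; apply: (EF_far _ _ _).1; rewrite ?/adj; lia.
by apply: EF_serre; rewrite ?/adj; lia.
Qed.

Lemma WE : W = Tv n T (E 0). Proof. by rewrite (Tv_E0 hn E_sys). Qed.

Lemma tau_range i : (1 <= i <= n)%N -> (1 <= tau n i <= n)%N.
Proof.
move=> hi; have [->|[->|h]] : i = 1%N \/ i = 2%N \/ (3 <= i <= n)%N by lia.
- by rewrite tau1; lia.
- by rewrite tau2; lia.
by rewrite tau3; lia.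
Qed.

Lemma E_Tv i : (1 <= i <= n)%N -> E i = Tv n T (E (tau n i)).
Proof.
move=> hi; rewrite (Tv_E hn E_sys sys5_E) ?tauK //; first by lia.
exact: tau_range.
Qed.

Lemma F_Tv i : (1 <= i <= n)%N -> F i = Tv n T (F (tau n i)).
Proof.
move=> hi; rewrite (Tv_E hn F_sys sys5_F) ?tauK //; first by lia.
exact: tau_range.
Qed.

(** Pulled back along T_v, this says that E_0 commutes with E_{tau i}; among 1, ..., n only the node
    n is adjacent to 0. *)
Lemma W_e i : (1 <= i < n)%N -> W * E i = E i * W.
Proof.
have hi2 : (1 <= i < n)%N -> (1 <= i <= n)%N by lia.
move=> hi; rewrite WE (E_Tv (hi2 hi)).
rewrite -!(homM _ _ Tv_hom); congr (Tv n T _).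
have [->|[->|h]] : i = 1%N \/ i = 2%N \/ (3 <= i <= n)%N by lia.
- by rewrite tau1 //; apply: (EF_far _ _ _).1; rewrite ?/adj; lia.
- by rewrite tau2 //; apply: (EF_far _ _ _).1; rewrite ?/adj; lia.
by rewrite tau3 //; apply: (EF_far _ _ _).1; rewrite ?/adj; lia.
Qed.

(** Pulled back along T_v, this is the vanishing of the commutator of E_0 with F_j for j != 0. *)
Lemma W_f i : (1 <= i <= n)%N -> W * F i = F i * W.
Proof.
move=> hi; rewrite WE F_Tv // -!(homM _ _ Tv_hom); congr (Tv n T _).
by have := tau_range hi => h; apply: EF_neq; lia.
Qed.

Lemma serre_hom (f : U -> U) a b : alg_hom f -> serre q a b -> serre q (f a) (f b).
Proof.
move=> hf; rewrite /serre => h.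
by rewrite -!(hom_qcomm _ _ hf) -!(homM _ _ hf) h (homZ _ _ hf).
Qed.

Lemma W_serre : serre q W (E n) /\ serre q (E n) W.
Proof.
have En : E n = Tv n T (E n) by rewrite [LHS]E_Tv ?tau3 //; lia.
by rewrite WE En; split; apply: (serre_hom Tv_hom); apply: EF_serre; rewrite ?/adj; lia.
Qed.

Lemma w_rule : rowrule q n (dplus n) E w.
Proof.
apply: row_rule => //; [exact: eC|exact: eS|exact: W_e|exact: W_serre.2].
Qed.

Lemma row_base x : serre q x (E n) -> row qc n E x 1 = x /\
  row qc n E x 2 * x = q^-1 *: (x * row qc n E x 2).
Proof.
move=> h; have r1 : row qc n E x 1 = x by rewrite row_first //; lia.
split=> //; have -> : row qc n E x 2 = qc x (E n).
  rewrite (_ : 2 = n.+1 - n.-1)%N; last by lia.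
  rewrite row_stepX; last by lia.
  by rewrite (_ : n - n.-1 = 1)%N ?r1 ?prednK //; lia.
by rewrite h scalerA mulVf // scale1r.
Qed.

Let Xz i := z (n.+1 - i).
Let Yz i := z (n + i).

Lemma Xz_step i : (1 <= i < n)%N -> Xz i = qc (Xz i.+1) (E i.+1).
Proof. by move=> hi; rewrite /Xz /z row_stepX. Qed.

Lemma Xz_top : Xz n = E n.+1.
Proof. by rewrite /Xz subSnn /z row_first //; lia. Qed.

Lemma Yz_1 : Yz 1 = qc (Xz 2) (E 1).
Proof. by rewrite /Yz /z row_Y1 // /Xz subSS. Qed.

Lemma Yz_step i : (1 <= i)%N -> Yz i.+1 = qc (Yz i) (E i.+1).
Proof. by move=> hi; rewrite /Yz /z row_stepY. Qed.

Lemma z_stay i t : (1 <= i <= n)%N -> (1 <= t <= n.*2)%N -> t != arrA n i -> t != arrB n i ->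
  t != pr n (arrA n i) -> t != pr n (arrB n i) -> z t * E i = E i * z t.
Proof.
move=> hi ht h1 h2 h3 h4; rewrite z_rule // /cw /dplus.
by rewrite (negPf h1) (negPf h2) (negPf h3) (negPf h4) addr0 scale1r.
Qed.

Lemma EF_neq' i m : (1 <= i <= n.+1)%N -> (1 <= m <= n)%N -> i != m -> E i * F m = F m * E i.
Proof. by move=> hi hm; apply: EF_neq; lia. Qed.

Lemma XF_le i m : (1 <= i <= n)%N -> (1 <= m <= i)%N -> Xz i * F m = F m * Xz i.
Proof.
move: i; apply: down_ind => [hm|i hi IHi hm].
  by rewrite Xz_top; apply: EF_neq'; lia.
rewrite Xz_step //; apply: qcomm_comm; first by apply: IHi; lia.
by apply: EF_neq'; lia.
Qed.

Lemma K_minus1 (x : U) d i : (1 <= i <= n)%N -> qweight x d -> ip (alpha i) d = -1 ->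
  K (alpha i) * x = q^-1 *: (x * K (alpha i)) /\
  K (- alpha i) * x = q *: (x * K (- alpha i)).
Proof.
move=> hi hx hip; rewrite !hx ?inQN ?inQ_alpha //; try by lia.
by rewrite ipNl hip opprK expr1z exprN1.
Qed.

Ltac iplia := rewrite ?ipE ?ip_ec; try (by lia); repeat (case: ifP => ?; try (exfalso; lia)); by [lia|].

Lemma KXz i : (1 <= i < n)%N ->
  K (alpha i.+1) * Xz i.+1 = q^-1 *: (Xz i.+1 * K (alpha i.+1)) /\
  K (- alpha i.+1) * Xz i.+1 = q *: (Xz i.+1 * K (- alpha i.+1)).
Proof.
move=> hi; apply: (K_minus1 _ (qweight_z _)); try by lia.
rewrite alphaS /ev; last by lia.
have -> : (n.+1 - i.+1 <= n)%N by lia.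
have -> : (n.+1 - (n.+1 - i.+1) = i.+1)%N by lia.
rewrite /=; iplia.
Qed.

Lemma KYz i : (1 <= i < n)%N ->
  K (alpha i.+1) * Yz i = q^-1 *: (Yz i * K (alpha i.+1)) /\
  K (- alpha i.+1) * Yz i = q *: (Yz i * K (- alpha i.+1)).
Proof.
move=> hi; apply: (K_minus1 _ (qweight_z _)); try by lia.
rewrite alphaS /ev; last by lia.
have -> : (n + i <= n)%N = false by lia.
have -> : (n + i - n = i)%N by lia.
rewrite /=; iplia.
Qed.

Lemma KXz2 :
  K (alpha 1) * Xz 2 = q^-1 *: (Xz 2 * K (alpha 1)) /\
  K (- alpha 1) * Xz 2 = q *: (Xz 2 * K (- alpha 1)).
Proof.
apply: (K_minus1 _ (qweight_z _)); try by lia.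
rewrite alpha1 /ev; have -> : (n.+1 - 2 <= n)%N by lia.
have -> : (n.+1 - (n.+1 - 2) = 2)%N by lia.
iplia.
Qed.

Lemma EF_same i : (1 <= i <= n)%N ->
  E i * F i - F i * E i = (qhat q)^-1 *: (K (alpha i) - K (- alpha i)).
Proof. by move=> hi; rewrite EF_comm ?eqxx //; lia. Qed.

Lemma XF_same i : (1 <= i < n)%N ->
  Xz i * F i.+1 = F i.+1 * Xz i + q^-1 *: (Xz i.+1 * K (alpha i.+1)).
Proof.
move=> hi; rewrite Xz_step //; have [h1 h2] := KXz hi.
apply: (lower_same q0 q2 _ _ h1 h2); first by apply: XF_le; lia.
by apply: EF_same; lia.
Qed.

Lemma XF_ge i m : (1 <= i <= n)%N -> (i.+2 <= m <= n)%N -> Xz i * F m = F m * Xz i.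
Proof.
move: i; apply: down_ind => [|i hi IHi hm]; first by lia.
rewrite Xz_step //; have [->|h] : m = i.+2 \/ (i.+3 <= m)%N by lia.
  apply: (lower_next q0 (XF_same _)); first by lia.
  - by apply: EF_neq'; lia.
  - by case: (@Kalpha i.+2 i.+1) => //; rewrite ?/adj; lia.
  - by apply: z_stay; arrlia.
apply: qcomm_comm; first by apply: IHi; lia.
by apply: EF_neq'; lia.
Qed.

Lemma YF_gt j m : (1 <= j)%N -> (j < m <= n)%N -> Yz j * F m = F m * Yz j.
Proof.
elim: j => // -[|j] IHj _ hm.
  rewrite Yz_1; have [->|[->|h]] : m = 2%N \/ m = 3%N \/ (4 <= m)%N by lia.
  - by apply: qcomm_comm; [apply: XF_le|apply: EF_neq']; lia.
  - apply: (lower_next q0 (XF_same _)); first by lia.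
    + by apply: EF_neq'; lia.
    + by case: (@Kalpha 3 1) => //; rewrite ?/adj; lia.
    + by apply: z_stay; arrlia.
  by apply: qcomm_comm; [apply: XF_ge|apply: EF_neq']; lia.
rewrite Yz_step //; apply: qcomm_comm; first by apply: IHj; lia.
by apply: EF_neq'; lia.
Qed.

Lemma YF_same j : (1 <= j < n)%N ->
  Yz j.+1 * F j.+1 = F j.+1 * Yz j.+1 + q^-1 *: (Yz j * K (alpha j.+1)).
Proof.
move=> hj; rewrite Yz_step; last by lia.
have [h1 h2] := KYz hj.
apply: (lower_same q0 q2 _ _ h1 h2); first by apply: YF_gt; lia.
by apply: EF_same; lia.
Qed.

Lemma YF_1 : Yz 1 * F 1 = F 1 * Yz 1 + q^-1 *: (Xz 2 * K (alpha 1)).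
Proof.
rewrite Yz_1; have [h1 h2] := KXz2.
apply: (lower_same q0 q2 _ _ h1 h2); first by apply: XF_le; lia.
by apply: EF_same; lia.
Qed.

Lemma KW i : (1 <= i <= n)%N ->
  K (alpha i) * W = (if i == n then q^-1 else 1) *: (W * K (alpha i)).
Proof.
move=> hi; rewrite qweight_W ?inQ_alpha //; try by lia.
congr (_ *: _).
have -> : ip (alpha i) (ecoord n n.+1 - ecoord n n + deltaL n) = if i == n then -1 else 0.
  have [->|h2] : i = 1%N \/ (2 <= i)%N by lia.
    rewrite alpha1; iplia.
  rewrite alphaS //; iplia.
by case: ifP; rewrite ?exprN1 ?expr0z.
Qed.

Lemma K_alphaV i : (1 <= i <= n)%N -> K (alpha i) * K (- alpha i) = 1.
Proof.
by move=> hi; rewrite K_add ?addrN ?K_zero ?inQN ?inQ_alpha //; lia.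
Qed.

(** Write v as v' followed by s_{n+1}. Then Y_n = T_{v'} E_{n+1}, and W = T_{v'} E_0 because T_{n+1}
    fixes E_0. The claim is the image under T_{v'} of the commutation of E_0 with E_{n+1}. *)
Lemma W_top : W * z n.*2 = z n.*2 * W.
Proof.
have sz := size_word1 hn.
have nE : nth 0%N (word1 n) n.*2.-1 = n.+1.
  rewrite /word1 nth_cat size_rev size_iota.
  have -> : (n.*2.-1 < n.+1)%N = false by lia.
  by rewrite nth_iota; lia.
have wE : word1 n = take n.*2.-1 (word1 n) ++ [:: n.+1].
  rewrite -[LHS](cat_take_drop n.*2.-1); congr (_ ++ _).
  rewrite (drop_nth 0%N) ?sz ?nE; last by lia.
  by rewrite drop_oversize ?sz //; lia.
have := Tword_row1 hn E_sys (t := n.*2); rewrite nE => zE.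
have hv : all (fun i => i <= n.+1)%N (take n.*2.-1 (word1 n)).
  by apply/allP => i /mem_take; apply: (allP all_word1).
rewrite /z -zE; last by lia.
rewrite WE /Tv wE TwordD -wE /= (sys_far E_sys); try by rewrite ?/adj; lia.
rewrite -!(homM _ _ (Tword_hom hv)); congr (Tword T _ _).
by apply: (EF_far _ _ _).1; rewrite ?/adj; lia.
Qed.

(** Each lowering step from Y_n multiplies the scalar by the factor with which K_{alpha_i} passes W:
    q^{-1} for i = n and 1 otherwise. F_n is used once more to reach X_n, which explains the q^{-2}
    in [W_cross]. *)
Lemma W_Yz j : (1 <= j < n)%N -> W * Yz j = q^-1 *: (Yz j * W).
Proof.
move: j; have P (i : nat) : (1 <= i <= n)%N -> (i < n)%N -> W * Yz i = q^-1 *: (Yz i * W).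
  move: i; apply: down_ind; first by lia.
  move=> i hi IHi hi'; have hi2 : (1 <= i.+1 <= n)%N by lia.
  have := lower_cross q0 (K_alphaV hi2) (YF_same hi) (W_f hi2) (KW hi2).
  have [iE|iE] : i.+1 = n \/ (i.+1 < n)%N by lia.
    rewrite iE eqxx => h; rewrite -[X in X *: _]mul1r; apply: h.
    by rewrite scale1r /Yz addnn W_top.
  have /negPf-> : i.+1 != n by lia.
  by move=> h; rewrite -[q^-1]mulr1; apply: h; apply: IHi.
by move=> j hj; apply: P; lia.
Qed.

Lemma W_Xz2 : W * Xz 2 = q^-1 *: (Xz 2 * W).
Proof.
have h1 : (1 <= 1 <= n)%N by lia.
rewrite -[q^-1]mulr1; apply: (lower_cross q0 (K_alphaV h1) YF_1 (W_f h1)).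
  by rewrite KW //; have /negPf-> : 1%N != n by lia.
by apply: W_Yz; lia.
Qed.

Lemma W_Xz i : (2 <= i < n)%N -> W * Xz i = q^-1 *: (Xz i * W).
Proof.
elim: i => // i IHi hi; have [->|h2] : i = 1%N \/ (2 <= i)%N by lia.
  exact: W_Xz2.
have h1 : (1 <= i.+1 <= n)%N by lia.
have h3 : (1 <= i < n)%N by lia.
rewrite -[q^-1]mulr1; apply: (lower_cross q0 (K_alphaV h1) (XF_same h3) (W_f h1)).
  by rewrite KW //; have /negPf-> : i.+1 != n by lia.
by apply: IHi; lia.
Qed.

Lemma W_Xz_top : W * Xz n = (q^-1 * q^-1) *: (Xz n * W).
Proof.
have h1 : (1 <= n <= n)%N by lia.
have h3 : (1 <= n.-1 < n)%N by lia.
have hp : n.-1.+1 = n by lia.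
have XF := XF_same h3; rewrite hp in XF.
apply: (lower_cross q0 (K_alphaV h1) XF (W_f h1)); first by rewrite KW ?eqxx.
have [n3|n4] : n.-1 = 2%N \/ (2 < n.-1)%N by lia.
  by rewrite n3; apply: W_Xz2.
by apply: W_Xz; lia.
Qed.

(** X_1 is obtained by raising instead: X_1 = [X_2, E_2], and E_2 commutes with W because 2 < n. *)
Lemma W_Xz1 : W * Xz 1 = q^-1 *: (Xz 1 * W).
Proof.
rewrite Xz_step; last by lia.
have /sub0 D1 := W_Xz2; have /sub0 D2 : W * E 2 = E 2 * W by apply: W_e; lia.
apply: subr0_eq; transitivity ((W * Xz 2 - q^-1 *: (Xz 2 * W)) * E 2
  + q^-1 *: (Xz 2 * (W * E 2 - E 2 * W)) - q^-1 *: ((W * E 2 - E 2 * W) * Xz 2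
  + E 2 * (W * Xz 2 - q^-1 *: (Xz 2 * W)))).
  by rewrite /qcomm; ncfield.
by rewrite D1 D2 !(mulr0, mul0r, scaler0, addr0, subr0).
Qed.

Lemma W_cross t : (1 <= t <= n.*2)%N ->
  W * z t = (if t == 1%N then q^-1 * q^-1 else if t == n.*2 then 1 else q^-1) *: (z t * W).
Proof.
move=> ht; have [->|h1] := eqVneq t 1%N.
  by have := W_Xz_top; rewrite /Xz subSnn.
have [->|h2] := eqVneq t n.*2; first by rewrite scale1r W_top.
have [h|h] : (t <= n)%N \/ (n < t)%N by lia.
  have -> : z t = Xz (n.+1 - t) by rewrite /Xz; congr z; lia.
  have [tn|tn] : t = n \/ (t < n)%N by lia.
    by rewrite tn subSnn W_Xz1.
  by apply: W_Xz; lia.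
have -> : z t = Yz (t - n) by rewrite /Yz; congr z; lia.
by apply: W_Yz; lia.
Qed.

Let x t := sgn k n t *: z t.
Let y t := sgn k n t *: w t.

Lemma x_rule : rowrule q n (dsign n) (fun i => esgn k n i *: E i) x.
Proof. exact: (row_rule_sign hn z_rule). Qed.

Lemma y_rule : rowrule q n (dsign n) (fun i => esgn k n i *: E i) y.
Proof. exact: (row_rule_sign hn w_rule). Qed.

Lemma row_relations : relsT q q n (fun p => if p.1 == 1%N then x p.2 else y p.2).
Proof.
have s1 : serre q (E n.+1) (E n) by apply: EF_serre; rewrite ?/adj; lia.
have [z1 z21] := row_base s1; have [w1 w21] := row_base W_serre.1.
apply: (rows_relsT q0 qq hn x_rule y_rule).
- rewrite /x -!scalerAl -!scalerAr !scalerA /z z1 z21 scalerA.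
  by congr (_ *: _); ring.
- rewrite /y -!scalerAl -!scalerAr !scalerA /w w1 w21 scalerA.
  by congr (_ *: _); ring.
move=> t ht; rewrite /x /y /w w1 -!scalerAl -!scalerAr.
have c t' : (1 <= t' <= n.*2)%N -> z t' * W = z t' * W by [].
rewrite W_cross // !scalerA.
have [->|h1] := eqVneq t 1%N.
  rewrite cross_eq w1 -!scalerAl -!scalerAr !scalerA; congr (_ *: _).
  by field.
have [t2|h2] := eqVneq t n.*2.
  have -> : t = pr n 1 by rewrite t2 /pr; lia.
  rewrite cross_pr_lo //.
  have -> : (n < 1)%N = false by lia.
  rewrite /= scaler0 addr0 w1 -!scalerAl -!scalerAr !scalerA; congr (_ *: _).
  by ring.
rewrite cross_lt //; try by move: h2; rewrite /pr; lia.
rewrite w1 -!scalerAl -!scalerAr !scalerA; congr (_ *: _).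
by field.
Qed.

Lemma rootvecE l : rootvec g T l = rootv n E T l.
Proof. by rewrite /rootvec TwordE. Qed.

Lemma rootvec1 t : (1 <= t <= n.*2)%N -> rootvec g T t = row qc n E (E n.+1) t.
Proof. by move=> ht; rewrite rootvecE (rootv1 hn E_sys). Qed.

Lemma rootvec2 t : (1 <= t <= n.*2)%N ->
  rootvec g T (n.*2 + t) = row qc n E (xbar qc n E) t.
Proof. by move=> ht; rewrite rootvecE (rootv2 hn E_sys sys5_E). Qed.

Lemma sgn2 t : sgn k n t * sgn k n t = 1.
Proof. by rewrite /sgn; case: ifP; rewrite ?mulr1 // -expr2 sqrr_sign. Qed.

Lemma rootvec_relsT : exists2 v : nat * nat -> U, relsT q q n v &
  forall t, (1 <= t <= n.*2)%N -> rootvec g T t = sgn k n t *: v (1, t)%N /\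
    rootvec g T (n.*2 + t) = sgn k n t *: v (2, t)%N.
Proof.
exists (fun p => if p.1 == 1%N then x p.2 else y p.2); first exact: row_relations.
move=> t ht; rewrite rootvec1 // rootvec2 // /x /y /= !scalerA sgn2 !scale1r.
by [].
Qed.

End UQ.

(** * Tensor powers of a minuscule representation *)

Section TensorDef.
Variables (R : comUnitRingType) (L : Type) (w : L -> nat -> int) (sh : nat -> L -> L) (q : R).

(* The action of a raising operator through the iterated coproduct
   E |-> E (x) 1 + K (x) E, on coefficient functions of tensor powers of a
   representation with basis [L] all of whose strings have length at most 1. *)
Fixpoint tens (i : nat) (f : seq L -> R) (s : seq L) : R :=
  if s is l :: s' then
    (w l i == 1)%:R * f (sh i l :: s') + q ^ (w l i) * tens i (fun r => f (l :: r)) s'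
  else 0.

Lemma tens_lin i a b (f g : seq L -> R) s :
  tens i (fun r => a * f r + b * g r) s = a * tens i f s + b * tens i g s.
Proof.
elim: s f g => [|l s IHs] f g /=; first by ring.
by rewrite IHs; ring.
Qed.

Lemma tens_scale i a (f : seq L -> R) s : tens i (fun r => a * f r) s = a * tens i f s.
Proof.
elim: s f => [|l s IHs] f /=; first by rewrite mulr0.
by rewrite IHs; ring.
Qed.

Lemma tens_linf i a b (f g : seq L -> R) :
  tens i (fun r => a * f r + b * g r) = (fun s => a * tens i f s + b * tens i g s).
Proof. by apply: funext => s; apply: tens_lin. Qed.
End TensorDef.

Section Tensor.
Variables (k : fieldType) (L : Type) (w : L -> nat -> int) (sh : nat -> L -> L) (q : k).
Hypothesis q0 : q != 0.
Local Notation tE := (tens w sh q).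

Lemma tens_comm i j : (forall l, w (sh i l) j = w l j) -> (forall l, w (sh j l) i = w l i) ->
  (forall l, w l i = 1 -> w l j = 1 -> sh i (sh j l) = sh j (sh i l)) ->
  forall f s, tE i (tE j f) s = tE j (tE i f) s.
Proof.
move=> hij hji hsh f s; elim: s f => [|l s IHs] f //=.
rewrite !tens_lin IHs !hij !hji.
case: eqP => h1; case: eqP => h2; rewrite ?(hsh _ h1 h2) /=; ring.
Qed.

(** Induction on the number of factors. Strings have length at most 1, so E_i cannot act twice on
    one factor; for each pair of weights the terms acting on the first factor cancel, and a power of
    q times the claim for the other factors remains. *)
Lemma tens_serre i j :
  (forall l, (w l i \in [:: -1; 0; 1]) && (w l j \in [:: -1; 0; 1])) ->
  (forall l, w (sh i l) i = - w l i) ->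
  (forall l, w (sh i l) j = w l j + w l i) -> (forall l, w (sh j l) i = w l i + w l j) ->
  forall f s, tE i (tE i (tE j f)) s - (q + q^-1) * tE i (tE j (tE i f)) s
    + tE j (tE i (tE i f)) s = 0.
Proof.
move=> hr hii hij hji f s; elim: s f => [|l s IHs] f; first by rewrite /=; ring.
have := IHs (fun r => f (l :: r)).
rewrite /= !tens_linf !hij !hji !hii !hij !hji => IH.
set X := _ + _ in IH; transitivity (q ^ (w l i) * q ^ (w l i) * q ^ (w l j) * X).
  rewrite /X !(expfzDr _ _ q0) -!invr_expz.
  have := hr l; rewrite !inE => /andP[/or3P[] /eqP -> /or3P[] /eqP ->] /=;
  by rewrite ?exprN1 ?invrK ?expr0z ?expr1z ?invr1; field.
by rewrite IH mulr0.
Qed.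
End Tensor.

(** * The algebra of linear operators on coefficient functions *)

Section Endo.
Variables (k : fieldType) (L : Type).
Local Notation S := (seq L).

(** Functions on words of labels treat all tensor powers at once and impose no support condition,
    although there are infinitely many labels. Linearity is a single equation of functions, so
    operators with equal values are equal by proof irrelevance. *)
Record endo := Endo {
  eapp :> (S -> k) -> S -> k;
  eapp_lin : forall a b f g,
    eapp (fun r => a * f r + b * g r) = (fun s => a * eapp f s + b * eapp g s) }.

Lemma endo_ext (P Q : endo) : (forall f s, P f s = Q f s) -> P = Q.
Proof.
case: P Q => [p hp] [r hr] /= h.
have e : p = r by apply: funext => f; apply: funext => s; apply: h.
by rewrite e in hp *; congr Endo; apply: Prop_irrelevance.
Qed.

HB.instance Definition _ := gen_eqMixin endo.
HB.instance Definition _ := gen_choiceMixin endo.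

Lemma endo_add_subproof (P Q : endo) a b f g :
  (fun s => P (fun r => a * f r + b * g r) s + Q (fun r => a * f r + b * g r) s) =
  (fun s => a * (P f s + Q f s) + b * (P g s + Q g s)).
Proof. by apply: funext => s; rewrite !eapp_lin; ring. Qed.
Definition endo_add P Q := Endo (endo_add_subproof P Q).

Lemma endo_opp_subproof (P : endo) a b f g :
  (fun s => - P (fun r => a * f r + b * g r) s) = (fun s => a * - P f s + b * - P g s).
Proof. by apply: funext => s; rewrite !eapp_lin; ring. Qed.
Definition endo_opp P := Endo (endo_opp_subproof P).

Lemma endo_zero_subproof (a b : k) (f g : S -> k) :
  (fun _ : S => 0) = (fun _ : S => a * 0 + b * 0).
Proof. by apply: funext => s; ring. Qed.
Definition endo_zero := Endo endo_zero_subproof.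

Lemma endo_one_subproof (a b : k) (f g : S -> k) :
  (fun r => a * f r + b * g r) = (fun s => a * f s + b * g s).
Proof. by []. Qed.
Definition endo_one := Endo endo_one_subproof.

Lemma endo_mul_subproof (P Q : endo) a b f g :
  P (Q (fun r => a * f r + b * g r)) = (fun s => a * P (Q f) s + b * P (Q g) s).
Proof. by rewrite !eapp_lin. Qed.
Definition endo_mul P Q := Endo (endo_mul_subproof P Q).

Lemma endo_scale_subproof c (P : endo) a b f g :
  (fun s => c * P (fun r => a * f r + b * g r) s) =
  (fun s => a * (c * P f s) + b * (c * P g s)).
Proof. by apply: funext => s; rewrite !eapp_lin; ring. Qed.
Definition endo_scale c P := Endo (endo_scale_subproof c P).

Lemma endo_addA : associative endo_add.
Proof. by move=> P Q M; apply: endo_ext => f s /=; rewrite addrA. Qed.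
Lemma endo_addC : commutative endo_add.
Proof. by move=> P Q; apply: endo_ext => f s /=; rewrite addrC. Qed.
Lemma endo_add0 : left_id endo_zero endo_add.
Proof. by move=> P; apply: endo_ext => f s /=; rewrite add0r. Qed.
Lemma endo_addN : left_inverse endo_zero endo_opp endo_add.
Proof. by move=> P; apply: endo_ext => f s /=; rewrite addNr. Qed.
HB.instance Definition _ :=
  GRing.isZmodule.Build endo endo_addA endo_addC endo_add0 endo_addN.

Lemma eapp_comb (P : endo) f g : P (fun r => f r + g r) = (fun s => P f s + P g s).
Proof.
have := eapp_lin P 1 1 f g; rewrite (_ : (fun r => 1 * f r + 1 * g r) = fun r => f r + g r).
  by move=> ->; apply: funext => s; rewrite !mul1r.
by apply: funext => s; rewrite !mul1r.
Qed.

Lemma eapp_scale (P : endo) a f : P (fun r => a * f r) = (fun s => a * P f s).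
Proof.
have := eapp_lin P a 0 f f; rewrite (_ : (fun r => a * f r + 0 * f r) = fun r => a * f r).
  by move=> ->; apply: funext => s; rewrite mul0r addr0.
by apply: funext => s; rewrite mul0r addr0.
Qed.

Lemma endo_mulA : associative endo_mul.
Proof. by move=> P Q M; apply: endo_ext. Qed.
Lemma endo_mul1 : left_id endo_one endo_mul.
Proof. by move=> P; apply: endo_ext. Qed.
Lemma endo_1mul : right_id endo_one endo_mul.
Proof. by move=> P; apply: endo_ext. Qed.
Lemma endo_mulDl : left_distributive endo_mul +%R.
Proof. by move=> P Q M; apply: endo_ext. Qed.
Lemma endo_mulDr : right_distributive endo_mul +%R.
Proof. by move=> P Q M; apply: endo_ext => f s; rewrite /= eapp_comb. Qed.
Lemma endo_one_neq0 : endo_one != 0 :> endo.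
Proof.
apply/eqP => /(congr1 (fun P : endo => P (fun _ => 1) [::])) /= /eqP.
by rewrite oner_eq0.
Qed.
HB.instance Definition _ := GRing.Zmodule_isNzRing.Build endo
  endo_mulA endo_mul1 endo_1mul endo_mulDl endo_mulDr endo_one_neq0.

Lemma endo_scaleA a b (P : endo) : endo_scale a (endo_scale b P) = endo_scale (a * b) P.
Proof. by apply: endo_ext => f s /=; rewrite mulrA. Qed.
Lemma endo_scale1 : left_id 1 endo_scale.
Proof. by move=> P; apply: endo_ext => f s /=; rewrite mul1r. Qed.
Lemma endo_scaleDr : right_distributive endo_scale +%R.
Proof. by move=> a P Q; apply: endo_ext => f s /=; rewrite mulrDr. Qed.
Lemma endo_scaleDl P : {morph endo_scale^~ P : a b / a + b}.
Proof. by move=> a b; apply: endo_ext => f s /=; rewrite mulrDl. Qed.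
HB.instance Definition _ := GRing.Zmodule_isLmodule.Build k endo
  endo_scaleA endo_scale1 endo_scaleDr endo_scaleDl.
Lemma endo_scaleAl a (P Q : endo) : a *: (P * Q) = (a *: P) * Q.
Proof. exact: endo_ext. Qed.
HB.instance Definition _ := GRing.Lmodule_isLalgebra.Build k endo endo_scaleAl.
Lemma endo_scaleAr a (P Q : endo) : a *: (P * Q) = P * (a *: Q).
Proof. by apply: endo_ext => f s; rewrite /= eapp_scale. Qed.
HB.instance Definition _ := GRing.Lalgebra_isAlgebra.Build k endo endo_scaleAr.
End Endo.

Local Opaque Defs.ip Defs.alpha Defs.inQ.

Section TensorK.
Variables (k : fieldType) (L : Type) (w : L -> nat -> int) (sh : nat -> L -> L) (q : k).
Hypothesis q0 : q != 0.
Local Notation tE := (tens w sh q).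

Lemma tens_weight (g : L -> int) (c : int) i f s :
  (forall l, w l i = 1 -> g (sh i l) = g l - c) ->
  q ^ (\sum_(l <- s) g l) * tE i f s =
  q ^ c * tE i (fun r => q ^ (\sum_(l <- r) g l) * f r) s.
Proof.
move=> hg; elim: s f => [|l s IHs] f /=; first by rewrite !mulr0.
have -> : (fun r => q ^ (\sum_(m <- l :: r) g m) * f (l :: r)) =
    (fun r => q ^ g l * (q ^ (\sum_(m <- r) g m) * f (l :: r))).
  by apply: funext => r; rewrite big_cons expfzDr // mulrA.
rewrite tens_scale mulrDr [in RHS]mulrDr; congr (_ + _).
  rewrite !big_cons; case: eqP => h; last by rewrite /= !mul0r !mulr0.
  by rewrite hg // /= !(expfzDr _ _ q0) -invr_expz; field; rewrite ?expfz_neq0.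
have IH := IHs (fun r => f (l :: r)); rewrite big_cons expfzDr //.
transitivity (q ^ g l * q ^ w l i * (q ^ (\sum_(j <- s) g j) * tE i (fun r => f (l :: r)) s)).
  by ring.
by rewrite IH; ring.
Qed.

Lemma tens_rcons i f s l : tE i f (rcons s l) =
  q ^ (\sum_(m <- s) w m i) * ((w l i == 1)%:R * f (rcons s (sh i l))) +
  tE i (fun r => f (rcons r l)) s.
Proof.
elim: s f => [|m s IHs] f /=; first by rewrite big_nil; ring.
by rewrite IHs big_cons expfzDr //; ring.
Qed.

End TensorK.

(** * Action of the quantum affine algebra on tensor powers *)

Section Rep.
Variables (k : fieldType) (q : k) (n : nat).
Hypotheses (q0 : q != 0) (q2 : q * q - 1 != 0) (hn : (3 <= n)%N).
Local Notation ip := (@ip n).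
Local Notation alpha := (alpha n).
Local Notation refl := (@refl n).

(** As [ip] ignores the delta coordinate, the labels are the vectors ±e_j + m delta, a basis of the
    affinised vector representation. *)
Definition label : Type := {l : lat n | ip l l == 1}.
Definition pairing (l : label) (i : nat) : int := ip (val l) (alpha i).
(** Reflections preserve the norm, so for i <= n+1 the default of [insubd] does not occur. *)
Definition shift (i : nat) (l : label) : label := insubd l (refl i (val l)).

Lemma val_shift i l : (i <= n.+1)%N -> val (shift i l) = refl i (val l).
Proof. by move=> hi; rewrite val_insubd refl_ip // (valP l). Qed.

Lemma pairing_shift i j l : (i <= n.+1)%N ->
  pairing (shift i l) j = pairing l j - pairing l i * ip (alpha i) (alpha j).
Proof.
by move=> hi; rewrite /pairing val_shift // /Defs.refl ipDl ipNl ipMzl mulrC.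
Qed.

Lemma ip_ge0 (a : lat n) : 0 <= ip a a.
Proof. by apply: sumr_ge0 => j _; rewrite -expr2 sqr_ge0. Qed.

Lemma pairing_range l i : (i <= n.+1)%N -> pairing l i \in [:: -1; 0; 1].
Proof.
move=> hi; have := ip_ge0 (val l + alpha i); have := ip_ge0 (val l - alpha i).
rewrite !ipE (ipC (alpha i) (val l)) cartan // eqxx (eqP (valP l)) -/(pairing l i).
by rewrite !inE; lia.
Qed.

Lemma shift_far i j l : (i <= n.+1)%N -> (j <= n.+1)%N -> ip (alpha i) (alpha j) = 0 ->
  shift i (shift j l) = shift j (shift i l).
Proof.
move=> hi hj h; apply: val_inj; rewrite !val_shift // /Defs.refl !ipDl !ipNl !ipMzl.
by rewrite h (ipC (alpha j)) h !mul0r !subr0 addrAC.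
Qed.

Lemma shift_shift i l : (i <= n.+1)%N -> shift i (shift i l) = l.
Proof.
move=> hi; apply: val_inj; rewrite !val_shift // /Defs.refl !ipDl !ipNl !ipMzl.
rewrite cartan // eqxx.
have -> : ip (val l) (alpha i) - 2 * ip (val l) (alpha i) = - ip (val l) (alpha i).
  by ring.
by rewrite mulrNz opprK subrK.
Qed.

Lemma reflE i (a : lat n) : refl i a = a - alpha i *~ ip a (alpha i).
Proof. by []. Qed.

Lemma pairingE l i : pairing l i = ip (val l) (alpha i).
Proof. by []. Qed.

Local Opaque pairing shift Defs.refl.
Local Notation opE := (tens pairing shift q).
Local Notation opF' := (tens (fun l i => - pairing l i) shift q).

Definition wsum (mu : lat n) (s : seq label) : int := \sum_(l <- s) ip mu (val l).
(** The coproduct F |-> F (x) K^{-1} + 1 (x) F is the one used for E with weights negated and tensor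
    factors reversed. The reversal makes the lemmas on [tens] available for F. *)
Definition opF i (f : seq label -> k) (s : seq label) : k :=
  opF' i (fun r => f (rev r)) (rev s).

Lemma opF_cons i f l s : opF i f (l :: s) =
  (pairing l i == -1)%:R * (q ^ (- wsum (alpha i) s) * f (shift i l :: s)) +
  opF i (fun r => f (l :: r)) s.
Proof.
rewrite /opF rev_cons tens_rcons // rev_rcons; congr (_ + _).
  rewrite revK [X in q ^ X](_ : _ = - wsum (alpha i) s).
    have -> : (- pairing l i == 1) = (pairing l i == -1) by rewrite eqr_oppLR.
    by rewrite mulrCA.
  rewrite /wsum -sumrN (perm_big s); last by rewrite perm_rev.
  by apply: eq_bigr => m _; rewrite ipC.
by congr (tens _ _ _ _ _ _); apply: funext => r; rewrite rev_rcons.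
Qed.

Lemma opE_lin i a b f g :
  opE i (fun r => a * f r + b * g r) = (fun s => a * opE i f s + b * opE i g s).
Proof. exact: tens_linf. Qed.

Lemma opF_lin i a b f g :
  opF i (fun r => a * f r + b * g r) = (fun s => a * opF i f s + b * opF i g s).
Proof. by apply: funext => s; rewrite /opF tens_lin. Qed.

Lemma opK_lin mu a b (f g : seq label -> k) :
  (fun s => q ^ wsum mu s * (a * f s + b * g s)) =
  (fun s => a * (q ^ wsum mu s * f s) + b * (q ^ wsum mu s * g s)).
Proof. by apply: funext => s; move: (q ^ _) => c; ring. Qed.

Definition tensor_rep (u : Ugen n) : endo k label :=
  match u with
  | UE i => Endo (@opE_lin i)
  | UF i => Endo (@opF_lin i)
  | UK mu => Endo (@opK_lin mu)
  end.

Lemma opE_weight mu i f s : (i <= n.+1)%N ->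
  q ^ wsum mu s * opE i f s =
  q ^ (ip mu (alpha i)) * opE i (fun r => q ^ wsum mu r * f r) s.
Proof.
move=> hi; apply: tens_weight => // l hl.
by rewrite val_shift // reflE ipDr ipNr ipMzr -pairingE hl mulr1.
Qed.

Lemma wsum_rev mu s : wsum mu (rev s) = wsum mu s.
Proof. by rewrite /wsum (perm_big s) // perm_rev. Qed.

Lemma opF_weight mu i f s : (i <= n.+1)%N ->
  q ^ wsum mu s * opF i f s =
  q ^ (- ip mu (alpha i)) * opF i (fun r => q ^ wsum mu r * f r) s.
Proof.
move=> hi; rewrite /opF -(wsum_rev mu s).
rewrite (tens_weight q0 (c := - ip mu (alpha i))) => [|l hl].
  congr (_ * _); congr (tens _ _ _ _ _ _).
  by apply: funext => r; rewrite wsum_rev.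
have {}hl : pairing l i = -1 by rewrite -hl opprK.
by rewrite val_shift // reflE ipDr ipNr ipMzr -pairingE hl mulrN1 !opprK.
Qed.

(** Induction on the number of factors. Products acting on different factors cancel by the power of
    q that E_i acquires in passing the weights of F_j, recorded in [E1]; the terms on the first
    factor are a finite check over its pairings. *)
Lemma opEF i j f s : (i <= n.+1)%N -> (j <= n.+1)%N ->
  opE i (opF j f) s - opF j (opE i f) s =
  (i == j)%:R * ((qhat q)^-1 * (q ^ wsum (alpha i) s * f s - q ^ wsum (- alpha i) s * f s)).
Proof.
move=> hi hj; have h0 : qhat q != 0.
  have -> : qhat q = q^-1 * (q * q - 1) by rewrite /qhat; field.
  by rewrite mulf_neq0 // invr_neq0.
elim: s f => [|l s IHs] f.
  by rewrite /= /opF /= /wsum !big_nil !subrr !mulr0.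
rewrite opF_cons [opE i _ _]/= opF_cons.
have -> : (fun r => opF j f (l :: r)) = (fun r => (pairing l j == -1)%:R *
   (q ^ (- wsum (alpha j) r) * f (shift j l :: r)) + 1 * opF j (fun r' => f (l :: r')) r).
  by apply: funext => r; rewrite opF_cons mul1r.
have -> : (fun r => opE i f (l :: r)) = (fun r => (pairing l i == 1)%:R * f (shift i l :: r)
   + q ^ pairing l i * opE i (fun r' => f (l :: r')) r).
  by [].
rewrite tens_lin opF_lin mul1r.
have {}IHs := IHs (fun r => f (l :: r)).
have wN mu r : - wsum mu r = wsum (- mu) r.
  by rewrite /wsum -sumrN; apply: eq_bigr => m _; rewrite ipNl.
have W := opE_weight (- alpha j) (fun r => f (shift j l :: r)) s hi.
have E1 : opE i (fun r => q ^ (- wsum (alpha j) r) * f (shift j l :: r)) s =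
    q ^ ip (alpha i) (alpha j) * (q ^ (- wsum (alpha j) s) * opE i (fun r => f (shift j l :: r)) s).
  rewrite !wN W mulrA -expfzDr // ipNl ipC subrr expr0z mul1r.
  by congr (tens _ _ _ _ _ _); apply: funext => r; rewrite wN.
rewrite E1 [opE i f _]/= !pairing_shift //.
have -> : opE i (opF j (fun r => f (l :: r))) s = opF j (opE i (fun r => f (l :: r))) s +
   (i == j)%:R * ((qhat q)^-1 * (q ^ wsum (alpha i) s * f (l :: s) - q ^ wsum (- alpha i) s * f (l :: s))).
  by rewrite -IHs addrC subrK.
have wc mu r : wsum mu (l :: r) = ip mu (val l) + wsum mu r by rewrite /wsum big_cons.
rewrite !wc !(ipC _ (val l)) ipNr -pairingE -!wN !(expfzDr _ _ q0) -!invr_expz.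
have P0 : q ^ wsum (alpha j) s != 0 by apply: expfz_neq0.
move: (opE i (fun r => f (shift j l :: r)) s) => a.
move: (opF j (opE i (fun r => f (l :: r))) s) (opF j (fun r => f (shift i l :: r)) s) => b c.
have ri := pairing_range l hi; have rj := pairing_range l hj.
have [ij|nij] := eqVneq i j.
  have h2 : ip (alpha i) (alpha i) = 2 by rewrite cartan // eqxx.
  have ss := shift_shift l hj.
  rewrite -ij in rj ss P0 * => {hj ij}; rewrite h2 ss.
  move: (q ^ wsum (alpha i) s) P0 (f (l :: s)) (f (shift i l :: s)) => P P0 y z.
  move: ri {rj}; rewrite /qhat !inE => /or3P[] /eqP -> /=;
    by rewrite ?exprN1 ?invrK ?expr0z ?expr1z ?invr1; field; rewrite P0 q2 q0.
rewrite !mul0r addr0.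
move: (q ^ wsum (alpha j) s) P0 => P P0.
rewrite (cartan hn hi hj) (cartan hn hj hi) (negPf nij) [j == i]eq_sym (negPf nij) (adj_sym hn j i).
case: ifP => hadj.
  move: (f _) (f _) => y z.
  move: ri rj; rewrite !inE => /or3P[] /eqP -> /or3P[] /eqP -> /=;
    by rewrite ?exprN1 ?invrK ?expr0z ?expr1z ?invr1; field; rewrite ?P0 ?q0.
have -> : shift i (shift j l) = shift j (shift i l).
  by apply: shift_far => //; rewrite cartan // (negPf nij) hadj.
move: (f _) => y.
move: ri rj; rewrite !inE => /or3P[] /eqP -> /or3P[] /eqP -> /=;
  by rewrite ?exprN1 ?invrK ?expr0z ?expr1z ?invr1; field; rewrite ?P0 ?q0.
Qed.

Lemma cart_cases i j : (i <= n.+1)%N -> (j <= n.+1)%N ->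
  (ip (alpha i) (alpha j) == 0) || (ip (alpha i) (alpha j) == 2) ->
  i = j \/ ip (alpha i) (alpha j) = 0.
Proof.
move=> hi hj /orP[/eqP->|]; first by right.
by rewrite cartan //; case: (i =P j) => [->|_]; [left|case: ifP].
Qed.

Lemma opE_far i j f s : (i <= n.+1)%N -> (j <= n.+1)%N -> ip (alpha i) (alpha j) = 0 ->
  opE i (opE j f) s = opE j (opE i f) s.
Proof.
move=> hi hj h; apply: tens_comm => [l|l|l _ _].
- by rewrite pairing_shift // h mulr0 subr0.
- by rewrite pairing_shift // ipC h mulr0 subr0.
exact: shift_far.
Qed.

Lemma opF_far i j f s : (i <= n.+1)%N -> (j <= n.+1)%N -> ip (alpha i) (alpha j) = 0 ->
  opF i (opF j f) s = opF j (opF i f) s.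
Proof.
move=> hi hj h; rewrite /opF.
have rr (g : seq label -> k) : (fun r => g (rev (rev r))) = g.
  by apply: funext => r; rewrite revK.
rewrite (rr (opF' j _)) (rr (opF' i _)); apply: tens_comm => [l|l|l _ _].
- by rewrite pairing_shift // h mulr0 subr0.
- by rewrite pairing_shift // ipC h mulr0 subr0.
exact: shift_far.
Qed.

Lemma cart_adj i j : ip (alpha i) (alpha j) = -1 -> ip (alpha j) (alpha i) = -1.
Proof. by rewrite ipC. Qed.

Lemma opE_serre i j f s : (i <= n.+1)%N -> (j <= n.+1)%N -> ip (alpha i) (alpha j) = -1 ->
  opE i (opE i (opE j f)) s - (q + q^-1) * opE i (opE j (opE i f)) s
    + opE j (opE i (opE i f)) s = 0.
Proof.
move=> hi hj h; have h' := cart_adj h; have h2 : ip (alpha i) (alpha i) = 2.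
  by rewrite cartan // eqxx.
apply: tens_serre => // [l|l|l|l].
- by rewrite !pairing_range.
- by rewrite pairing_shift // h2; ring.
- by rewrite pairing_shift // h; ring.
by rewrite pairing_shift // h'; ring.
Qed.

Lemma opF_serre i j f s : (i <= n.+1)%N -> (j <= n.+1)%N -> ip (alpha i) (alpha j) = -1 ->
  opF i (opF i (opF j f)) s - (q + q^-1) * opF i (opF j (opF i f)) s
    + opF j (opF i (opF i f)) s = 0.
Proof.
move=> hi hj h; have h' := cart_adj h; have h2 : ip (alpha i) (alpha i) = 2.
  by rewrite cartan // eqxx.
have rr (g : seq label -> k) : (fun r => g (rev (rev r))) = g.
  by apply: funext => r; rewrite revK.
rewrite /opF !(rr (opF' _ _)); apply: tens_serre => // [l|l|l|l].
- have := pairing_range l hi; have := pairing_range l hj.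
  by rewrite !inE => /or3P[] /eqP -> /or3P[] /eqP ->.
- by rewrite pairing_shift // h2; ring.
- by rewrite pairing_shift // h; ring.
by rewrite pairing_shift // h'; ring.
Qed.

Lemma tensor_rep_K mu i : (i <= n.+1)%N ->
  tensor_rep (UK mu) * tensor_rep (UE n i) =
  q ^ (ip mu (alpha i)) *: (tensor_rep (UE n i) * tensor_rep (UK mu)).
Proof. by move=> hi; apply: endo_ext => f s; rewrite /= opE_weight. Qed.

Lemma tensor_rep_rels : relsU q tensor_rep.
Proof.
split; [|split; [|split; [|split; [|split; [|split]]]]].
- apply: endo_ext => f s /=; rewrite /wsum big1 ?expr0z ?mul1r // => l _; exact: ip0l.
- move=> mu la _ _; apply: endo_ext => f s /=.
  rewrite mulrA -expfzDr // /wsum -big_split; congr (q ^ _ * _).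
  by apply: eq_bigr => l _; rewrite ipDl.
- by move=> mu i _ hi; apply: tensor_rep_K.
- by move=> mu i _ hi; apply: endo_ext => f s; rewrite /= opF_weight.
- move=> i j hi hj /cart_cases h; have [->|h0] := h hi hj; first by [].
  by split; apply: endo_ext => f s; [apply: opE_far|apply: opF_far].
- move=> i j hi hj h; split; apply: (@serre_of0 _ _ _ q0); apply: endo_ext => f s.
    exact: (opE_serre _ _ hi hj h).
  exact: (opF_serre _ _ hi hj h).
move=> i j hi hj; apply: endo_ext => f s; transitivity (opE i (opF j f) s - opF j (opE i f) s).
  by [].
by rewrite opEF //; case: eqP => _; rewrite ?mul1r ?mul0r //= -mulrBl.
Qed.

End Rep.

(** * Specialisation at q = 1 *)

Section Spec.
Variables (k : fieldType) (q : k).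
Hypothesis hq : transcendental q.
Hypothesis q0 : q != 0.

Lemma int_transcendental (p : {poly int}) : p != 0 -> (map_poly intr p).[q] != 0.
Proof.
move=> p0; have h : map_poly intr p != 0 :> {poly rat}.
  by rewrite -size_poly_eq0 size_map_inj_poly ?size_poly_eq0 //; apply: intr_inj.
have := hq h; rewrite /root -map_poly_comp_id0 ?rmorph0 //; last exact: (ratr_int k 0).
by rewrite (eq_map_poly (g := intr)) // => z /=; rewrite ratr_int.
Qed.

(* [x] lies in Z[q, 1/q] and takes the value [c] at [q = 1]. *)
Definition spec (x : k) (c : int) : Prop :=
  exists N (p : {poly int}), x * q ^+ N = (map_poly intr p).[q] /\ p.[1] = c.

Lemma specD x y c d : spec x c -> spec y d -> spec (x + y) (c + d).
Proof.
move=> [N [p [hp <-]]] [M [r [hr <-]]].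
exists (N + M)%N, (p * 'X^M + r * 'X^N); split; last first.
  by rewrite hornerD !hornerM !hornerXn !expr1n !mulr1.
rewrite rmorphD !rmorphM /= !map_polyXn hornerD !hornerM !hornerXn -hp -hr exprD.
by rewrite mulrDl !mulrA; congr (_ + _); rewrite mulrAC.
Qed.

Lemma specM x y c d : spec x c -> spec y d -> spec (x * y) (c * d).
Proof.
move=> [N [p [hp <-]]] [M [r [hr <-]]].
exists (N + M)%N, (p * r); split; last by rewrite hornerM.
by rewrite rmorphM hornerM -hp -hr exprD mulrACA.
Qed.

Lemma spec_int (m : int) : spec m%:~R m.
Proof. by exists 0%N, (m%:P); rewrite expr0 mulr1 map_polyC !hornerC. Qed.

Lemma spec0 : spec 0 0. Proof. exact: (spec_int 0). Qed.
Lemma spec1 : spec 1 1. Proof. exact: (spec_int 1). Qed.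

Lemma specN x c : spec x c -> spec (- x) (- c).
Proof. by move=> h; have := specM (spec_int (-1)) h; rewrite !mulN1r. Qed.

Lemma spec_q : spec q 1.
Proof. by exists 0%N, 'X; rewrite expr0 mulr1 map_polyX !hornerX. Qed.

Lemma spec_qV : spec q^-1 1.
Proof. by exists 1%N, 1; rewrite expr1 mulVf // rmorph1 !hornerC. Qed.

Lemma spec_qz (z : int) : spec (q ^ z) 1.
Proof.
have H x (m : nat) : spec x 1 -> spec (x ^+ m) 1.
  move=> h; elim: m => [|m IHm]; first exact: spec1.
  by rewrite exprS -[1]mulr1; apply: specM.
case: z => m; first exact: H spec_q.
by rewrite NegzE -exprz_inv -exprnP; apply: H spec_qV.
Qed.

Lemma spec_sum (I : Type) (r : seq I) (F : I -> k) (G : I -> int) :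
  (forall i, spec (F i) (G i)) -> spec (\sum_(i <- r) F i) (\sum_(i <- r) G i).
Proof.
by move=> h; elim/big_rec2: _ => [|i x y _ hxy]; [apply: spec0|apply: specD].
Qed.

Lemma spec_prod (I : Type) (r : seq I) (F : I -> k) (G : I -> int) :
  (forall i, spec (F i) (G i)) -> spec (\prod_(i <- r) F i) (\prod_(i <- r) G i).
Proof.
by move=> h; elim/big_rec2: _ => [|i x y _ hxy]; [apply: spec1|apply: specM].
Qed.

(** Transcendence enters here: a numerator p with p(1) != 0 is a nonzero polynomial, so p(q) !=
    0. *)
Lemma spec_neq0 x c : spec x c -> c != 0 -> x != 0.
Proof.
move=> [N [p [hp <-]]] c0; apply: contraNneq c0 => x0.
have [->|/int_transcendental] := eqVneq p 0; first by rewrite horner0.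
by rewrite -hp x0 mul0r eqxx.
Qed.

Lemma spec_det m (A : 'M[k]_m) (B : 'M[int]_m) :
  (forall i j, spec (A i j) (B i j)) -> spec (\det A) (\det B).
Proof.
move=> h; apply: spec_sum => s; apply: specM; last exact: spec_prod.
by case: (perm.odd_perm s); [apply: specN spec1|apply: spec1].
Qed.

Lemma spec_diag_free m (A : 'M[k]_m) (B : 'M[int]_m) (x : 'rV_m) :
  (forall i j, spec (A i j) (B i j)) -> (forall i j, i != j -> B i j = 0) ->
  (forall i, B i i != 0) -> x *m A = 0 -> x = 0.
Proof.
move=> hAB hB hd hx; have : A \in unitmx.
  rewrite unitmxE unitfE; apply: spec_neq0 (spec_det hAB) _.
  have -> : B = diag_mx (\row_i B i i).
    apply/matrixP => i j; rewrite !mxE; case: eqVneq => [->//|ij]; exact: hB.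
  by rewrite det_diag; apply/prodf_neq0 => i _; rewrite mxE.
by move=> uA; rewrite -[x]mulmx1 -(mulmxV uA) mulmxA hx mul0mx.
Qed.

Lemma trans_q2 : q * q - 1 != 0.
Proof.
have := @int_transcendental ('X * 'X - 1); rewrite rmorphB rmorphM rmorph1 /= map_polyX.
rewrite hornerD hornerN hornerM hornerX hornerC; apply.
by apply/eqP => /(congr1 (fun p : {poly int} => p.[0])); rewrite !hornerE.
Qed.

Lemma trans_qq : q + q^-1 != 0.
Proof.
have := @int_transcendental ('X * 'X + 1); rewrite rmorphD rmorphM rmorph1 /= map_polyX.
rewrite hornerD hornerM hornerX hornerC => h.
suff -> : q + q^-1 = q^-1 * (q * q + 1).
  rewrite mulf_neq0 ?invr_neq0 //; apply: h.
  by apply/eqP => /(congr1 (fun p : {poly int} => p.[0])); rewrite !hornerE.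
by rewrite mulrDr mulKf // mulr1.
Qed.
End Spec.

(** * Root vectors at q = 1 *)

Lemma row_ind S (br : S -> S -> S) n e x (P : nat -> S -> Prop) : (3 <= n)%N -> P 1%N x ->
  (forall i a, (1 <= i < n)%N -> P (n - i)%N a -> P (n.+1 - i)%N (br a (e i.+1))) ->
  (forall a, P (n - 1)%N a -> P (n + 1)%N (br a (e 1%N))) ->
  (forall i a, (1 <= i < n)%N -> P (n + i)%N a -> P (n + i.+1)%N (br a (e i.+1))) ->
  forall t, (1 <= t <= n.*2)%N -> P t (row br n e x t).
Proof.
move=> hn h1 hX hY1 hY.
have HX j : (j < n)%N -> P j.+1 (row br n e x j.+1).
  elim: j => [|j IHj] hj; first by rewrite row_first //; lia.
  have -> : j.+2 = (n.+1 - (n - j.+1))%N by lia.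
  rewrite row_stepX; last by lia.
  apply: hX; first by lia.
  by have -> : (n - (n - j.+1) = j.+1)%N; [lia|apply: IHj; lia].
have HY j : (j < n)%N -> P (n + j.+1)%N (row br n e x (n + j.+1)).
  elim: j => [|j IHj] hj.
    rewrite row_Y1 //; apply: hY1.
    by have -> : (n - 1 = (n - 2).+1)%N; [lia|apply: HX; lia].
  by rewrite row_stepY //; apply: hY; [lia|apply: IHj; lia].
move=> t ht; have [h|h] : (t <= n)%N \/ (n < t)%N by lia.
  by have -> : t = t.-1.+1; [lia|apply: HX; lia].
by have -> : t = (n + (t - n).-1.+1)%N; [lia|apply: HY; lia].
Qed.

Section Classical.
Variables (n : nat).
Hypothesis hn : (3 <= n)%N.
Local Notation lat := (lat n).
Local Notation ip := (@ip n).
Local Notation alpha := (alpha n).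
Local Notation ec := (ecoord n).
Local Notation ev := (ev n).

Definition clop := (seq lat -> int) -> seq lat -> int.
Definition clcomm (P Q : clop) : clop := fun F s => P (Q F) s - Q (P F) s.

(* [P] acts as a derivation on coefficient functions of tensor powers: on one
   tensor factor it subtracts [b] from the label, with coefficient [c]. *)
Record prim (P : clop) (b : lat) (c : lat -> int) : Prop := Prim {
  prim_lin : forall x y F G,
    P (fun s => x * F s + y * G s) = (fun s => x * P F s + y * P G s);
  prim_nil : forall F, P F [::] = 0;
  prim_cons : forall F l s, P F (l :: s) = c l * F (l - b :: s) + P (fun r => F (l :: r)) s;
  prim_supp : forall l, c l != 0 -> (ip l l == 1) && (ip (l - b) (l - b) == 1) }.

(** Terms in which P and Q act on different tensor factors cancel, so the commutator acts on one
    factor at a time. *)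
Lemma prim_comm P Q b b' c c' : prim P b c -> prim Q b' c' ->
  prim (clcomm P Q) (b + b') (fun l => c l * c' (l - b) - c' l * c (l - b')).
Proof.
move=> hP hQ; split.
- move=> x y F G; apply: funext => s; rewrite /clcomm (prim_lin hQ) (prim_lin hP).
  by rewrite (prim_lin hP) (prim_lin hQ); ring.
- by move=> F; rewrite /clcomm (prim_nil hP) (prim_nil hQ) subrr.
- move=> F l s; rewrite /clcomm (prim_cons hP) (prim_cons hQ).
  have e1 : (fun r => Q F (l :: r)) = (fun r => c' l * F (l - b' :: r) + 1 * Q (fun r => F (l :: r)) r).
    by apply: funext => r; rewrite mul1r (prim_cons hQ).
  have e2 : (fun r => P F (l :: r)) = (fun r => c l * F (l - b :: r) + 1 * P (fun r => F (l :: r)) r).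
    by apply: funext => r; rewrite mul1r (prim_cons hP).
  rewrite e1 e2 (prim_lin hP) (prim_lin hQ) (prim_cons hQ F (l - b)) (prim_cons hP F (l - b')).
  rewrite (_ : l - b' - b = l - b - b'); last by rewrite addrAC.
  rewrite (_ : l - (b + b') = l - b - b'); last by rewrite opprD addrA.
  by ring.
move=> l; case: (eqVneq (c l * c' (l - b)) 0) => [->|].
  rewrite sub0r oppr_eq0 mulf_eq0 negb_or => /andP[/(prim_supp hQ) /andP[-> _]].
  by move=> /(prim_supp hP) /andP[_]; rewrite opprD addrA [l - b' - b]addrAC.
rewrite mulf_eq0 negb_or => /andP[/(prim_supp hP) /andP[-> _]].
by move=> /(prim_supp hQ) /andP[_]; rewrite opprD addrA.
Qed.

(** The norm condition stands in for membership in [label], so that these operators are defined on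
    words of arbitrary lattice vectors. *)
Definition clc i (l : lat) : int := ((ip l l == 1) && (ip l (alpha i) == 1))%:R.

Fixpoint clE i (F : seq lat -> int) (s : seq lat) : int :=
  if s is l :: s' then clc i l * F (l - alpha i :: s') + clE i (fun r => F (l :: r)) s' else 0.

Lemma prim_E i : (i <= n.+1)%N -> prim (clE i) (alpha i) (clc i).
Proof.
move=> hi; split => //.
- move=> x y F G; apply: funext => s; elim: s F G => [|l s IHs] F G /=; first by ring.
  by rewrite IHs; ring.
move=> l; rewrite /clc; case: (boolP (_ && _)) => [/andP[/eqP h1 /eqP h2] _|_]; last by rewrite eqxx.
have h3 : ip (alpha i) (alpha i) = 2 by rewrite cartan // eqxx.
by rewrite !ipE (ipC (alpha i) l) h1 h2 h3 eqxx.
Qed.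

(** In the applications b = e_{n+1} + u, so u is the label that P connects with u - b = -e_{n+1}. *)
Definition good (P : clop) (b u : lat) : Prop := exists2 c, prim P b c & c u != 0.

Lemma ip_last_alpha i : (1 <= i <= n)%N -> ip (alpha i) (ec n.+1) = 0.
Proof.
move=> hi; have [->|h] : i = 1%N \/ (2 <= i)%N by lia.
  by rewrite alpha1 ipE !ip_ec; try lia; do ?case: ifP => ?; lia.
by rewrite alphaS // ipE ipNl !ip_ec; try lia; do ?case: ifP => ?; lia.
Qed.

(** One term of the commutator vanishes, since u + alpha_i - (e_{n+1} + u) = alpha_i - e_{n+1} has
    norm 3 and is not a label. The other is a product of nonzero coefficients, so nothing
    cancels. *)
Lemma good_step P u i : (1 <= i <= n)%N -> ip u u = 1 -> ip u (alpha i) = -1 ->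
  good P (ec n.+1 + u) u -> good (clcomm P (clE i)) (ec n.+1 + (u + alpha i)) (u + alpha i).
Proof.
move=> hi hu hui [c hP cu]; have hE : prim (clE i) (alpha i) (clc i) by apply: prim_E; lia.
have ha : ip (alpha i) (alpha i) = 2 by rewrite cartan ?eqxx //; lia.
have hl := ip_last_alpha hi; have he : ip (ec n.+1) (ec n.+1) = 1.
  by rewrite ip_ec ?eqxx //; lia.
rewrite addrA; eexists; first exact: prim_comm hP hE.
rewrite /=.
have -> : c (u + alpha i) = 0.
  apply/eqP; apply: contraT => /(prim_supp hP) /andP[_].
  have -> : u + alpha i - (ec n.+1 + u) = alpha i - ec n.+1.
    by rewrite opprD addrA addrAC [u + _]addrC addrK.
  by rewrite !ipE (ipC (ec n.+1)) ha hl he.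
rewrite mul0r sub0r oppr_eq0 addrK mulf_neq0 // /clc !ipE (ipC (alpha i) u) hu hui ha.
by [].
Qed.

Lemma good_rows x m : good x (ec n.+1 + (ev 1 + deltaL n *~ m)) (ev 1 + deltaL n *~ m) ->
  forall t, (1 <= t <= n.*2)%N -> good (row clcomm n clE x t)
    (ec n.+1 + (ev t + deltaL n *~ m)) (ev t + deltaL n *~ m).
Proof.
move=> h1.
have step P t t' i : (1 <= t <= n.*2)%N -> (1 <= i <= n)%N -> ev t' = ev t + alpha i ->
    ip (ev t) (alpha i) = -1 -> good P (ec n.+1 + (ev t + deltaL n *~ m)) (ev t + deltaL n *~ m) ->
    good (clcomm P (clE i)) (ec n.+1 + (ev t' + deltaL n *~ m)) (ev t' + deltaL n *~ m).
  move=> ht hi -> hev hP; rewrite [_ + alpha i + _]addrAC; apply: good_step => //.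
    by rewrite !(ipDl, ipDr, ipMzl, ipMzr, ip_delta, ip_deltal) !mul0r !addr0 ip_ev // eqxx.
  by rewrite ipDl ipMzl ip_deltal mul0r addr0 hev.
apply: (row_ind (P := fun t P => good P _ _)) => //.
- move=> i P hi; apply: step; try by lia.
    have -> : (n - i = n.+1 - i.+1)%N by lia.
    by rewrite !ev_X ?alphaS /=; try lia; rewrite addrA addNr add0r.
  have -> : (n - i = n.+1 - i.+1)%N by lia.
  rewrite !ev_X ?alphaS /=; try lia.
  by rewrite !ipE !ip_ec; try lia; do ?case: ifP => ?; lia.
- move=> P; apply: step; try by lia.
    have -> : (n - 1 = n.+1 - 2)%N by lia.
    rewrite ev_X ?ev_Y ?alpha1; try lia.
    by rewrite addrCA addNr addr0.
  have -> : (n - 1 = n.+1 - 2)%N by lia.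
  rewrite ev_X ?alpha1; try lia.
  by rewrite !ipE !ip_ec //=; lia.
move=> i P hi; apply: step; try by lia.
  by rewrite !ev_Y ?alphaS /=; try lia; rewrite addrCA subrr addr0.
rewrite ev_Y ?alphaS /=; try lia.
by rewrite !ipE !ip_ec; try lia; do ?case: ifP => ?; lia.
Qed.

Lemma ip_ecs a b : (1 <= a <= n.+1)%N -> (1 <= b <= n.+1)%N ->
  ip (ec a) (ec b) = (nat_of_bool (a == b))%:R.
Proof. by move=> ha hb; rewrite ip_ec //; case: eqP. Qed.

Ltac ecsimp := rewrite ?ipE ?opprK !ip_ecs; try lia;
  repeat match goal with |- context [nat_of_bool (?a == ?b)] =>
    (have -> : (a == b) = true by lia) || (have -> : (a == b) = false by lia) end; try by [].

Lemma good_first : good (clE n.+1) (ec n.+1 + ev 1) (ev 1).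
Proof.
have -> : ec n.+1 + ev 1 = alpha n.+1 by rewrite (ev_first hn) alphaS //; lia.
exists (clc n.+1); first by apply: prim_E.
rewrite /clc (ev_first hn) alphaS; last by lia.
rewrite /= (_ : ip _ _ == 1); last by ecsimp.
by rewrite (_ : ip _ _ == 1) //; ecsimp.
Qed.

Lemma good_xbar : good (xbar clcomm n clE) (ec n.+1 + (ev 1 + deltaL n)) (ev 1 + deltaL n).
Proof.
have [c hc cP] : good (row clcomm n clE (clE n.+1) n.*2.-1)
    (ec n.+1 + (ev n.*2.-1 + deltaL n *~ 0)) (ev n.*2.-1 + deltaL n *~ 0).
  by apply: good_rows; rewrite ?mulr0z ?addr0; [exact: good_first|lia].
have e1 : ev n.*2.-1 = ec n.-1.
  by have -> : n.*2.-1 = (n + n.-1)%N; [|apply: ev_Y]; lia.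
rewrite mulr0z addr0 e1 in hc cP.
have E2 : row clcomm n clE (clE n.+1) 2 = clcomm (clE n.+1) (clE n).
  have -> : (2 = n.+1 - n.-1)%N by lia.
  rewrite row_stepX; last by lia.
  have -> : (n - n.-1 = 1)%N by lia.
  by rewrite row_first; [congr (clcomm _ (clE _))|]; lia.
have h2 := prim_comm (prim_E (leqnn n.+1)) (prim_E (leqnSn n)).
have hR := prim_comm h2 (prim_E (leq0n n.+1)).
have hX := prim_comm hc hR.
rewrite (xbarE hn) E2 (ev_first hn).
eexists.
  have -> : ec n.+1 + (- ec n + deltaL n) = ec n.+1 + ec n.-1 + (alpha n.+1 + alpha n + alpha 0).
    rewrite alpha0 !alphaS; try lia.
    by rewrite /=; apply/rowP => j; rewrite !mxE; ring.
  exact: hX.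
(* In each nested commutator a single order contributes, along the labels -e_n + delta, e_{n+1},
   e_n, e_{n-1}, -e_{n+1}; the opposite order has coefficient 0. *)
set u := - ec n + deltaL n; rewrite /=.
have -> : c u = 0.
  apply/eqP; apply: contraT => /(prim_supp hc) /andP[_]; rewrite /u; ecsimp.
have -> : u - (alpha n.+1 + alpha n + alpha 0) = ec n.-1.
  rewrite /u alpha0 !alphaS; try lia.
  by rewrite /=; apply/rowP => j; rewrite !mxE; ring.
rewrite mul0r sub0r oppr_eq0 mulf_neq0 //.
set c2 := fun l : lat => clc n.+1 l * clc n (l - alpha n.+1) - clc n l * clc n.+1 (l - alpha n).
have h2' : prim (clcomm (clE n.+1) (clE n)) (alpha n.+1 + alpha n) c2 by exact: h2.
rewrite -/(c2 u) -/(c2 (u - alpha 0)).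
have -> : c2 u = 0.
  apply/eqP; apply: contraT => /(prim_supp h2') /andP[_].
  rewrite /u !alphaS; try lia.
  rewrite /=; ecsimp.
rewrite mul0r sub0r oppr_eq0 mulf_neq0 //.
  rewrite /clc /u alpha0 (_ : ip _ _ == 1); last by ecsimp.
  by rewrite (_ : ip _ _ == 1) //; ecsimp.
have -> : u - alpha 0 = ec n.+1 by rewrite /u alpha0; apply/rowP => j; rewrite !mxE; ring.
rewrite /c2 /clc !alphaS; try lia.
rewrite /=.
have -> : ip (ec n.+1) (ec n - ec n.-1) == 1 = false by ecsimp.
have -> : ip (ec n.+1) (ec n.+1 - ec n) == 1 by ecsimp.
have -> : ec n.+1 - (ec n.+1 - ec n) = ec n by rewrite opprB addrC subrK.
have -> : ip (ec n.+1) (ec n.+1) == 1 by ecsimp.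
have -> : ip (ec n) (ec n) == 1 by ecsimp.
have -> : ip (ec n) (ec n - ec n.-1) == 1 by ecsimp.
by rewrite andbF mul0r.
Qed.
End Classical.

(** * Linear independence of the sorted monomials *)

Section Matching.
Variable T : eqType.

Fixpoint dels (b : T) (s : seq T) : seq (seq T) :=
  if s is a :: s' then (if a == b then [:: s'] else [::]) ++ map (cons a) (dels b s')
  else [::].

Lemma dels_perm b s r : r \in dels b s -> perm_eq s (b :: r).
Proof.
elim: s r => [|a s IHs] r //=; rewrite mem_cat => /orP[|/mapP[r' /IHs h ->]].
  by case: eqP => // ->; rewrite inE => /eqP ->.
rewrite -(perm_cons a) in h; apply: (perm_trans h).
by apply/permP => p /=; lia.
Qed.

Lemma dels_mem b s : b \in s -> dels b s != [::].
Proof.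
elim: s => [|a s IHs] //=; rewrite inE eq_sym; case: eqP => //= _ /IHs.
by case: dels.
Qed.

(* The number of bijections matching the letters of [s] with those of [b]. *)
Fixpoint matchings (s b : seq T) : nat :=
  if b is x :: b' then \sum_(r <- dels x s) matchings r b' else s == [::].

Lemma matchings0 s b : ~~ perm_eq s b -> matchings s b = 0%N.
Proof.
elim: b s => [|x b IHb] s /=; first by case: s.
move=> h; rewrite big1_seq // => r /= /dels_perm hr; apply: IHb.
by apply: contra h => h; apply: (perm_trans hr); rewrite perm_cons.
Qed.

Lemma matchings_gt0 s b : perm_eq s b -> (0 < matchings s b)%N.
Proof.
elim: b s => [|x b IHb] s /=; first by move=> /perm_size/size0nil ->.
move=> h; have := dels_mem (s := s) (b := x).
rewrite (perm_mem h) mem_head => /(_ isT).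
case e: (dels x s) => [|r l] // _; rewrite big_cons ltn_addr //.
apply: IHb; have /dels_perm hr : r \in dels x s by rewrite e mem_head.
by rewrite -(perm_cons x) -(permPl hr).
Qed.
End Matching.

Section Words.
Variable n : nat.
Hypothesis hn : (3 <= n)%N.
Local Notation lat := (lat n).
Local Notation ip := (@ip n).
Local Notation ec := (ecoord n).

(** The degree of the root vector of index a minus e_{n+1}, that is, the label which this root
    vector connects with -e_{n+1}. *)
Definition lam (a : nat) : lat :=
  if (a <= n.*2)%N then ev n a else ev n (a - n.*2) + deltaL n.

Definition clroot (a : nat) : clop n :=
  if (a <= n.*2)%N then row (@clcomm n) n (@clE n) (clE n.+1) a
  else row (@clcomm n) n (@clE n) (xbar (@clcomm n) n (@clE n)) (a - n.*2).

Lemma good_clroot a : (1 <= a <= n * 4)%N -> good (clroot a) (ec n.+1 + lam a) (lam a).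
Proof.
move=> ha; rewrite /clroot /lam; case: ifP => h.
  have := @good_rows n hn (clE n.+1) 0; rewrite mulr0z => /(_ _ a); rewrite !addr0.
  by apply; [exact: good_first|lia].
have := @good_rows n hn (xbar (@clcomm n) n (@clE n)) 1; rewrite mulr1z.
by move=> /(_ _ (a - n.*2)%N); apply; [exact: good_xbar|lia].
Qed.

Lemma lam_norm a : (1 <= a <= n * 4)%N -> ip (lam a) (lam a) = 1.
Proof.
move=> ha; rewrite /lam; case: ifP => h; rewrite ?ipE ?addr0 ip_ev ?eqxx //; lia.
Qed.

Lemma lam_last a : (1 <= a <= n * 4)%N -> ip (lam a) (ec n.+1) = 0.
Proof.
move=> ha; rewrite /lam; case: ifP => h; rewrite ?ipE ?addr0 ip_ev_last //; lia.
Qed.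

Lemma lam_inj a b : (1 <= a <= n * 4)%N -> (1 <= b <= n * 4)%N -> lam a = lam b -> a = b.
Proof.
have evP s t : (1 <= s <= n.*2)%N -> (1 <= t <= n.*2)%N ->
    ip (ev n s) (ev n t) = 1 -> s = t.
  by move=> hs ht; rewrite ip_ev //; case: eqP => // _; case: eqP.
have d0 u v : (1 <= u <= n.*2)%N -> (1 <= v <= n.*2)%N -> ev n u <> ev n v + deltaL n.
  move=> hu hv /(congr1 (@coef_alpha0 n)); rewrite (coefD _ _).1.
  by rewrite (coef_ev hn hu).1 (coef_ev hn hv).1 (coef_delta hn).1.
move=> ha hb; rewrite /lam; case: ifP => h1; case: ifP => h2 e.
- by apply: evP; rewrite ?e ?ip_ev ?eqxx //; lia.
- by case: (d0 a (b - n.*2)%N) => //; lia.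
- by case: (d0 b (a - n.*2)%N) => //; lia.
have {}e := addIr _ e; suff: (a - n.*2 = b - n.*2)%N by lia.
by apply: evP; rewrite ?e ?ip_ev ?eqxx //; lia.
Qed.

Definition vac (s : seq lat) : int := (all (pred1 (- ec n.+1)) s)%:R.
Definition clword (s : seq nat) : seq lat -> int := foldr clroot vac s.

Let he : ip (ec n.+1) (ec n.+1) = 1. Proof. by rewrite ip_ec ?eqxx //; lia. Qed.

Lemma prim0 P b c : @prim n P b c -> P (fun _ => 0) = (fun _ => 0).
Proof.
move=> hP; have := prim_lin hP 0 0 (fun _ => 0) (fun _ => 0).
by rewrite (_ : (fun _ => _ + _) = fun _ => 0) => [->|]; apply: funext => s; ring.
Qed.

Lemma primZ P b c x F : @prim n P b c -> P (fun s => x * F s) = (fun s => x * P F s).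
Proof.
move=> hP; have := prim_lin hP x 0 F F.
rewrite (_ : (fun _ => _ + _) = fun s => x * F s) => [->|]; apply: funext => s; ring.
Qed.

Lemma prim_sum P b c x (I : Type) (r : seq I) (G : I -> seq lat -> int) : @prim n P b c ->
  P (fun s => \sum_(i <- r) x * G i s) = (fun s => \sum_(i <- r) x * P (G i) s).
Proof.
move=> hP; elim: r => [|i r IHr].
  rewrite (_ : (fun _ => _) = fun _ => 0); last by apply: funext => s; rewrite big_nil.
  by rewrite (prim0 hP); apply: funext => s; rewrite big_nil.
rewrite (_ : (fun s => _) = fun s => x * G i s + 1 * \sum_(i <- r) x * G i s).
  by rewrite (prim_lin hP) IHr; apply: funext => s; rewrite big_cons mul1r.
by apply: funext => s; rewrite big_cons mul1r.
Qed.

Local Notation valid := (fun a => 1 <= a <= n * 4)%N.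

(* Root vectors annihilate a tensor factor whose e_{n+1}-coordinate is -1: lowering
   it further would leave the representation. *)
Lemma clword_vac s l r : all valid s -> ip l (ec n.+1) = -1 ->
  clword s (l :: r) = (l == - ec n.+1)%:R * clword s r.
Proof.
move=> hs hl; elim: s hs r => [|a s IHs] /=.
  by move=> _ r; rewrite /vac /=; case: (l == _); rewrite ?mul1r ?mul0r.
move=> /andP[ha hs] r; have [c hc _] := good_clroot ha.
rewrite (prim_cons hc); have -> : c l = 0.
  apply/eqP; apply: contraT => /(prim_supp hc) /andP[_ /eqP h].
  have hv : ip (l - (ec n.+1 + lam a)) (ec n.+1) = -2.
    by rewrite !(ipDl, ipNl) he hl lam_last.
  move: (l - _) h hv => v h hv; have := ip_ge0 (v + ec n.+1).
  by rewrite ipDl !ipDr (ipC (ec _) v) h hv he.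
rewrite mul0r add0r -/(clword s) (_ : (fun r => _) = fun r => (l == - ec n.+1)%:R * clword s r).
  by rewrite (primZ _ _ hc).
by apply: funext => r'; apply: IHs.
Qed.

(** Every root vector lowers the e_{n+1}-coordinate of a factor by 1, so exactly one letter acts on
    the factor [lam b], and it must lead to -e_{n+1}; this forces the letter b. The scalar depends
    on b alone, so [clword_perm] can pull it out. *)
Lemma clword_cons b : (1 <= b <= n * 4)%N -> exists2 x : int, x != 0 &
  forall s r, all valid s ->
  clword s (lam b :: r) = \sum_(s' <- dels b s) x * clword s' r.
Proof.
move=> hb; have [c0 hc0 cb] := good_clroot hb; exists (c0 (lam b)) => // s r hs.
have hl := lam_last hb; elim: s hs r => [|a s IHs] /=.
  move=> _ r; rewrite big_nil /vac /=; case: eqP => // e.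
  by move: hl; rewrite e ipNl he.
move=> /andP[ha hs] r.
have [c hc cc] : exists2 c, prim (clroot a) (ec n.+1 + lam a) c & a = b -> c = c0.
  have [->|ab] := eqVneq a b; first by exists c0.
  by have [c hc _] := good_clroot ha; exists c => // e; rewrite e eqxx in ab.
rewrite (prim_cons hc) big_cat big_map -/(clword s) /=.
have -> : (fun r => clword s (lam b :: r)) = fun r => \sum_(s' <- dels b s) c0 (lam b) * clword s' r.
  by apply: funext => r'; apply: IHs.
rewrite (prim_sum _ _ _ hc); congr (_ + _).
rewrite clword_vac //; last by rewrite ipDl ipNl ipDl he !lam_last.
have -> : (lam b - (ec n.+1 + lam a) == - ec n.+1) = (a == b).
  rewrite -subr_eq0 opprK opprD addrCA addrAC addNr add0r subr_eq0.
  by apply/eqP/eqP => [/lam_inj|->//] /(_ hb ha).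
case: eqP => [/cc->|_]; last by rewrite mul0r mulr0 big_nil.
by rewrite big_seq1 mul1r.
Qed.

Lemma clword_perm b : all valid b -> exists2 x : int, x != 0 &
  forall s, all valid s -> clword s (map lam b) = x * (matchings s b)%:R.
Proof.
elim: b => [_|b w IHw /= /andP[hb /IHw [x x0 hx]]].
  exists 1 => // -[|a s] /=; first by rewrite mulr1.
  by move=> /andP[ha _]; have [c hc _] := good_clroot ha; rewrite (prim_nil hc) mulr0.
have [y y0 hy] := clword_cons hb; exists (y * x); first by rewrite mulf_neq0.
move=> s hs; rewrite hy // natr_sum mulr_sumr; apply: eq_big_seq => r /= /dels_perm hr.
rewrite hx ?mulrA //; move: hs; rewrite (perm_all _ hr) /=.
by case/andP.
Qed.
End Words.

(** * Independence for transcendental q *)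

Section Independent.
Variables (k : fieldType) (q : k) (n : nat).
Hypotheses (hq : transcendental q) (q0 : q != 0) (hn : (3 <= n)%N).
Local Notation ip := (@ip n).
Local Notation label := (label n).
Local Notation ec := (ecoord n).
Local Notation spec := (spec q).
Local Notation qc := (@qcomm k q (endo k label)).

Definition opspec (P : endo k label) (P1 : clop n) : Prop :=
  forall f F, (forall s, spec (f s) (F (map val s))) -> forall s, spec (P f s) (P1 F (map val s)).

Lemma opspec_qcomm P Q P1 Q1 : opspec P P1 -> opspec Q Q1 ->
  opspec (qcomm q P Q) (clcomm P1 Q1).
Proof.
move=> hP hQ f F hf s; rewrite /clcomm -[Q1 (P1 F) _]mul1r.
apply: specD; first exact/hP/hQ.
by apply/specN/specM; [apply: spec_qV|apply/hQ/hP].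
Qed.

Lemma opspec_E i : (i <= n.+1)%N -> opspec (tensor_rep q (UE n i)) (clE i).
Proof.
move=> hi f F hf s; rewrite /=; elim: s f F hf => [|l s IHs] f F hf /=; first exact: spec0.
apply: specD; last first.
  rewrite -[clE _ _ _]mul1r; apply: specM; first exact: spec_qz.
  by apply: IHs => r; apply: (hf (l :: r)).
rewrite /clc (valP l) /= -/(pairing l i); case: eqP => h; last first.
  by rewrite !mul0r; apply: spec0.
rewrite !mul1r; have -> : val l - alpha n i = val (shift i l).
  by rewrite val_shift // /refl -/(pairing l i) h.
exact: hf.
Qed.

Lemma opspec_row t : (1 <= t <= n.*2)%N -> forall x x1, opspec x x1 ->
  opspec (row qc n (fun i => tensor_rep q (UE n i)) x t) (row (@clcomm n) n (@clE n) x1 t).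
Proof.
move=> ht x x1 hx; apply: (row_rel (R := opspec)) => //.
  by move=> a b a' b'; apply: opspec_qcomm.
by move=> i hi; apply: opspec_E; lia.
Qed.

Definition qroot (a : nat) : endo k label :=
  let E := fun i => tensor_rep q (UE n i) in
  if (a <= n.*2)%N then row qc n E (E n.+1) a
  else row qc n E (xbar qc n E) (a - n.*2).

Lemma opspec_root a : (1 <= a <= n * 4)%N -> opspec (qroot a) (@clroot n a).
Proof.
move=> ha; rewrite /qroot /clroot; case: ifP => h; apply: opspec_row; try by lia.
  exact: opspec_E.
rewrite !(xbarE hn); apply: opspec_qcomm; first by apply: opspec_row; [lia|apply: opspec_E].
by apply: opspec_qcomm; [apply: opspec_row; [lia|apply: opspec_E]|apply: opspec_E].
Qed.

Definition qvac (s : seq label) : k := (vac (map val s))%:~R.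

Local Notation valid := (fun a => 1 <= a <= n * 4)%N.

Lemma spec_word s : all valid s -> forall r,
  spec ((\prod_(a <- s) qroot a : endo k label) qvac r) (@clword n s (map val r)).
Proof.
elim: s => [_ r|a s IHs /= /andP[ha hs] r]; first by rewrite big_nil; apply: spec_int.
by rewrite big_cons; apply: opspec_root => // r'; apply: IHs.
Qed.

Lemma lam_labels b : all valid b -> exists s : seq label, map val s = map (lam n) b.
Proof.
elim: b => [_|b w IHw /= /andP[hb /IHw [s hs]]]; first by exists [::].
have h : ip (lam n b) (lam n b) == 1 by rewrite lam_norm.
by exists ((exist (fun l => ip l l == 1) _ h : label) :: s); rewrite /= hs.
Qed.

(** Sortedness makes words with the same letters coincide. Thus [matchings] vanishes off the
    diagonal and the matrix at q = 1 is diagonal. *)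
Lemma sorted_free m (w : 'I_m -> seq nat) (c : 'I_m -> k) : injective w ->
  (forall i, all valid (w i) && sorted leq (w i)) ->
  (forall s, \sum_i c i * (\prod_(a <- w i) qroot a : endo k label) qvac s = 0) ->
  forall i, c i = 0.
Proof.
move=> winj hw h0.
have hv i : all valid (w i) by case/andP: (hw i).
have [p hp] : exists p : 'I_m -> seq label, forall i, map val (p i) = map (lam n) (w i).
  by exists (fun i => projT1 (cid (lam_labels (hv i)))) => i; case: cid.
suff /rowP h : \row_i c i = 0 :> 'rV_m by move=> i; have := h i; rewrite !mxE.
apply: (spec_diag_free hq
  (A := \matrix_(i, j) (\prod_(a <- w i) qroot a : endo k label) qvac (p j))
  (B := \matrix_(i, j) @clword n (w i) (map (lam n) (w j)))).
- by move=> i j; rewrite !mxE -hp; apply: spec_word.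
- move=> i j ij; rewrite mxE; have [x _ ->] := clword_perm hn (hv j) => //.
  rewrite matchings0 ?mulr0 //; apply: contra ij => e.
  case/andP: (hw i) => _ si; case/andP: (hw j) => _ sj.
  by apply/eqP/winj; apply: (sorted_eq leq_trans anti_leq).
- move=> i; rewrite mxE; have [x x0 ->] := clword_perm hn (hv i) => //.
  rewrite mulf_neq0 // pnatr_eq0 -lt0n; exact: matchings_gt0.
- by apply/rowP => j; rewrite !mxE -[RHS](h0 (p j)); apply: eq_bigr => i _; rewrite !mxE.
Qed.
End Independent.

(** * Straightening *)

Section Straighten.
Variables (k : fieldType) (V : lmodType k) (M : nat) (p : seq nat -> V).
Local Notation valid := (fun a => 1 <= a <= M)%N.

Definition comb (ok : seq nat -> bool) (x : V) : Prop :=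
  exists c : seq (k * seq nat), all (fun y => ok y.2) c /\ x = \sum_(y <- c) y.1 *: p y.2.

Lemma comb_sum (ok : seq nat -> bool) (I : eqType) (r : seq I) (c : I -> k) (F : I -> V) :
  (forall i, i \in r -> comb ok (F i)) -> comb ok (\sum_(i <- r) c i *: F i).
Proof.
elim: r => [_|i r IHr h]; first by exists [::]; rewrite !big_nil.
have [d [hd hsum]] : comb ok (\sum_(i <- r) c i *: F i).
  by apply: IHr => j hj; apply: h; rewrite inE hj orbT.
have [e [he hF]] := h i (mem_head _ _).
exists (map (fun y => (c i * y.1, y.2)) e ++ d); split.
  by rewrite all_cat all_map hd andbT.
by rewrite big_cons hF hsum big_cat big_map scaler_sumr /=; congr (_ + _); apply: eq_bigr => y _; rewrite scalerA.
Qed.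

Definition descend (t s : nat) (y : k * (nat * nat)) : bool :=
  [&& 1 <= y.2.1 <= M, 1 <= y.2.2 <= M & y.2.1 < t]%N.

Hypothesis step : forall u t s v, all valid u -> (1 <= s <= M)%N -> (1 <= t <= M)%N ->
  all valid v -> (s < t)%N ->
  exists r : seq (k * (nat * nat)), all (descend t s) r /\
    p (u ++ t :: s :: v) = \sum_(y <- r) y.1 *: p (u ++ y.2.1 :: y.2.2 :: v).

(** The word read as a number in base M+1. Rewriting preserves the length and lowers the first digit
    that it changes, whatever happens to the second; this is lexicographic descent as a numerical
    measure. *)
Fixpoint code (w : seq nat) : nat :=
  if w is a :: w' then (a * M.+1 ^ size w' + code w')%N else 0%N.

Lemma code_lt w : all valid w -> (code w < M.+1 ^ size w)%N.
Proof.
elim: w => // a w IHw /= /andP[ha /IHw]; rewrite expnS.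
have : (a * M.+1 ^ size w <= M * M.+1 ^ size w)%N by rewrite leq_mul2r; lia.
lia.
Qed.

Lemma code_step u v a b t s : all valid v -> (b <= M)%N -> (a < t)%N ->
  (code (u ++ a :: b :: v) < code (u ++ t :: s :: v))%N.
Proof.
move=> hv hb hat; elim: u => [|c u IHu] /=; last by rewrite !size_cat /= ltn_add2l.
have := code_lt hv; rewrite expnS; set X := (M.+1 ^ size v)%N => h.
have h1 : (b * X <= M * X)%N by rewrite leq_mul2r hb orbT.
have h2 : (a.+1 * (M.+1 * X) <= t * (M.+1 * X))%N by rewrite leq_mul2r hat orbT.
by move: h1 h2 h; rewrite mulSn [(M.+1 * X)%N]mulSn; set c := (M * X)%N; lia.
Qed.

Lemma unsorted w : ~~ sorted leq w -> exists u t s v, w = u ++ t :: s :: v /\ (s < t)%N.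
Proof.
elim: w => [|a [|b w] IHw] //=; rewrite negb_and -ltnNge.
case/orP => [h|/IHw [u [t [s [v [-> h]]]]]]; first by exists [::], a, b, w.
by exists (a :: u), t, s, v.
Qed.

Lemma straighten w : all valid w -> comb (fun s => all valid s && sorted leq s) (p w).
Proof.
have [m] := ubnP (code w); elim: m w => // m IHm w hm hw.
have [hs|/unsorted [u [t [s [v [e h]]]]]] := boolP (sorted leq w).
  by exists [:: (1, w)]; rewrite /= hw hs big_seq1 scale1r.
move: hw hm; rewrite {}e all_cat /= => /and4P[hu ht hs hv] hm.
have [r [hr ->]] := step hu hs ht hv h.
apply: comb_sum => y hy; have /and3P[ha hb hat] := allP hr y hy.
apply: IHm; last by rewrite all_cat hu /= ha hb.
by rewrite -ltnS; apply: leq_trans hm; rewrite ltnS; apply: code_step => //; case/andP: hb.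
Qed.
End Straighten.

(** * Straightening rules common to both algebras *)

Section Rules.
Variables (k : fieldType) (q : k) (n : nat).

Definition letter (B : Type) (x : nat * nat -> B) (l : nat) : B :=
  if (l <= n.*2)%N then x (1%N, l) else x (2, l - n.*2)%N.

Definition hi (l : nat) : bool := (n.*2 < l)%N.

(* Exponent of 1/q by which the cocycle twist rescales the monomial of a word. *)
Fixpoint twexp (w : seq nat) : nat :=
  if w is l :: s then (hi l * (size s + count hi s) + twexp s)%N else 0%N.

Lemma twexp_cat u v :
  twexp (u ++ v) = (twexp u + twexp v + count hi u * (size v + count hi v))%N.
Proof.
elim: u => [|l u IHu] /=; first by rewrite mul0n addn0 add0n.
by rewrite IHu size_cat count_cat; case: (hi l); lia.
Qed.

(** Besides the descent, both sides have equally many second-row letters, and their twist exponents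
    differ by 1 exactly when the rule carries the factor [th]. This is what lets one rewriting serve
    U, with th = q, and X, with th = 1. *)
Definition rule_ok (t s : nat) (y : k * (nat * nat)) : bool :=
  let: (a, b) := y.2 in
  [&& 1 <= a <= n * 4, 1 <= b <= n * 4, a < t, hi a + hi b == hi t + hi s &
      hi t * (1 + hi s) == (hi t && ~~ hi s) + hi a * (1 + hi b)]%N.

Lemma letter1 B (x : nat * nat -> B) l : (l <= n.*2)%N -> letter x l = x (1%N, l).
Proof. by rewrite /letter => ->. Qed.

Lemma letter2 B (x : nat * nat -> B) l : (1 <= l)%N -> letter x (n.*2 + l) = x (2%N, l).
Proof. by rewrite /letter => hl; rewrite ifF ?addKn //; lia. Qed.

Definition rlet (r l : nat) : nat := if r == 1%N then l else (n.*2 + l)%N.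

Lemma letterR B (x : nat * nat -> B) r l : (1 <= r <= 2)%N -> (1 <= l <= n.*2)%N ->
  letter x (rlet r l) = x (r, l).
Proof.
move=> hr hl; rewrite /rlet; have [->|->] /= : r = 1%N \/ r = 2%N by lia.
  by rewrite letter1 //; lia.
by rewrite letter2 //; lia.
Qed.

Local Notation qh := (qhat q).

Lemma hi_rlet r l : (1 <= r <= 2)%N -> (1 <= l <= n.*2)%N -> hi (rlet r l) = (r == 2%N).
Proof.
move=> hr hl; rewrite /hi /rlet; have [->|->] /= : r = 1%N \/ r = 2%N by lia.
  by lia.
by lia.
Qed.

Lemma rule_same r t s a b c : (1 <= r <= 2)%N -> (1 <= t <= n.*2)%N -> (1 <= s <= n.*2)%N ->
  (1 <= a <= n.*2)%N -> (1 <= b <= n.*2)%N -> (a < t)%N ->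
  rule_ok (rlet r t) (rlet r s) (c, (rlet r a, rlet r b)).
Proof.
move=> hr ht hs ha hb hat; rewrite /rule_ok; cbn [fst snd]; rewrite !hi_rlet //.
rewrite /rlet; have [->|->] /= : r = 1%N \/ r = 2%N by lia.
  by lia.
by lia.
Qed.

Lemma rule_cross t s a b c : (1 <= t <= n.*2)%N -> (1 <= s <= n.*2)%N ->
  (1 <= a <= n.*2)%N -> (1 <= b <= n.*2)%N ->
  rule_ok (rlet 2 t) (rlet 1 s) (c, (rlet 1 a, rlet 2 b)).
Proof.
move=> ht hs ha hb; rewrite /rule_ok; cbn [fst snd].
by rewrite !hi_rlet // /rlet /=; lia.
Qed.

(** A right-hand side uniform in the algebra, so that U and X receive the same coefficients. *)
Definition expr := forall B : algType k, (nat * nat -> B) -> B.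

Definition expands (t s : nat) (Z : expr) : Prop :=
  exists r : seq (k * (nat * nat)), all (rule_ok t s) r /\
  forall B x, Z B x = \sum_(y <- r) y.1 *: (letter x y.2.1 * letter x y.2.2).

Lemma expandsD t s (Y Z : expr) : expands t s Y -> expands t s Z ->
  expands t s (fun B x => Y B x + Z B x).
Proof.
move=> [r [hr hY]] [r' [hr' hZ]]; exists (r ++ r'); split; first by rewrite all_cat hr.
by move=> B x; rewrite big_cat hY hZ.
Qed.

Lemma expandsZ t s c (Y : expr) : expands t s Y -> expands t s (fun B x => c *: Y B x).
Proof.
move=> [r [hr hY]]; exists (map (fun y => (c * y.1, y.2)) r); split; first by rewrite all_map.
by move=> B x; rewrite big_map hY scaler_sumr; apply: eq_bigr => y _; rewrite scalerA.
Qed.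

Lemma expandsN t s (Y : expr) : expands t s Y -> expands t s (fun B x => - Y B x).
Proof.
move=> /(expandsZ (-1)) [r [hr hY]]; exists r; split => // B x.
by rewrite -hY scaleN1r.
Qed.

Lemma expands_sum t s m m' (F : nat -> expr) :
  (forall l, (m <= l < m')%N -> expands t s (F l)) ->
  expands t s (fun B x => \sum_(m <= l < m') F l B x).
Proof.
move=> h; have [e|e] : (m' <= m)%N \/ (m <= m')%N by lia.
  by exists [::]; split => // B x; rewrite big_geq // big_nil.
rewrite -(subnKC e) in h *; elim: (m' - m)%N h => [|d IHd] h.
  by exists [::]; split => // B x; rewrite addn0 big_geq // big_nil.
have [r [hr hY]] : expands t s (fun B x => \sum_(m <= l < m + d) F l B x).
  by apply: IHd => l hl; apply: h; lia.
have [r' [hr' hZ]] := h (m + d)%N ltac:(lia).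
exists (r ++ r'); split; first by rewrite all_cat hr.
by move=> B x; rewrite addnS big_nat_recr ?leq_addr //= big_cat hY hZ.
Qed.

Lemma expands_same r t s a b : (1 <= r <= 2)%N -> (1 <= t <= n.*2)%N -> (1 <= s <= n.*2)%N ->
  (1 <= a <= n.*2)%N -> (1 <= b <= n.*2)%N -> (a < t)%N ->
  expands (rlet r t) (rlet r s) (fun B x => x (r, a) * x (r, b)).
Proof.
move=> hr ht hs ha hb hat; exists [:: (1, (rlet r a, rlet r b))].
split; first by rewrite /= rule_same.
by move=> B x; rewrite big_seq1 scale1r !letterR.
Qed.

Lemma expands_cross t s a b : (1 <= t <= n.*2)%N -> (1 <= s <= n.*2)%N ->
  (1 <= a <= n.*2)%N -> (1 <= b <= n.*2)%N ->
  expands (rlet 2 t) (rlet 1 s) (fun B x => x (1%N, a) * x (2, b)%N).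
Proof.
move=> ht hs ha hb; exists [:: (1, (rlet 1 a, rlet 2 b))].
split; first by rewrite /= rule_cross.
by move=> B x; rewrite big_seq1 scale1r !letterR.
Qed.

Lemma expands_row r t s : (1 <= r <= 2)%N -> (1 <= t <= n.*2)%N -> (1 <= s <= n.*2)%N ->
  (s < t)%N -> exists2 Z : expr, expands (rlet r t) (rlet r s) Z &
  forall (th : k) (B : algType k) (x : nat * nat -> B), relsT th q n x -> x (r, t) * x (r, s) = Z B x.
Proof.
move=> hr ht hs hst; have [e|ne] := eqVneq t (pr n s); last first.
  exists (fun B x => q^-1 *: (x (r, s) * x (r, t))).
    by apply/expandsZ/expands_same.
  by move=> th B x [h _]; apply: h.
exists (fun B x => x (r, s) * x (r, t) + qhat q *:
    \sum_(s.+1 <= l < n.+1) q ^ (l%:Z - s%:Z - 1) *: (x (r, l) * x (r, pr n l))).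
  apply: expandsD; first exact: expands_same.
  apply/expandsZ/expands_sum => l hl; apply/expandsZ/expands_same => //; move: e; rewrite /pr; lia.
by move=> th B x [_ [h _]]; rewrite e in hst *; apply: h.
Qed.

Lemma expands_mixed t s : (1 <= t <= n.*2)%N -> (1 <= s <= n.*2)%N ->
  exists2 Z : expr, expands (rlet 2 t) (rlet 1 s) Z &
  forall (th : k) (B : algType k) (x : nat * nat -> B), relsT th q n x ->
    th *: (x (2, t)%N * x (1, s)%N) = Z B x.
Proof.
move=> ht hs; have [e|ne] := eqVneq t (pr n s); last first.
  have [|[h|h]] : t = s \/ (t < s)%N \/ (s < t)%N by lia.
  - move=> ->; exists (fun B x => q^-1 *: (x (1, s)%N * x (2, s)%N)).
      exact/expandsZ/expands_cross.
    by move=> th B x [_ [_ [h _]]]; apply: h.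
  - exists (fun B x => x (1, s)%N * x (2, t)%N); first exact: expands_cross.
    by move=> th B x [_ [_ [_ [h' _]]]]; apply: h' => //; move: ne; rewrite /pr; lia.
  exists (fun B x => x (1, s)%N * x (2, t)%N - qhat q *: (x (1, t)%N * x (2, s)%N)).
    apply: expandsD; first exact: expands_cross.
    exact/expandsN/expandsZ/expands_cross.
  by move=> th B x [_ [_ [_ [_ [h' _]]]]]; apply: h'.
have [h|h] : (t < s)%N \/ (s < t)%N by move: e; rewrite /pr; lia.
  have {}e : s = pr n t by move: e; rewrite /pr; lia.
  exists (fun B x => q *: (x (1, pr n t)%N * x (2, t)%N) +
      qhat q *: \sum_(1 <= l < t) q ^ (t%:Z - l%:Z) *: (x (1, pr n l)%N * x (2, l)%N)).
    apply: expandsD; first by apply/expandsZ/expands_cross; rewrite // -e.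
    by apply/expandsZ/expands_sum => l hl; apply/expandsZ/expands_cross; rewrite // /pr; lia.
  by move=> th B x [_ [_ [_ [_ [_ [h' _]]]]]]; rewrite e in h *; apply: h'.
exists (fun B x => q *: (x (1, s)%N * x (2, pr n s)%N) +
    qhat q *: \sum_(s.+1 <= l < n.+1) q ^ (l%:Z - s%:Z) *: (x (1, l)%N * x (2, pr n l)%N) +
    (qhat q * q^-1) *: \sum_(1 <= l < n.+1) q ^ ((pr n l)%:Z - s%:Z) *:
      (x (1, pr n l)%N * x (2, l)%N) -
    qhat q *: (x (1, pr n s)%N * x (2, s)%N)).
  apply: expandsD; last by apply/expandsN/expandsZ/expands_cross; rewrite // -e.
  apply: expandsD.
    apply: expandsD; first by apply/expandsZ/expands_cross; rewrite // -e.
    by apply/expandsZ/expands_sum => l hl; apply/expandsZ/expands_cross; rewrite // /pr; lia.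
  by apply/expandsZ/expands_sum => l hl; apply/expandsZ/expands_cross; rewrite // /pr; lia.
by move=> th B x [_ [_ [_ [_ [_ [_ h']]]]]]; rewrite e in h *; apply: h'.
Qed.

(** The order of quantifiers is the point: the list is fixed before [th], the algebra and the
    generators. *)
Lemma straightening_rule t s : (1 <= t <= n * 4)%N -> (1 <= s <= n * 4)%N -> (s < t)%N ->
  exists r : seq (k * (nat * nat)), all (rule_ok t s) r /\
  forall (th : k) (B : algType k) (x : nat * nat -> B), relsT th q n x ->
    (if hi t && ~~ hi s then th else 1) *: (letter x t * letter x s) =
    \sum_(y <- r) y.1 *: (letter x y.2.1 * letter x y.2.2).
Proof.
move=> ht hs hst.
have [ts|ts] : (t <= n.*2)%N \/ (n.*2 < t)%N by lia.
  have [||||Z [r [hr hZ]] hx] := @expands_row 1 t s; try by lia.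
  exists r; split => // th B x hX; rewrite /hi (leq_gtF ts) /= scale1r -hZ -(hx th) //.
  by rewrite !letter1 //; lia.
have [t' tE] : exists t', t = rlet 2 t' by exists (t - n.*2)%N; rewrite /rlet /=; lia.
have [ss|ss] : (s <= n.*2)%N \/ (n.*2 < s)%N by lia.
  have [||Z [r [hr hZ]] hx] := @expands_mixed t' s; try by move: tE; rewrite /rlet /=; lia.
  exists r; split; first by rewrite tE.
  move=> th B x hX; rewrite /hi ts (leq_gtF ss) /= -hZ -(hx th) // tE.
  by rewrite letterR ?letter1 //; move: tE; rewrite /rlet /=; lia.
have [s' sE] : exists s', s = rlet 2 s' by exists (s - n.*2)%N; rewrite /rlet /=; lia.
have [||||Z [r [hr hZ]] hx] := @expands_row 2 t' s'; try by move: tE sE; rewrite /rlet /=; lia.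
exists r; split; first by rewrite tE sE.
move=> th B x hX; rewrite /hi ts ss /= scale1r -hZ -(hx th) // tE sE.
by rewrite !letterR //; move: tE sE; rewrite /rlet /=; lia.
Qed.
End Rules.

(** * Untwisting *)

Section Transfer.
Variables (k : fieldType) (th q : k) (n : nat) (A B : algType k) (R : A -> B -> Prop).
Hypotheses (R0 : R 0 0) (RD : forall a b a' b', R a a' -> R b b' -> R (a + b) (a' + b'))
  (RZ : forall c a a', R a a' -> R (c *: a) (c *: a'))
  (RM : forall a b a' b', R a a' -> R b b' -> R (a * b) (a' * b'))
  (Rfun : forall a b b', R a b -> R a b' -> b = b').
Variables (x : nat * nat -> A) (y : nat * nat -> B).
Hypothesis Rxy : forall p, validX n p -> R (x p) (y p).

Lemma transfer_eq a b a' b' : a = b -> R a a' -> R b b' -> a' = b'.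
Proof. by move=> -> h h'; apply: Rfun h h'. Qed.

Lemma transfer_opp a a' : R a a' -> R (- a) (- a').
Proof. by move=> h; rewrite -!scaleN1r; apply: RZ. Qed.

Lemma transfer_sum m m' (F : nat -> A) G : (forall l, (m <= l < m')%N -> R (F l) (G l)) ->
  R (\sum_(m <= l < m') F l) (\sum_(m <= l < m') G l).
Proof. by move=> h; rewrite !big_nat; apply: big_rec2 => // l a b hl; apply: RD; apply: h. Qed.

Ltac transfer := repeat first
  [ apply: transfer_sum => ? ? | apply: RD | apply: RZ | apply: transfer_opp | apply: RM ];
  try (apply: Rxy; rewrite /validX /pr /=; unfold pr in *; lia).

(** [R] plays the graph of a partial homomorphism. It is used forwards for a homomorphism and
    backwards for the inclusion of a subalgebra, as [a = val b]. *)
Lemma relsT_transfer : relsT th q n x -> relsT th q n y.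
Proof.
move=> [h1 [h2 [h3 [h4 [h5 [h6 h7]]]]]].
split; [|split; [|split; [|split; [|split; [|split]]]]].
- by move=> r s t hr hs ht h h'; apply: (transfer_eq (h1 r s t hr hs ht h h')); transfer.
- by move=> r s hr hs h; apply: (transfer_eq (h2 r s hr hs h)); transfer.
- by move=> s hs; apply: (transfer_eq (h3 s hs)); transfer.
- by move=> s t hs ht h h'; apply: (transfer_eq (h4 s t hs ht h h')); transfer.
- by move=> s t hs ht h h'; apply: (transfer_eq (h5 s t hs ht h h')); transfer.
- by move=> s hs h; apply: (transfer_eq (h6 s hs h)); transfer.
by move=> s hs h; apply: (transfer_eq (h7 s hs h)); transfer.
Qed.
End Transfer.

Section Twisting.
Variables (k : fieldType) (th q : k) (n : nat) (A : algType k) (w : nat * nat -> A) (G : A).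
Hypothesis Gw : forall p, validX n p -> G * w p = th *: (w p * G).

Definition twist (p : nat * nat) : A := if p.1 == 1%N then w p else w p * G.

Lemma twist21 s t : (1 <= s <= n.*2)%N -> (1 <= t <= n.*2)%N ->
  twist (2, s)%N * twist (1, t)%N = th *: (w (2, s)%N * w (1, t)%N) * G.
Proof. by move=> hs ht; rewrite /twist /= -mulrA Gw // -scalerAr -scalerAl mulrA. Qed.

Lemma twist12 s t : twist (1, s)%N * twist (2, t)%N = (w (1, s)%N * w (2, t)%N) * G.
Proof. by rewrite /twist /= mulrA. Qed.

Lemma twist22 s t : (1 <= s <= n.*2)%N -> (1 <= t <= n.*2)%N ->
  twist (2, s)%N * twist (2, t)%N = (w (2, s)%N * w (2, t)%N) * (th *: (G * G)).
Proof.
by move=> hs ht; rewrite /twist /= -mulrA (mulrA G) Gw // -!(scalerAl, scalerAr) !mulrA.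
Qed.

(** Moving G to the right turns w_2 w_1 into th w_2 w_1 G, whereas w_1 w_2 gains only G and every
    w_2 w_2 gains th G^2. The factor of the twisted relations is thereby absorbed. *)
Lemma relsT_twist : relsT th q n w -> relsT 1 q n twist.
Proof.
move=> [h1 [h2 [h3 [h4 [h5 [h6 h7]]]]]].
have rP r : (1 <= r <= 2)%N -> r = 1%N \/ r = 2%N by lia.
have sumG (m m' : nat) (c : nat -> k) (F : nat -> A) (E : A) :
    (\sum_(m <= l < m') c l *: F l) * E = \sum_(m <= l < m') c l *: (F l * E).
  by rewrite mulr_suml; apply: eq_bigr => l _; rewrite scalerAl.
split; [|split; [|split; [|split; [|split; [|split]]]]].
- move=> r s t /rP[->|->] hs ht h h'; first by apply: h1.
  by rewrite !twist22 // h1 // -scalerAl.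
- move=> r s /rP[->|->] hs h; first by apply: h2.
  have hp : (1 <= pr n s <= n.*2)%N by rewrite /pr; lia.
  rewrite !twist22 // h2 // mulrDl -scalerAl sumG; congr (_ + _ *: _).
  by apply: eq_big_nat => l hl; rewrite twist22 //; rewrite /pr; lia.
- by move=> s hs; rewrite scale1r twist21 // twist12 h3 // -scalerAl.
- by move=> s t hs ht h h'; rewrite scale1r twist21 // twist12 h4.
- by move=> s t hs ht h h'; rewrite scale1r twist21 // !twist12 h5 // mulrBl -scalerAl.
- move=> s hs h; rewrite scale1r twist21 //; last by rewrite /pr; lia.
  rewrite h6 // twist12 mulrDl -!scalerAl sumG; congr (_ + _ *: _).
  by apply: eq_bigr => l _; rewrite twist12.
move=> s hs h; rewrite scale1r twist21 //; last by rewrite /pr; lia.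
rewrite h7 // !twist12 mulrBl !mulrDl -!scalerAl !sumG.
congr (_ + _ *: _ + _ *: _ - _); by apply: eq_bigr => l _; rewrite twist12.
Qed.
End Twisting.

(** * The grading operator on tensor powers *)

Section Grade.
Variables (k : fieldType) (q : k) (n : nat).
Hypotheses (q0 : q != 0) (hn : (3 <= n)%N).
Local Notation ip := (@ip n).
Local Notation label := (label n).
Local Notation ec := (ecoord n).
Local Notation qc := (@qcomm k q (endo k label)).
Local Notation E := (fun i => tensor_rep q (UE n i)).

Definition gradeof (s : seq label) : int := \sum_(l <- s) (ip (ec n.+1) (val l) + 1).

Lemma grade_subproof a b (f g : seq label -> k) :
  (fun s => q ^ gradeof s * (a * f s + b * g s)) =
  (fun s => a * (q ^ gradeof s * f s) + b * (q ^ gradeof s * g s)).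
Proof. by apply: funext => s; move: (q ^ _) => c; ring. Qed.

(* K_{e_{n+1}}, rescaled by q on every tensor factor so as to fix [qvac]. *)
Definition grade : endo k label := Endo grade_subproof.

Lemma gradeE i : (i <= n.+1)%N ->
  grade * E i = q ^ (ip (ec n.+1) (alpha n i)) *: (E i * grade).
Proof.
move=> hi; apply: endo_ext => f s; rewrite /=; apply: tens_weight => // l hl.
by rewrite val_shift // /refl -/(pairing l i) hl ipDr ipNr mulr1z addrAC.
Qed.

Lemma grade_comm a b c d : grade * a = c *: (a * grade) -> grade * b = d *: (b * grade) ->
  grade * qc a b = (c * d) *: (qc a b * grade).
Proof.
move=> ha hb; rewrite /qcomm mulrBr mulrBl -!scalerAr -!scalerAl mulrA ha -scalerAl -mulrA hb.
rewrite [grade * (b * a)]mulrA hb -scalerAl -mulrA ha -!(scalerAr, scalerAl) !scalerA !scalerBr.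
by rewrite !mulrA !scalerA; congr (_ *: _ - _ *: _); ring.
Qed.

Lemma grade_row x t : (1 <= t <= n.*2)%N -> grade * x = q *: (x * grade) ->
  grade * row qc n E x t = q *: (row qc n E x t * grade).
Proof.
move=> ht hx.
have h0 i : (1 <= i <= n)%N -> grade * E i = 1 *: (E i * grade).
  by move=> hi; rewrite gradeE ?(ipC (ec _)) ?ip_last_alpha //; lia.
have st a i : (1 <= i <= n)%N -> grade * a = q *: (a * grade) ->
    grade * qc a (E i) = q *: (qc a (E i) * grade).
  by move=> hi ha; rewrite (grade_comm ha (h0 i hi)) mulr1.
by apply: (row_ind (P := fun _ a => grade * a = q *: (a * grade))) => // [i a hi|a|i a hi];
  apply: st; lia.
Qed.

Lemma grade_last : grade * E n.+1 = q *: (E n.+1 * grade).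
Proof.
rewrite gradeE // (_ : ip _ _ = 1) // alphaS; last by lia.
by rewrite !ipE /= !ip_ecs; lia.
Qed.

Lemma grade_zero : grade * E 0%N = q^-1 *: (E 0%N * grade).
Proof.
by rewrite gradeE // (_ : ip _ _ = -1) // alpha0 !ipE !ip_ecs; lia.
Qed.

(** All root vectors scale alike, because each degree is e_{n+1} plus a vector orthogonal to
    e_{n+1}. *)
Lemma grade_root a : (1 <= a <= n * 4)%N ->
  grade * qroot q n a = q *: (qroot q n a * grade).
Proof.
move=> ha; rewrite /qroot; case: ifP => h; apply: grade_row; try by lia.
  exact: grade_last.
rewrite (xbarE hn).
have r t : (1 <= t <= n.*2)%N -> grade * row qc n E (E n.+1) t = q *: (row qc n E (E n.+1) t * grade).
  by move=> ht; apply/grade_row/grade_last.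
have h2 := grade_comm (r 2 ltac:(lia)) grade_zero.
rewrite (grade_comm (r n.*2.-1 ltac:(lia)) h2).
by congr (_ *: _); field.
Qed.

Lemma grade_vac : grade (@qvac k n) = @qvac k n.
Proof.
apply: funext => s; rewrite /= /qvac /vac.
case: (boolP (all _ _)) => [h|_]; last by rewrite mulr0.
rewrite (_ : gradeof s = 0) ?mul1r //.
rewrite /gradeof big1_seq // => l /= hl.
have /allP/(_ (val l)) := h; rewrite map_f // => /(_ isT) /eqP ->.
by rewrite ipNr ip_ec ?eqxx ?addNr //; lia.
Qed.
End Grade.

(** * Spans of monomials *)

Section Span.
Variables (k : fieldType) (A : algType k) (valid : pred nat) (g : nat -> A).

Definition word_span (x : A) : Prop := comb (monom g) (all valid) x.

Lemma word_span_gen l : valid l -> word_span (g l).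
Proof.
move=> hl; exists [:: (1, [:: l])]; rewrite /= hl big_seq1 scale1r.
by rewrite /monom big_seq1.
Qed.

Definition span_pred : {pred A} := fun x => `[< word_span x >].

Lemma span_closed : subalg_closed span_pred.
Proof.
have mon w : all valid w -> word_span (monom g w).
  by move=> hw; exists [:: (1, w)]; rewrite /= hw big_seq1 scale1r.
split.
- by apply/asboolP; have := mon [::] isT; rewrite /monom big_nil.
- move=> a x y /asboolP [c [hc ->]] /asboolP hy; apply/asboolP.
  (* Summing over two booleans, with coefficients a and 1, presents a x + y as one combination. *)
  have := comb_sum (p := monom g) (ok := all valid) (r := [:: true; false])
    (fun b : bool => if b then a else 1) (F := fun b => if b then \sum_(y <- c) y.1 *: monom g y.2 else y).
  rewrite big_cons big_seq1 scale1r; apply=> -[] _ //.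
  by exists c.
move=> x y /asboolP [c [hc ->]] /asboolP [d [hd ->]]; apply/asboolP.
rewrite mulr_suml.
have -> : \sum_(i <- c) i.1 *: monom g i.2 * \sum_(j <- d) j.1 *: monom g j.2 =
    \sum_(i <- c) i.1 *: \sum_(j <- d) j.1 *: monom g (i.2 ++ j.2).
  apply: eq_bigr => i _; rewrite -scalerAl mulr_sumr; congr (_ *: _).
  by apply: eq_bigr => j _; rewrite -scalerAr /monom big_cat.
apply: comb_sum => i hi; apply: comb_sum => j hj; apply: mon.
by rewrite all_cat (allP hc i hi) (allP hd j hj).
Qed.

HB.instance Definition _ := GRing.isSubalgClosed.Build k A span_pred span_closed.

Definition span_type : Type := {x : A | span_pred x}.
HB.instance Definition _ := SubChoice.on span_type.
HB.instance Definition _ := [SubChoice_isSubAlgebra of span_type by <:].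
End Span.
Arguments span_type {k A} valid g.

Section Generated.
Variables (k : fieldType) (q : k) (n : nat) (X : algType k) (gX : nat * nat -> X).
Hypotheses (HX : presented (validX n) (@relsX k q n) gX).
Local Notation valid := (fun a => 1 <= a <= n * 4)%N.
Local Notation S := (span_type valid (letter n gX) : algType k).

(** The subalgebra spanned by monomials satisfies the relations, so X maps to it. Followed by the
    inclusion this fixes the generators, hence is the identity by uniqueness. *)
Lemma generated (z : X) : word_span valid (letter n gX) z.
Proof.
have gen p : validX n p -> span_pred valid (letter n gX) (gX p).
  move=> [h1 h2]; apply/asboolP; case: p h1 h2 => r l /= h1 h2.
  by rewrite -(letterR gX h1 h2); apply: word_span_gen; rewrite /rlet; case: eqP; lia.
(* The value 0 at invalid indices is arbitrary, as the relations and the presentation only concern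
   valid ones. *)
pose h p : S := if pselect (validX n p) is left v then exist _ (gX p) (gen p v) else 0.
have hE p : validX n p -> val (h p) = gX p by rewrite /h; case: pselect.
have [HXr HXu] := HX.
have hrel : relsX q n h.
  apply/relsT1; refine (@relsT_transfer k 1 q n X S (fun a b => a = val b) _ _ _ _ _ gX h _ _).
  - by rewrite rmorph0.
  - by move=> a b a' b' -> ->; rewrite rmorphD.
  - by move=> c a a' ->; rewrite linearZ.
  - by move=> a b a' b' -> ->; rewrite rmorphM.
  - by move=> a b b' -> /val_inj.
  - by move=> p hp; rewrite hE.
  exact/relsT1.
have [f [[fD [fZ [fM f1]]] [fg _]]] := HXu S h hrel.
have [f0 [_ [_ uniq]]] := HXu X gX HXr.
have e : val (f z) = z.
  transitivity (f0 z); last by symmetry; apply: (uniq id).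
  apply: (uniq (val \o f)); last by move=> p hp /=; rewrite fg // hE.
  split; [|split; [|split]]; rewrite /comp.
  - by move=> x y; rewrite fD raddfD.
  - by move=> a x; rewrite fZ linearZ.
  - by move=> x y; rewrite fM rmorphM.
  by rewrite f1 rmorph1.
by rewrite -e; apply/asboolP; apply: valP (f z).
Qed.
End Generated.

Section Collect.
Variables (k : fieldType).

(** A combination may list a word several times, whereas independence concerns distinct words; their
    coefficients are added up here. *)
Lemma collect (c : seq (k * seq nat)) (V : lmodType k) (F : seq nat -> V) :
  let ws := undup (map snd c) in
  \sum_(y <- c) y.1 *: F y.2 =
  \sum_(i < size ws) (\sum_(y <- c | y.2 == nth [::] ws i) y.1) *: F (nth [::] ws i).
Proof.
move=> ws; transitivity (\sum_(w <- ws) (\sum_(y <- c | y.2 == w) y.1) *: F w); last first.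
  by rewrite (big_nth [::]) big_mkord.
under [RHS]eq_bigr => w _ do rewrite scaler_suml.
rewrite (exchange_big_dep xpredT) //=; apply: eq_big_seq => y hy.
rewrite (big_rem y.2) /=; last by rewrite mem_undup map_f.
rewrite eqxx big1_seq ?addr0 // => w /andP[/eqP <-].
by rewrite mem_rem_uniqF // undup_uniq.
Qed.
End Collect.

Section Free.
Variables (k : fieldType) (q : k) (n : nat).
Hypotheses (hq : transcendental q) (q0 : q != 0) (hn : (3 <= n)%N).
Local Notation valid := (fun a => 1 <= a <= n * 4)%N.
Local Notation E := (endo k (label n)).

(** A vanishing combination of sorted monomials has zero coefficients once equal words are
    collected, so the same combination of any other family F vanishes too. This is the form needed
    for pairs, where F is the other component. *)
Lemma free_of_rep (A : lmodType k) (rho : A -> E) (m : seq nat -> A) (V : lmodType k)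
  (F : seq nat -> V) (c : seq (k * seq nat)) :
  (forall x y, rho (x + y) = rho x + rho y) -> (forall a x, rho (a *: x) = a *: rho x) ->
  (forall w, all valid w -> exists2 a : k, a != 0 & forall s,
     rho (m w) (@qvac k n) s = a * (\prod_(l <- w) qroot q n l : E) (@qvac k n) s) ->
  all (fun y => all valid y.2 && sorted leq y.2) c ->
  \sum_(y <- c) y.1 *: m y.2 = 0 -> \sum_(y <- c) y.1 *: F y.2 = 0.
Proof.
move=> rD rZ hrho hc; rewrite !collect /=; set ws := undup _ => h.
pose C (i : 'I_(size ws)) := \sum_(y <- c | y.2 == nth [::] ws i) y.1.
have hw (i : 'I_(size ws)) : all valid (nth [::] ws i) && sorted leq (nth [::] ws i).
  have : nth [::] ws i \in ws by rewrite mem_nth.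
  by rewrite mem_undup => /mapP [y hy ->]; have := allP hc y hy.
have [a a0 ha] : exists2 a : 'I_(size ws) -> k, (forall i, a i != 0) & forall (i : 'I_(size ws)) s,
    rho (m (nth [::] ws i)) (@qvac k n) s =
    a i * (\prod_(l <- nth [::] ws i) qroot q n l : E) (@qvac k n) s.
  have hi (i : 'I_(size ws)) : exists x : k, x != 0 /\ forall s, rho (m (nth [::] ws i)) (@qvac k n) s =
     x * (\prod_(l <- nth [::] ws i) qroot q n l : E) (@qvac k n) s.
    by case/andP: (hw i) => /hrho [x x0 hx] _; exists x.
  by exists (fun i => projT1 (cid (hi i))) => i; case: cid => x [].
have r0 : rho 0 = 0 by rewrite -(scale0r (0 : A)) rZ scale0r.
have free := @sorted_free _ _ _ hq q0 hn _ (fun i : 'I_(size ws) => nth [::] ws i)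
  (fun i => C i * a i).
apply: big1 => i _; suff /eqP : C i * a i = 0.
  by rewrite mulf_eq0 (negPf (a0 i)) orbF -[X in X *: _]/(C i) => /eqP ->; rewrite scale0r.
apply: free => // [j j' /eqP|s].
  by rewrite nth_uniq ?undup_uniq // => /eqP /val_inj.
have endo_sum (I : Type) (r : seq I) (G : I -> A) : rho (\sum_(i <- r) G i) (@qvac k n) s =
    \sum_(i <- r) rho (G i) (@qvac k n) s.
  elim: r => [|x r IHr]; first by rewrite !big_nil r0.
  by rewrite !big_cons rD -IHr.
transitivity (rho 0 (@qvac k n) s); last by rewrite r0.
rewrite -[X in rho X]h endo_sum; apply: eq_bigr => j _; rewrite rZ /= ha mulrA.
by [].
Qed.
End Free.

(** * The isomorphism *)

Section Pairs.
Variables (k : fieldType) (q : k) (n : nat) (U X : algType k).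
Variables (v : nat * nat -> U) (x : nat * nat -> X).
Hypotheses (q0 : q != 0) (hv : relsT q q n v) (hx : relsX q n x).
Local Notation valid := (fun a => 1 <= a <= n * 4)%N.

Lemma monom_mid (A : algType k) (g : nat -> A) u a b w :
  monom g (u ++ a :: b :: w) = monom g u * (g a * g b) * monom g w.
Proof. by rewrite /monom big_cat !big_cons /= !mulrA. Qed.

(* A word read in U and, with the factor coming from the cocycle twist, in X. *)
Definition wpair (w : seq nat) : U * X :=
  (monom (letter n v) w, q ^- twexp n w *: monom (letter n x) w).

Lemma twexp_step u a b t s w : rule_ok n t s ((1 : k), (a, b)) ->
  twexp n (u ++ t :: s :: w) = ((hi n t && ~~ hi n s) + twexp n (u ++ a :: b :: w))%N.
Proof.
move=> /and5P[_ _ _ /eqP h1 /eqP h2]; rewrite !twexp_cat /=.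
have -> : ((size w).+2 + (hi n t + (hi n s + count (hi n) w)) =
  (size w).+2 + (hi n a + (hi n b + count (hi n) w)))%N by lia.
suff : (hi n t * ((size w).+1 + (hi n s + count (hi n) w)) + hi n s * (size w + count (hi n) w) =
  (hi n t && ~~ hi n s) + (hi n a * ((size w).+1 + (hi n b + count (hi n) w)) +
   hi n b * (size w + count (hi n) w)))%N by lia.
move: h1 h2; case: (hi n t); case: (hi n s); case: (hi n a); case: (hi n b) => //=; lia.
Qed.

Lemma wpair_step u t s w : all valid u -> (1 <= s <= n * 4)%N -> (1 <= t <= n * 4)%N ->
  all valid w -> (s < t)%N ->
  exists r : seq (k * (nat * nat)), all (descend (n * 4) t s) r /\
    wpair (u ++ t :: s :: w) = \sum_(y <- r) y.1 *: wpair (u ++ y.2.1 :: y.2.2 :: w).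
Proof.
move=> hu hs ht hw hst; have [r [hr hrel]] := straightening_rule q ht hs hst.
pose c : nat := hi n t && ~~ hi n s.
have cE : (if hi n t && ~~ hi n s then q else 1) = q ^+ c.
  by rewrite /c; case: (_ && _); rewrite ?expr1.
(* The factor q^{-c} has two origins: in U it comes from the relations with th = q, in X from the
   change of [twexp]. *)
exists (map (fun y => (q ^- c * y.1, y.2)) r); split.
  rewrite all_map; apply/allP => -[d [a b]] /(allP hr) /and5P[ha hb hat _ _].
  by rewrite /descend /= ha hb.
rewrite big_map; apply: injective_projections.
  rewrite (big_morph (fun z : U * X => z.1) (id1 := 0) (op1 := +%R)) //= monom_mid.
  have -> : letter n v t * letter n v s =
      q ^- c *: \sum_(y <- r) y.1 *: (letter n v y.2.1 * letter n v y.2.2).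
    by rewrite -(hrel _ _ _ hv) cE scalerA mulVf ?scale1r // expf_neq0.
  rewrite -scalerAr -scalerAl mulr_sumr mulr_suml scaler_sumr; apply: eq_bigr => y _.
  by rewrite -scalerAr -scalerAl scalerA monom_mid.
rewrite (big_morph (fun z : U * X => z.2) (id1 := 0) (op1 := +%R)) //= monom_mid.
have -> : letter n x t * letter n x s =
    \sum_(y <- r) y.1 *: (letter n x y.2.1 * letter n x y.2.2).
  rewrite -(hrel 1); first by case: ifP => _; rewrite scale1r.
  exact/relsT1.
rewrite mulr_sumr mulr_suml scaler_sumr; apply: eq_big_seq => -[d [a b]] /(allP hr) hy /=.
rewrite (twexp_step u w (a := a) (b := b) hy) -/c monom_mid -scalerAr -scalerAl !scalerA.
by congr (_ *: _); rewrite exprD invfM; ring.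
Qed.

Definition wgraph (z : U * X) : Prop := comb wpair (all valid) z.

Lemma wgraph_sorted z : wgraph z -> comb wpair (fun w => all valid w && sorted leq w) z.
Proof.
move=> [c [hc ->]]; apply: comb_sum => y hy; apply: straighten; last exact: (allP hc y hy).
exact: wpair_step.
Qed.
End Pairs.

Section Reps.
Variables (k : fieldType) (q : k) (n : nat).
Hypotheses (hq : transcendental q) (q0 : q != 0) (hn : (3 <= n)%N).
Local Notation valid := (fun a => 1 <= a <= n * 4)%N.
Local Notation E := (endo k (label n)).
Local Notation grade := (grade q n : E).
Local Notation qvac := (@qvac k n).
Local Notation qword w := (\prod_(l <- w) qroot q n l : E).

Lemma grade_word w : all valid w -> grade * qword w = q ^+ size w *: (qword w * grade).
Proof.
elim: w => [_|l w IHw /= /andP[hl /IHw h]]; first by rewrite big_nil mulr1 mul1r scale1r.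
rewrite !big_cons mulrA grade_root // -scalerAl -[_ * grade * _]mulrA h -scalerAr scalerA mulrA.
by rewrite exprS.
Qed.

Lemma grade_word_vac w : all valid w ->
  grade (qword w qvac) = fun s => q ^+ size w * qword w qvac s.
Proof.
move=> hw; transitivity ((grade * qword w) qvac); first by [].
rewrite grade_word //; apply: funext => s.
transitivity (q ^+ size w * qword w (grade qvac) s); first by [].
by rewrite grade_vac.
Qed.

(** Powers of [grade] only rescale what a word makes of the vacuum, so they cost nonzero scalars. *)
Lemma rep_word (A : algType k) (rho : A -> E) (g : nat -> A) : alg_hom rho ->
  (forall l, valid l -> exists2 e : k, e != 0 & exists b : bool,
     rho (g l) = e *: (qroot q n l * grade ^+ b)) ->
  forall w, all valid w -> exists2 a : k, a != 0 &
    forall s, rho (monom g w) qvac s = a * qword w qvac s.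
Proof.
move=> [_ [_ [rM r1]]] hg; elim=> [_|l w IHw /= /andP[hl hw]].
  by exists 1; rewrite ?oner_eq0 // => s; rewrite /monom !big_nil r1 mul1r.
have [a a0 ha] := IHw hw; have [e e0 [b hb]] := hg l hl.
exists (e * a * (q ^+ size w) ^+ b); first by rewrite !mulf_neq0 ?expf_neq0.
move=> s; rewrite /monom !big_cons rM hb -/(monom g w) -scalerAl -mulrA /=.
have -> : (rho (monom g w)) qvac = fun s => a * qword w qvac s by apply: funext.
have -> : (grade ^+ b : E) (fun s => a * qword w qvac s) =
    fun s => a * (q ^+ size w) ^+ b * qword w qvac s.
  rewrite eapp_scale; case: b hb => _ /=; last by apply: funext => r; rewrite mulr1.
  apply: funext => r; have := congr1 (fun f => f r) (grade_word_vac hw).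
  by rewrite !expr1 /= => ->; rewrite mulrA.
rewrite (eapp_scale (qroot q n l) _ (qword w qvac)) /= mulrA; move: (qroot _ _ _ _ _) => z; ring.
Qed.
End Reps.

(** * The graph and the isomorphism *)

Section Main.
Variables (k : fieldType) (q : k) (n : nat).
Hypotheses (q0 : q != 0) (hq : transcendental q) (hn : (3 <= n)%N).
Variables (U : algType k) (gU : Ugen n -> U).
Hypothesis HU : presented (@validU n) (@relsU k q n) gU.
Variables (T : nat -> U -> U).
Hypothesis HT : lusztig q gU T.
Variables (X : algType k) (gX : nat * nat -> X).
Hypothesis HX : presented (validX n) (@relsX k q n) gX.
Local Notation valid := (fun a => 1 <= a <= n * 4)%N.
Local Notation E := (endo k (label n)).
Local Notation rv := (rootvec gU T).
Let q2 := trans_q2 hq.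
Let qq := trans_qq hq q0.

Definition lsgn (l : nat) : k := if (l <= n.*2)%N then sgn k n l else sgn k n (l - n.*2).

Lemma lsgn2 l : lsgn l * lsgn l = 1.
Proof.
rewrite /lsgn; case: ifP => _; rewrite /sgn; case: ifP => _; rewrite ?mulr1 // -expr2 -exprM mulnC exprM.
  by rewrite sqrrN expr1n expr1n.
by rewrite sqrrN expr1n expr1n.
Qed.

Lemma lsgn_neq0 l : lsgn l != 0.
Proof. by apply/eqP => h; have := lsgn2 l; rewrite h mul0r => /esym/eqP; rewrite oner_eq0. Qed.

Lemma rootvec_letter : exists2 v : nat * nat -> U, relsT q q n v &
  forall l, valid l -> rv l = lsgn l *: letter n v l.
Proof.
have [HR _] := HU; have [v hv hrv] := rootvec_relsT q0 q2 qq hn HR HT.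
exists v => // l hl; rewrite /lsgn /letter; case: ifP => h.
  by have [-> _] := hrv l ltac:(lia).
have e : (n.*2 + (l - n.*2) = l)%N by lia.
by have [_ ] := hrv (l - n.*2)%N ltac:(lia); rewrite e.
Qed.

Lemma rep_rootvec : exists2 f : U -> E, alg_hom f & forall l, valid l -> f (rv l) = qroot q n l.
Proof.
have [HR Hu] := HU; have [f [hf [fg _]]] := Hu _ _ (tensor_rep_rels q0 q2 hn).
have frow t : (1 <= t <= n.*2)%N -> forall z,
    f (row (@qcomm k q U) n (fun i => gU (UE n i)) z t) =
    row (@qcomm k q E) n (fun i => tensor_rep q (UE n i)) (f z) t.
  move=> ht z; apply: (row_rel (R := fun a b => f a = b)) => // [a b _ _ <- <-|i hi].
    by rewrite hom_qcomm.
  by apply: fg => /=; lia.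
exists f => // l hl; rewrite /qroot; case: ifP => h.
  rewrite (rootvec1 q0 q2 hn HR HT); last by lia.
  by rewrite frow ?fg //=; lia.
have {1}-> : l = (n.*2 + (l - n.*2))%N by lia.
rewrite (rootvec2 q0 q2 qq hn HR HT); last by lia.
rewrite frow; last by lia.
congr (row _ _ _ _ _); rewrite !(xbarE hn) (hom_qcomm _ _ _ hf) (hom_qcomm _ _ _ hf).
have fl : f (gU (UE n n.+1)) = tensor_rep q (UE n n.+1) by apply: fg => /=.
have f0 : f (gU (UE n 0)) = tensor_rep q (UE n 0) by apply: fg => /=.
rewrite frow; last by lia.
rewrite frow; last by lia.
by rewrite fl f0.
Qed.

Section WithRows.
Variable v : nat * nat -> U.
Hypotheses (hv : relsT q q n v) (hrv : forall l, valid l -> rv l = lsgn l *: letter n v l).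

Lemma letter_rv l : valid l -> letter n v l = lsgn l *: rv l.
Proof. by move=> hl; rewrite hrv // scalerA lsgn2 scale1r. Qed.

Lemma valid_letter (p : nat * nat) : validX n p -> valid (rlet n p.1 p.2).
Proof. by move=> [h1 h2]; rewrite /rlet; case: eqP; lia. Qed.

(** The operators f(v_p), multiplied by [grade] in the second row, satisfy the untwisted relations
    by [relsT_twist]; the presentation of X then supplies the action. *)
Lemma rep_X (f : U -> E) : alg_hom f -> (forall l, valid l -> f (rv l) = qroot q n l) ->
  exists2 h : X -> E, alg_hom h & forall l, valid l -> exists b : bool,
    h (letter n gX l) = lsgn l *: (qroot q n l * (grade q n) ^+ b).
Proof.
move=> hf fr; have flet l : valid l -> f (letter n v l) = lsgn l *: qroot q n l.
  by move=> hl; rewrite letter_rv // homZ // fr.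
have hw : relsT q q n (fun p => f (v p)).
  refine (@relsT_transfer k q q n U E (fun a b => f a = b) _ _ _ _ _ v _ _ hv) => //.
  - exact: hom0.
  - by move=> a b a' b' <- <-; apply: homD.
  - by move=> c a a' <-; apply: homZ.
  - by move=> a b a' b' <- <-; apply: homM.
  by move=> a b b' <-.
have fv p : validX n p -> f (v p) = lsgn (rlet n p.1 p.2) *: qroot q n (rlet n p.1 p.2).
  move=> hp; rewrite -flet; last exact: valid_letter.
  by case: p hp => r l [h1 h2]; rewrite letterR.
have hG p : validX n p -> grade q n * f (v p) = q *: (f (v p) * grade q n).
  move=> hp; rewrite fv // -scalerAr grade_root //; last exact: valid_letter.
  by rewrite -scalerAl !scalerA mulrC.
have [_ Hu] := HX.
have [h [hh [hg _]]] := Hu E _ ((relsT1 _ _ _).2 (relsT_twist hG hw)).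
exists h => // l hl; rewrite /letter; case: ifP => hl2.
  exists false; rewrite hg; last by rewrite /validX /=; lia.
  by rewrite /twist /= mulr1 -flet // letter1.
exists true; rewrite hg; last by rewrite /validX /=; lia.
by rewrite /twist /= expr1 scalerAl -flet // /letter hl2.
Qed.

Local Notation G := (wgraph q n v gX).
Local Notation P := (wpair q n v gX).

(** Applied to differences this yields both single-valuedness and injectivity of the graph. Over
    sorted words, a zero component forces zero coefficients. *)
Lemma wgraph0 z : G z -> z.1 = 0 \/ z.2 = 0 -> z = 0.
Proof.
have hx : relsX q n gX by case: HX.
move=> /(wgraph_sorted q0 hv hx) [c [hc zE]] hz.
have [f hf fr] := rep_rootvec; have [h hh hl] := rep_X hf fr.
rewrite zE; case: hz; rewrite {}zE.
  rewrite (big_morph (fun z : U * X => z.1) (id1 := 0) (op1 := +%R)) //=.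
  apply: (free_of_rep hq q0 hn (rho := f)) => //.
  - by move=> a b; apply: homD.
  - by move=> a b; apply: homZ.
  apply: rep_word => // l hvl; exists (lsgn l); first exact: lsgn_neq0.
  by exists false; rewrite mulr1 letter_rv // homZ // fr.
rewrite (big_morph (fun z : U * X => z.2) (id1 := 0) (op1 := +%R)) //=.
apply: (free_of_rep hq q0 hn (rho := h) (m := fun w => q ^- twexp n w *: monom (letter n gX) w)) => //.
- by move=> a b; apply: homD.
- by move=> a b; apply: homZ.
move=> w hw; have [|a a0 ha] := rep_word q0 hn hh (g := letter n gX) _ hw.
  by move=> l hvl; exists (lsgn l); [exact: lsgn_neq0|apply: hl].
exists (q ^- twexp n w * a); first by rewrite mulf_neq0 ?invr_eq0 ?expf_neq0.
by move=> s; rewrite homZ //= ha mulrA.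
Qed.

Lemma wgraph_lin a z z' : G z -> G z' -> G (a *: z + z').
Proof.
move=> [c [hc ->]] [d [hd ->]]; exists (map (fun y => (a * y.1, y.2)) c ++ d).
rewrite all_cat all_map hc hd big_cat big_map scaler_sumr; split => //; congr (_ + _).
by apply: eq_bigr => y _; rewrite scalerA.
Qed.

Lemma wgraph_word w : all valid w -> G (P w).
Proof. by move=> hw; exists [:: (1, w)]; rewrite /= hw big_seq1 scale1r. Qed.

Lemma wgraph_zero : G 0. Proof. by exists [::]; rewrite big_nil. Qed.

Lemma wgraph_fun x z z' : G (x, z) -> G (x, z') -> z = z'.
Proof.
move=> h h'; have := wgraph_lin (-1) h' h; rewrite scaleN1r => /wgraph0.
rewrite /= addrC subrr => /(_ (or_introl erefl)) /(congr1 snd) /= /eqP.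
by rewrite addrC subr_eq0 => /eqP.
Qed.

Lemma wgraph_inj x x' z : G (x, z) -> G (x', z) -> x = x'.
Proof.
move=> h h'; have := wgraph_lin (-1) h' h; rewrite scaleN1r => /wgraph0.
rewrite /= addNr => /(_ (or_intror erefl)) /(congr1 fst) /= /eqP.
by rewrite addrC subr_eq0 => /eqP.
Qed.

Definition wsgn (w : seq nat) : k := \prod_(l <- w) lsgn l.

Lemma wsgn2 w : wsgn w * wsgn w = 1.
Proof. by rewrite -big_split big1 // => l _; apply: lsgn2. Qed.

Lemma monom_rv w : all valid w -> monom rv w = wsgn w *: monom (letter n v) w.
Proof.
elim: w => [_|l w IHw /= /andP[hl /IHw h]]; first by rewrite /monom /wsgn !big_nil scale1r.
rewrite /monom /wsgn !big_cons -/(monom rv w) h hrv // -scalerAl -scalerAr scalerA.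
by rewrite mulrC.
Qed.

Lemma wgraph_rv w : all valid w ->
  G (monom rv w, (wsgn w * q ^- twexp n w) *: monom (letter n gX) w).
Proof.
move=> hw; have := wgraph_lin (wsgn w) (wgraph_word hw) wgraph_zero.
by rewrite addr0 monom_rv // -scalerA.
Qed.

Lemma subalg_wgraph x : in_subalg valid rv x <-> exists z, G (x, z).
Proof.
split=> [[c [hc ->]]|[z [c [hc e]]]].
  exists (\sum_(y <- c) y.1 *: ((wsgn y.2 * q ^- twexp n y.2) *: monom (letter n gX) y.2)).
  elim: c hc => [_|y c IHc /= /andP[hy /IHc h]]; first by rewrite !big_nil; apply: wgraph_zero.
  by rewrite !big_cons; apply: (wgraph_lin y.1 (wgraph_rv hy) h).
exists (map (fun y => (y.1 * wsgn y.2, y.2)) c); split; first by rewrite all_map.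
have := congr1 fst e; rewrite (big_morph (fun z : U * X => z.1) (id1 := 0) (op1 := +%R)) //= => ->.
rewrite big_map; apply: eq_big_seq => y hy /=.
by rewrite (monom_rv (allP hc y hy)) scalerA -mulrA wsgn2 mulr1.
Qed.

(** The value 0 outside the subalgebra is arbitrary; [twisted_alg_iso] only constrains elements
    inside it. *)
Definition phi (x : U) : X :=
  if pselect (exists z, G (x, z)) is left h then projT1 (cid h) else 0.

Lemma phiE x z : G (x, z) -> phi x = z.
Proof.
move=> h; rewrite /phi; case: pselect => [h'|[]]; last by exists z.
by case: cid => z' h'' /=; apply: wgraph_fun h'' h.
Qed.

(** The exponent is the mixed term of [twexp_cat], so rescaling words by q to the power -[twexp]
    turns concatenation into the twisted product. *)
Lemma beta_word s t : all valid s -> all valid t ->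
  beta q (mdeg (@rootdeg n) s) (mdeg (@rootdeg n) t) =
  q ^+ (count (hi n) s * (size t + count (hi n) t)).
Proof.
have c0 w : all valid w -> coef_alpha0 (mdeg (@rootdeg n) w) = (count (hi n) w)%:Z /\
    coef_alphaLast (mdeg (@rootdeg n) w) = (size w + count (hi n) w)%:Z.
  elim: w => [_|l w IHw /= /andP[hl /IHw [h1 h2]]].
    by rewrite /mdeg big_nil /coef_alpha0 /coef_alphaLast !mxE.
  rewrite /mdeg big_cons (coefD _ _).1 (coefD _ _).2 -/(mdeg _ w) h1 h2.
  by have [-> ->] := coef_rootdeg hn hl; rewrite /hi; split; lia.
move=> hs ht; have [hs0 _] := c0 s hs; have [_ ht1] := c0 t ht.
by rewrite /beta hs0 ht1 -PoszM.
Qed.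

Lemma phi_iso : twisted_alg_iso valid rv (@rootdeg n) (beta q (n:=n)) phi.
Proof.
have graph x : in_subalg valid rv x -> G (x, phi x).
  by move=> /subalg_wgraph [z hz]; rewrite (phiE hz).
split; [|split; [|split; [|split; [|split]]]].
- move=> x y /graph hx /graph hy; apply: phiE.
  by have := wgraph_lin 1 hx hy; rewrite scale1r.
- move=> a x /graph hx; apply: phiE.
  by have := wgraph_lin a hx wgraph_zero; rewrite addr0.
- by apply: phiE; have := wgraph_rv (w := [::]) isT;
    rewrite /monom /wsgn !big_nil /= expr0 invr1 mulr1 scale1r.
- move=> s t hs ht; have hst : all valid (s ++ t) by rewrite all_cat hs ht.
  have -> : monom rv s * monom rv t = monom rv (s ++ t) by rewrite /monom big_cat.
  rewrite !(phiE (wgraph_rv _)) // beta_word // twexp_cat -scalerAl -scalerAr !scalerA.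
  have -> : monom (letter n gX) (s ++ t) = monom (letter n gX) s * monom (letter n gX) t.
    by rewrite /monom big_cat.
  have -> : wsgn (s ++ t) = wsgn s * wsgn t by rewrite /wsgn big_cat.
  congr (_ *: _); rewrite !exprD.
  move: (twexp n s) (twexp n t) (_ * _)%N => a b c.
  have A : q ^+ a != 0 by rewrite expf_neq0.
  have B : q ^+ b != 0 by rewrite expf_neq0.
  have C : q ^+ c != 0 by rewrite expf_neq0.
  by move: (q ^+ a) (q ^+ b) (q ^+ c) A B C => x y z A B C; field; rewrite A B C.
- move=> x y /graph hx /graph hy e; rewrite e in hx.
  exact: wgraph_inj hx hy.
move=> z; have [c [hc ->]] := generated HX z.
(* The weights cancel the scalars in the second component of [wpair], so that this component of y is
   the given element. *)
pose y := \sum_(i <- c) (i.1 * q ^+ twexp n i.2) *: P i.2.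
have hy : G y.
  exists (map (fun i => (i.1 * q ^+ twexp n i.2, i.2)) c).
  by rewrite all_map big_map.
have y2 : y.2 = \sum_(i <- c) i.1 *: monom (letter n gX) i.2.
  rewrite /y (big_morph (fun z : U * X => z.2) (id1 := 0) (op1 := +%R)) //=.
  by apply: eq_bigr => i _; rewrite scalerA mulfK ?expf_neq0.
exists y.1; first by apply/subalg_wgraph; exists y.2; case: (y) hy.
by rewrite -y2; apply: phiE; case: (y) hy.
Qed.

Lemma phi_rv l : valid l -> phi (rv l) = lsgn l *: letter n gX l.
Proof.
move=> hl; apply: phiE; have := wgraph_rv (w := [:: l]).
rewrite /= hl /monom /wsgn !big_seq1 muln0 expr0 invr1 mulr1; exact.
Qed.
End WithRows.

Lemma twisted_iso_exists : exists phi : U -> X,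
  twisted_alg_iso valid rv (@rootdeg n) (beta q (n:=n)) phi /\
  forall l, valid l -> phi (rv l) = lsgn l *: letter n gX l.
Proof.
have [v hv hrv] := rootvec_letter; exists (phi v); split; first exact: phi_iso.
by move=> l; apply: phi_rv.
Qed.
End Main.

Theorem theorem5p2 (k : closedFieldType) (hchar : [pchar k] =i pred0)
  (q : k) (hq0 : q != 0) (hq : transcendental q)
  (n : nat) (hn : (3 <= n)%N)
  (U : algType k) (gU : Ugen n -> U) (HU : presented (@validU n) (@relsU k q n) gU)
  (T : nat -> U -> U) (HT : lusztig q gU T)
  (X : algType k) (gX : nat * nat -> X) (HX : presented (validX n) (@relsX k q n) gX) :
  let rv := rootvec gU T in
  let Xv i := rv (n.+1 - i)%N in
  let Yv i := rv (n + i)%N in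
  let Xbv i := rv (n * 3 + 1 - i)%N in
  let Ybv i := rv (n * 3 + i)%N in
  exists phi : U -> X,
    ((twisted_alg_iso (fun l => (1 <= l <= n * 4)%N) rv (@rootdeg n) (beta q (n:=n)) phi) /\ ((forall i, (1 <= i <= n)%N -> phi (Xv i) = (-1) ^+ (n.+1 - i) *: gX (1%N, (n.+1 - i)%N))) /\ ((forall i, (1 <= i <= n)%N -> phi (Xbv i) = (-1) ^+ (n.+1 - i) *: gX (2%N, (n.+1 - i)%N))) /\ ((forall i, (1 <= i <= n)%N -> phi (Yv i) = gX (1%N, (n + i)%N))) /\ ((forall i, (1 <= i <= n)%N -> phi (Ybv i) = gX (2%N, (n + i)%N)))).
Proof.
move=> rv Xv Yv Xbv Ybv.
have [phi [hphi hl]] := twisted_iso_exists hq0 hq hn HU HT HX.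
have h1 t : (1 <= t <= n.*2)%N -> phi (rv t) = sgn k n t *: gX (1%N, t).
  move=> ht; rewrite hl /lsgn /letter; last by lia.
  by have -> : (t <= n.*2)%N by lia.
have h2 t : (1 <= t <= n.*2)%N -> phi (rv (n.*2 + t)%N) = sgn k n t *: gX (2%N, t).
  move=> ht; rewrite hl /lsgn /letter; last by lia.
  by rewrite (_ : (n.*2 + t <= n.*2)%N = false) ?addKn //; lia.
exists phi; split=> //; split; [|split; [|split]] => i hi.
- rewrite h1; last by lia.
  by rewrite /sgn (_ : (n.+1 - i <= n)%N) //; lia.
- rewrite /Xbv (_ : (n * 3 + 1 - i = n.*2 + (n.+1 - i))%N); last by lia.
  rewrite h2; last by lia.
  by rewrite /sgn (_ : (n.+1 - i <= n)%N) //; lia.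
- rewrite h1; last by lia.
  by rewrite /sgn (_ : (n + i <= n)%N = false) ?scale1r //; lia.
rewrite /Ybv (_ : (n * 3 + i = n.*2 + (n + i))%N); last by lia.
rewrite h2; last by lia.
by rewrite /sgn (_ : (n + i <= n)%N = false) ?scale1r //; lia.
Qed.
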